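(* Let $H\in(0,1)$ and $\Delta>0$, and let $Y$ be the solution of $Y_t=x+\int_0^t b(Y_s)\,ds+\sigma B_t$, $t\ge 0$, where $B$ is a $d$-dimensional fractional Brownian motion with Hurst parameter $H$, $\sigma$ is a real $d\times d$ matrix, $x\in\mathbb{R}^d$, and $b:\mathbb{R}^d\to\mathbb{R}^d$ is continuous and such that, for some constants $\alpha,L>0$, $\langle b(y)-b(z),y-z\rangle\le-\alpha|y-z|^2$ and $|b(y)-b(z)|\le L|y-z|$ for all $y,z\in\mathbb{R}^d$. Then: (i) there exists a constant $C_{H,\Delta,\sigma}>0$ such that for all $n\in\mathbb{N}^*$, all Lipschitz functions $F:((\mathbb{R}^d)^n,d_n)\to(\mathbb{R},|\cdot|)$ and all $r\ge 0$, setting $F_Y:=F(Y_{\Delta},Y_{2\Delta},\dots,Y_{n\Delta})$, $$\mathbb{P}\left(F_Y-\mathbb{E}[F_Y]>r\right)\le\exp\left(-\frac{r^2}{4C_{H,\Delta,\sigma}\|F\|_{\rm Lip}^2 n^{2H\vee 1}}\right);$$ (ii) there exists a constant $\tilde C_{H,\sigma}>0$ such that for all $T\ge 1$, all Lipschitz functions $\tilde F:(\mathcal{C}([0,T],\mathbb{R}^d),d_T)\to(\mathbb{R},|\cdot|)$ and all $r\ge 0$, setting $\tilde F_Y:=\tilde F((Y_t)_{t\in[0,T]})$, $$\mathbb{P}\left(\tilde F_Y-\mathbb{E}[\tilde F_Y]>r\right)\le\exp\left(-\frac{r^2}{4\tilde C_{H,\sigma}\|\tilde F\|_{\rm Lip}^2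 T^{2H\vee 1}}\right).$$
   Context: $|\cdot|$ is the Euclidean norm and $\langle\cdot,\cdot\rangle$ the scalar product on $\mathbb{R}^d$; $a\vee b=\max(a,b)$; $\mathbb{N}^*=\{1,2,\dots\}$. For $x,y\in(\mathbb{R}^d)^n$, $d_n(x,y)=\sum_{i=1}^n|x_i-y_i|$. For $x,y\in\mathcal{C}([0,T],\mathbb{R}^d)$ (continuous functions), $d_T(x,y)=\int_0^T|x_t-y_t|\,dt$. For a Lipschitz map $F$ between metric spaces $(E,d_E)$ and $(E',d_{E'})$, $\|F\|_{\rm Lip}=\sup_{x\ne y}d_{E'}(F(x),F(y))/d_E(x,y)$. When the Lipschitz norm is $0$, the right-hand sides are read as $0$ for $r>0$ and $1$ for $r=0$. A $d$-dimensional fractional Brownian motion with Hurst parameter $H$ has independent components that are continuous centered Gaussian processes with covariance $\frac12(t^{2H}+s^{2H}-|t-s|^{2H})$. The dimension $d$ and the drift $b$ are fixed data, on which constants may depend; apart from these, $C_{H,\Delta,\sigma}$ depends only on $H,\Delta,\sigma$, and $\tilde C_{H,\sigma}$ only on $H,\sigma$. *)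

(* Defs.v *)
From HB Require Import structures.
From mathcomp Require Import all_boot all_order all_algebra.
From mathcomp Require Import all_classical all_reals all_analysis.

Set Implicit Arguments.
Unset Strict Implicit.
Unset Printing Implicit Defensive.

Import Order.TTheory GRing.Theory Num.Theory.
Import numFieldNormedType.Exports.

Local Open Scope classical_set_scope.
Local Open Scope ring_scope.

Section euclidean.
Context {R : realType} {d : nat}.
Implicit Types x y : 'cV[R]_d.

Definition scalprod x y : R := \sum_(i < d) x i 0 * y i 0.

(* The library norm on matrices is the sup norm; it induces the same topology,
   but the Lipschitz norms below refer to the Euclidean one. *)
Definition enorm x : R := Num.sqrt (scalprod x x).

End euclidean.

Section lipschitz.
Context {R : realType} {E : Type} (dist : E -> E -> R).

Definition lipschitz_wrt (F : E -> R) :=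
  exists k : R, forall x y, `|F x - F y| <= k * dist x y.

Definition lip_norm (F : E -> R) : R :=
  sup [set q | exists x y, x <> y /\ q = `|F x - F y| / dist x y].

End lipschitz.

(* The bound exp(- r^2 / (4 C lip^2 s)), with its limit value when lip = 0. *)
Definition concentration_bound {R : realType} (C lip s r : R) : R :=
  if lip == 0 then (if r == 0 then 1 else 0)
  else expR (- (r ^+ 2 / (4 * C * lip ^+ 2 * s))).

Definition dist_n {R : realType} {d n : nat} (x y : 'I_n -> 'cV[R]_d) : R :=
  \sum_(i < n) enorm (x i - y i).

(* Continuous maps on the subtype of the reals lying in [0, T]. *)
Definition cpath {R : realType} (d : nat) (T : R) : Type :=
  continuousType (`[0, T]%classic : Type) 'cV[R]_d.

(* 'valL_0 only extends the integrand outside [0, T]. *)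
Definition dist_T {R : realType} {d : nat} {T : R} (x y : cpath d T) : R :=
  \int[lebesgue_measure]_(t in `[0, T])
    'valL_0 (fun u : (`[0, T]%classic : Type) => enorm (x u - y u)) t.

Section restriction.
Context {R : realType} {d : nat}.

Lemma restrict_continuous (T : R) (w : R -> 'cV[R]_d) :
  {within `[0, +oo[, continuous w} ->
  continuous (w \o set_val : (`[0, T]%classic : Type) -> 'cV[R]_d).
Proof.
move=> cw; apply/subspace_sigL_continuousP.
apply: continuous_subspaceW cw => t /=.
by rewrite !in_itv/= => /andP[->].
Qed.

Definition restrict_path (T : R) (w : R -> 'cV[R]_d)
    (cw : {within `[0, +oo[, continuous w}) : cpath d T :=
  mkcts (@restrict_continuous T w cw).

End restriction.

Section processes.
Context {R : realType} {disp : measure_display} {Omega : measurableType disp}.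
Variable P : probability Omega R.

(* Degenerate laws are Dirac masses; normal_prob m 0 is a junk value. *)
Definition gaussian (X : Omega -> R) :=
  exists m s : R, forall A : set R, measurable A ->
    P (X @^-1` A) = if s == 0 then \d_m A else normal_prob m s A.

(* Processes are indexed by R, but only times t >= 0 are ever constrained. *)
Definition gaussian_process (X : R -> {RV P >-> R}) :=
  forall (n : nat) (t a : 'I_n -> R), (forall k, 0 <= t k) ->
    gaussian (fun w => \sum_(k < n) a k * X (t k) w).

Definition process_sigma_algebra (X : R -> {RV P >-> R}) : set (set Omega) :=
  <<s \bigcup_(t in `[0, +oo[) preimage_set_system setT (X t) measurable >>.

(* Product rules over subfamilies are the instances where some A i = setT. *)
Definition independent_processes (d : nat) (X : 'I_d -> R -> {RV P >-> R}) :=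
  forall A : 'I_d -> set Omega,
    (forall i, process_sigma_algebra (X i) (A i)) ->
    P (\bigcap_i A i) = (\prod_(i < d) P (A i))%E.

Record fbm1 (H : R) (X : R -> {RV P >-> R}) : Prop := {
  fbm1_gaussian : gaussian_process X ;
  fbm1_centered : forall t, 0 <= t -> 'E_P[X t]%E = 0%E ;
  fbm1_covariance : forall s t, 0 <= s -> 0 <= t ->
    covariance P (X t) (X s) =
      (2^-1 * (t `^ (2 * H) + s `^ (2 * H) - `|t - s| `^ (2 * H)))%:E ;
  fbm1_continuous : forall w, {within `[0, +oo[, continuous (fun t => X t w)} }.

Record fbm (d : nat) (H : R) (B : 'I_d -> R -> {RV P >-> R}) : Prop := {
  fbm_component : forall i, fbm1 H (B i) ;
  fbm_independent : independent_processes B }.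

Definition vproc (d : nat) (X : 'I_d -> R -> {RV P >-> R}) (t : R) (w : Omega) :
  'cV[R]_d := \col_i X i t w.

Record solution (d : nat) (b : 'cV[R]_d -> 'cV[R]_d) (sigma : 'M[R]_d)
    (x : 'cV[R]_d) (B Y : 'I_d -> R -> {RV P >-> R}) : Prop := {
  solution_continuous :
    forall w, {within `[0, +oo[, continuous (fun t => vproc Y t w)} ;
  solution_equation : forall w t, 0 <= t ->
    vproc Y t w =
      x + \col_i (\int[lebesgue_measure]_(s in `[0, t]) (b (vproc Y s w)) i 0)
        + sigma *m vproc B t w }.

Definition solution_path (d : nat) (b : 'cV[R]_d -> 'cV[R]_d)
    (sigma : 'M[R]_d) (x : 'cV[R]_d) (B Y : 'I_d -> R -> {RV P >-> R})
    (hY : solution b sigma x B Y) (T : R) (w : Omega) : cpath d T :=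
  restrict_path T (@solution_continuous _ _ _ _ _ _ hY w).

End processes.

(* Main.v *)
Require Import Defs.
From HB Require Import structures.
From mathcomp Require Import all_boot all_order all_algebra.
From mathcomp Require Import all_classical all_reals all_analysis.
From mathcomp Require Import measurable_realfun ring lra.

Set Implicit Arguments.
Unset Strict Implicit.
Unset Printing Implicit Defensive.

Import Order.TTheory GRing.Theory Num.Theory.
Import numFieldNormedType.Exports.

Local Open Scope classical_set_scope.
Local Open Scope ring_scope.

(** The equation enters only through a pathwise Lipschitz estimate, and the law of the noise only
    through a Gaussian exponential inequality.

    Pathwise part. Fix a mesh [D] ([Delta] in (i), 1 in (ii)) and two solutions from the same
    starting point, driven by noises with difference [h]. On a block [kD, (k+1)D], subtract the
    increment h_t - h_{kD} from the difference of the solutions. The remainder u is absolutely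
    continuous, and the assumptions on [b] give |u|' <= - alpha |u| + L |h_t - h_{kD}|. Integrating
    over each block and telescoping bounds both the time integral and the sampled sum of the
    distance by a constant, independent of the number of blocks, times the block variation of [h]
    ([block_contraction], [two_solutions_bound], [solution_paths_bound]). So F(Y) is Lipschitz in
    [B] for [block_variation], and the power of n or T comes from the Gaussian part alone.

    Gaussian part. Let X be a finite centered Gaussian family, X' an independent copy and f
    Lipschitz with coordinatewise weights. Rotating X into X' along a quarter circle, cutting the
    circle into small arcs and using convexity of exp gives E exp(f(X') - f(X)) <= exp(pi^2 Q / 8),
    where Q bounds the variance of the linear forms whose coefficients are dominated by the weights
    ([maurey_pisier]). For increments of fractional Brownian motion inside n blocks, the covariance
    at block distance l is at most half a second difference of x^(2H). These telescope, so Q is of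
    order K^2 D^(2H) n^(max(2H,1)) ([increments_form_bound]).

    Rotation invariance is expressed through averages of cos(<a,X> + c), which determine the
    averages of exp of Lipschitz functions: trigonometric polynomials form an algebra, and Bernstein
    polynomials in sin(x_j / r) approximate Lipschitz functions ([lip_expR_same_integral]).

    Passage to paths. Riemann sums turn the block variation into a function of finitely many
    increments, up to an error that vanishes for each path. A functional that is Lipschitz up to
    such an error is a pointwise limit of minima of finitely many smoothed cones centred at a dense
    sequence of outcomes ([approximation_expR]). This yields its measurability and, by Fatou, the
    exponential inequality. Jensen in one of the two copies, Markov, and the optimal exponent
    conclude ([chernoff_expR]). *)

(** * Elementary inequalities and limits for sin, cos and exp *)

Section real_inequalities.
Context {R : realType}.
Implicit Types x y : R.

Lemma sin_lip x y : `|sin x - sin y| <= `|x - y|.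
Proof.
wlog xy : x y / x <= y => [H|].
  by case/orP: (le_total x y) => /H //; rewrite (distrC (sin _)) (distrC x).
have [c _ E] : exists2 c, c \in `[x, y] & sin y - sin x = cos c * (y - x).
  apply: MVT_segment => //.
  by apply/continuous_subspaceT; exact: continuous_sin.
by rewrite distrC E normrM (distrC x) ler_piMl// cos_max.
Qed.

Lemma cos_lip x y : `|cos x - cos y| <= `|x - y|.
Proof.
rewrite -!sinDpihalf (le_trans (sin_lip _ _))//.
by rewrite opprD addrACA subrr addr0.
Qed.

Lemma sin_sub_bound x : `|sin x - x| <= x ^+ 2.
Proof.
have cc : continuous (fun x : R => sin x - x).
  move=> z; apply: (@cvgB _ R^o); [exact: continuous_sin|exact: cvg_id].
have dd (z : R) : is_derive z 1 (fun x : R => sin x - x) (cos z - 1).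
  by apply: is_deriveB.
have C (z : R) : `|cos z - 1| <= `|z|.
  by rewrite -[1]cos0 (le_trans (cos_lip _ _))// subr0.
have [x0|x0] := leP 0 x.
- have [c] := MVT_segment x0 (fun z _ => dd z) (continuous_subspaceT cc).
  rewrite in_itv/= => /andP[c0 cx]; rewrite sin0 !subr0 => ->.
  rewrite normrM (ger0_norm x0) expr2 ler_wpM2r// (le_trans (C _))//.
  by rewrite ger0_norm.
- have [c] := MVT_segment (ltW x0) (fun z _ => dd z) (continuous_subspaceT cc).
  rewrite in_itv/= => /andP[c0 cx]; rewrite sin0 !subr0 !sub0r => /eqP.
  rewrite eqr_oppLR => /eqP ->; rewrite normrN normrM normrN.
  rewrite -[x ^+ 2]ger0_norm ?sqr_ge0// normrX expr2 ler_wpM2r//.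
  rewrite (le_trans (C _))// !ler0_norm ?lerN2//; exact: ltW.
Qed.

(** Serves twice: bounded trigonometric coordinates r sin(x / r) exhaust the line, and n small
    rotation steps add up to the full angle. *)
Lemma cvg_scaled_sin x : (fun n : nat => n.+1%:R * sin (x / n.+1%:R)) @ \oo --> x.
Proof.
apply/cvgrPdist_le => e e0.
have q0 : 0 < x ^+ 2 + 1 by rewrite ltr_wpDl// sqr_ge0.
have /cvgrPdist_le/(_ _ (divr_gt0 e0 q0)) [N _ HN] := @cvg_harmonic R.
exists N => // n /HN; rewrite /= sub0r normrN ger0_norm ?invr_ge0// => Hn.
have n0 : (0:R) < n.+1%:R by rewrite ltr0n.
rewrite distrC -{2}(mulrVK (unitf_gt0 n0) x) -[X in _ - X]mulrC -mulrBr normrM.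
rewrite ger0_norm// (le_trans (ler_wpM2l (ltW n0) (sin_sub_bound _)))//.
have -> : n.+1%:R * (x / n.+1%:R) ^+ 2 = x ^+ 2 / n.+1%:R :> R.
  by field; rewrite addrC natr1 gt_eqF.
rewrite ler_pdivlMr// in Hn; apply: le_trans Hn.
by rewrite mulrC ler_wpM2l ?invr_ge0 ?ltW//; lra.
Qed.

Lemma cos_ge_quad x : 1 - x ^+ 2 / 2 <= cos x.
Proof.
have -> : cos x = 1 - 2 * sin (x / 2) ^+ 2.
  have {1}-> : x = (x / 2) *+ 2 by rewrite -mulr_natr divfK.
  rewrite cos_mulr2n.
  by rewrite cos2sin2; ring.
have : `|sin (x / 2)| <= `|x / 2| by have := sin_lip (x/2) 0; rewrite sin0 !subr0.
rewrite -ler_sqr ?nnegrE// !real_normK ?num_real// exprMn; lra.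
Qed.

(** Integrating the second derivative of the difference, e^x + e^(-x) - 2 >= 0, twice. Together with
    [cos_ge_quad] it compares a Gaussian transform with the second moment. *)
Lemma cosh_ge_quad x : 2 + x ^+ 2 <= expR x + expR (- x).
Proof.
have H y : 0 <= y -> 2 + y ^+ 2 <= expR y + expR (- y).
  move=> y0; pose f z : R := expR z + expR (- z) - z ^+ 2.
  have df (z : R) : is_derive z 1 f (expR z - expR (- z) - 2 * z).
    rewrite /f; apply: is_deriveB => //.
      apply: is_deriveD.
      by apply: is_derive_eq; rewrite mulrN1.
    by apply: is_derive_eq; rewrite /GRing.scale/= ?mulr1; ring.
  pose g z : R := expR z - expR (- z) - 2 * z.
  have dg (z : R) : is_derive z 1 g (expR z + expR (- z) - 2).
    rewrite /g; apply: is_deriveB => //.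
      have -> : expR z + expR (- z) = expR z - (- expR (- z)) by rewrite opprK.
      apply: is_deriveB.
      by apply: is_derive_eq; rewrite mulrN1.
    by apply: is_derive_eq; rewrite /GRing.scale/= mulr1.
  have cf : continuous f by move=> z; apply/differentiable_continuous/derivable1_diffP; case: (df z).
  have cg : continuous g by move=> z; apply/differentiable_continuous/derivable1_diffP; case: (dg z).
  have g0 z : 0 <= z -> 0 <= g z.
    move=> z0; have [c _] := MVT_segment z0 (fun z _ => dg z) (continuous_subspaceT cg).
    have -> : g 0 = 0 by rewrite /g oppr0 expR0 mulr0; ring.
    rewrite subr0 => ->; rewrite subr0 mulr_ge0//.
    have := sqr_ge0 (expR (c / 2) - expR (- (c / 2))).
    rewrite sqrrB -!expRM_natl -expRD subrr expR0.
    by rewrite mulrN mulrCA divff// mulr1; lra.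
  have [c] := MVT_segment y0 (fun z _ => df z) (continuous_subspaceT cf).
  rewrite in_itv/= => /andP[c0 _].
  have -> : f 0 = 2 by rewrite /f oppr0 expR0; ring.
  rewrite /f subr0 => E; have : 0 <= (expR c - expR (- c) - 2 * c) * y by rewrite mulr_ge0// g0.
  rewrite -E; lra.
have [/H//|/ltW x0] := leP 0 x.
by have := H (- x); rewrite sqrrN opprK [expR _ + _]addrC; apply; rewrite oppr_ge0.
Qed.

End real_inequalities.

Lemma cvg_sumr {R : realType} {I T : Type} {F : set_system T} {FF : Filter F}
    (s : seq I) (f : I -> T -> R) (l : I -> R) :
  (forall i, f i @ F --> l i) ->
  (fun t => \sum_(i <- s) f i t) @ F --> \sum_(i <- s) l i.
Proof.
move=> fl; elim: s => [|i s IH].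
  rewrite big_nil; under eq_fun do rewrite big_nil; exact: cvg_cst.
rewrite big_cons; under eq_fun do rewrite big_cons.
exact: cvgD.
Qed.

Lemma normr_le_cvg0 {R : realType} (u v : nat -> R) :
  (forall n, `|u n| <= v n) -> v @ \oo --> (0 : R) -> u @ \oo --> (0 : R).
Proof.
move=> uv v0.
have nv : (fun n => - v n) @ \oo --> (0 : R) by rewrite -[X in _ --> X]oppr0; exact: cvgN.
apply: (squeeze_cvgr _ nv v0).
by apply: nearW => n; rewrite -ler_norml.
Qed.

(** Jensen for the uniform law on [I]: the values N a_i have mean m, and each e^(N a_i) lies above
    the tangent of exp at m. *)
Lemma expR_mean_le {R : realType} {I : finType} (a : I -> R) : (0 < #|I|)%N ->
  expR (\sum_i a i) <= #|I|%:R^-1 * \sum_i expR (#|I|%:R * a i).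
Proof.
move=> I0; set N : R := #|I|%:R.
have N0 : 0 < N by rewrite ltr0n.
set m := \sum_i a i.
have tangent i : expR m * (1 + (N * a i - m)) <= expR (N * a i).
  have -> : expR (N * a i) = expR m * expR (N * a i - m) by rewrite -expRD addrC subrK.
  by rewrite ler_wpM2l ?expR_ge0 ?expR_ge1Dx.
rewrite mulrC ler_pdivlMr// (le_trans _ (ler_sum _ (fun i _ => tangent i)))//.
rewrite -mulr_sumr big_split/= sumr_const sumrB -mulr_sumr sumr_const -/m.
by rewrite -[m *+ _]mulr_natl subrr addr0.
Qed.

Section limits.
Context {R : realType}.
Implicit Types x y v : R.

Lemma cvg_harmonicZ x : (fun n : nat => x * n.+1%:R^-1) @ \oo --> (0 : R).
Proof.
by rewrite -[X in _ --> X](mulr0 x); apply: cvgM; [exact: cvg_cst|exact: cvg_harmonic].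
Qed.

Lemma cvg_scaled_cos x :
  (fun n : nat => n.+1%:R * (cos (x / n.+1%:R) - 1)) @ \oo --> (0 : R).
Proof.
apply: normr_le_cvg0 (cvg_harmonicZ (x ^+ 2)) => n.
rewrite normrM ger0_norm// distrC ger0_norm ?subr_ge0 ?cos_le1//.
have -> : x ^+ 2 * n.+1%:R^-1 = n.+1%:R * (x / n.+1%:R) ^+ 2.
  by field; rewrite addrC natr1 gt_eqF.
rewrite ler_wpM2l//; set y := x / _; have := cos_ge_quad y.
by have := sqr_ge0 y; lra.
Qed.

Lemma minr_dist x y v : `|Num.min x v - Num.min y v| <= `|x - y|.
Proof.
wlog xy : x y / x <= y => [H|].
  by have [/H //|/ltW /H] := leP x y; rewrite distrC (distrC y).
rewrite distrC (distrC x) [X in _ <= X]ger0_norm ?subr_ge0// ger0_norm; last first.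
  by rewrite subr_ge0 le_min !ge_min xy lexx orbT.
have [yv|vy] := leP y v.
  by rewrite (min_l (le_trans xy yv)).
have [xv|vx] := leP x v; first by rewrite lerD2r ltW.
by rewrite subrr subr_ge0.
Qed.

Lemma cvg_minr_cst (u : nat -> R) x v : u @ \oo --> x ->
  (fun n => Num.min (u n) v) @ \oo --> Num.min x v.
Proof.
move=> ux; apply/cvgrPdist_le => e e0; move/cvgrPdist_le/(_ _ e0) : ux => [N _ HN].
by exists N => // n /HN /=; apply: le_trans; exact: minr_dist.
Qed.

End limits.

(** * Bounded measurable functions under a probability *)

Section bounded_measurable.
Context d (T : measurableType d) (R : realType).

Definition bounded_mfun (f : T -> R) :=
  measurable_fun setT f /\ exists M, forall x, `|f x| <= M.

Lemma bounded_mfun_cst c : bounded_mfun (cst c).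
Proof. by split => //; exists `|c|. Qed.

Lemma bounded_mfunD f g : bounded_mfun f -> bounded_mfun g ->
  bounded_mfun (fun x => f x + g x).
Proof.
move=> [mf [M Mf]] [mg [N Ng]]; split; first exact: measurable_funD.
by exists (M + N) => x; rewrite (le_trans (ler_normD _ _))// lerD.
Qed.

Lemma bounded_mfunM f g : bounded_mfun f -> bounded_mfun g ->
  bounded_mfun (fun x => f x * g x).
Proof.
move=> [mf [M Mf]] [mg [N Ng]]; split; first exact: measurable_funM.
by exists (M * N) => x; rewrite normrM ler_pM.
Qed.

Lemma bounded_mfunZ c f : bounded_mfun f -> bounded_mfun (fun x => c * f x).
Proof. by move=> bf; apply: bounded_mfunM => //; exact: bounded_mfun_cst. Qed.

Lemma bounded_mfun_cos f : measurable_fun setT f -> bounded_mfun (fun x => cos (f x)).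
Proof.
move=> mf; split; last by exists 1 => x; exact: cos_max.
by apply: measurableT_comp mf; apply: continuous_measurable_fun; exact: continuous_cos.
Qed.

Lemma bounded_mfun_integrable (P : probability T R) f :
  bounded_mfun f -> P.-integrable setT (EFin \o f).
Proof.
move=> [mf [M Mf]]; apply: measurable_bounded_integrable => //.
  by apply: le_lt_trans (ltry 1); exact: probability_le1.
exists M; split; first exact: num_real.
by move=> K MK x _; apply: le_trans (ltW MK).
Qed.

Lemma bounded_mfun_cvg (P : probability T R) (f_ : nat -> T -> R) f M :
  (forall n, bounded_mfun (f_ n)) -> (forall n x, `|f_ n x| <= M) ->
  (forall x, (fun n => f_ n x) @ \oo --> f x) ->
  bounded_mfun f /\ \int[P]_x f_ n x @[n --> \oo] --> \int[P]_x f x.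
Proof.
move=> bf Mf ff.
have bdf : bounded_mfun f.
  split.
    apply: (@measurable_fun_cvg _ _ _ _ f_) => //.
    by move=> n; case: (bf n).
  exists M => x; apply: (ler_cvg_to (cvg_norm (ff x)) (cvg_cst M)).
  by apply: nearW => n; exact: Mf.
split=> //; apply: fine_cvg; rewrite fineK; last first.
  by apply: integrable_fin_num => //; exact: bounded_mfun_integrable.
apply: (@dominated_cvg _ _ _ _ _ measurableT _ _ (cst M%:E)) => //.
- by move=> n; apply/measurable_EFinP; case: (bf n).
- by move=> x _; apply: cvg_EFin; [exact: nearW|exact: ff].
- by apply: (@bounded_mfun_integrable P (cst M)); exact: bounded_mfun_cst.
- by move=> n x _; rewrite lee_fin.
Qed.

Lemma bounded_mfunN f : bounded_mfun f -> bounded_mfun (fun x => - f x).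
Proof.
move=> [mf [M Mf]]; split; last by exists M => x; rewrite normrN.
exact: measurableT_comp.
Qed.

Lemma bounded_RintegralD (P : probability T R) f g :
  bounded_mfun f -> bounded_mfun g ->
  \int[P]_x (f x + g x) = \int[P]_x f x + \int[P]_x g x.
Proof. by move=> bf bg; rewrite RintegralD//; exact: bounded_mfun_integrable. Qed.

Lemma bounded_RintegralZ (P : probability T R) c f :
  bounded_mfun f -> \int[P]_x (c * f x) = c * \int[P]_x f x.
Proof. by move=> bf; rewrite RintegralZl//; exact: bounded_mfun_integrable. Qed.

Lemma Rintegral_probability_cst (P : probability T R) (r : R) : \int[P]_x r = r.
Proof.
rewrite /Rintegral integral_cst//.
by rewrite -[X in (_ * X)%E]/(P setT) probability_setT mule1.
Qed.

End bounded_measurable.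

(** * Binomial averages and the error of Bernstein approximation *)

Section binomial_average.
Context {R : realType}.
Implicit Types (u : R) (g : nat -> R).

(* Expectation of [g] under the binomial law with parameters [n] and [u];
   [binomial_mean n u (fun k => h (k / n))] is the Bernstein polynomial of [h]. *)
Fixpoint binomial_mean n u g : R :=
  if n is m.+1 then
    u * binomial_mean m u (fun k => g k.+1) + (1 - u) * binomial_mean m u g
  else g 0%N.

Lemma le_binomial_mean n u g1 g2 : 0 <= u <= 1 ->
  (forall k, g1 k <= g2 k) -> binomial_mean n u g1 <= binomial_mean n u g2.
Proof.
move=> /andP[u0 u1]; elim: n g1 g2 => //= n IH g1 g2 g12.
by rewrite lerD// ler_wpM2l ?subr_ge0// IH.
Qed.

Lemma binomial_meanD n u g1 g2 :
  binomial_mean n u (fun k => g1 k + g2 k) =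
  binomial_mean n u g1 + binomial_mean n u g2.
Proof. by elim: n g1 g2 => //= n IH g1 g2; rewrite !IH; ring. Qed.

Lemma binomial_meanZ n u c g :
  binomial_mean n u (fun k => c * g k) = c * binomial_mean n u g.
Proof. by elim: n g => //= n IH g; rewrite !IH; ring. Qed.

Lemma binomial_mean_cst n u c : binomial_mean n u (fun=> c) = c.
Proof. by elim: n => //= n ->; ring. Qed.

(** The centre [c] is kept general because conditioning on a success replaces it by c - 1 in the
    induction. *)
Lemma binomial_mean_sqr n u c : binomial_mean n u (fun k => (k%:R - c) ^+ 2) =
  (n%:R * u - c) ^+ 2 + n%:R * u * (1 - u).
Proof.
elim: n c => [|n IH] c /=; first by rewrite mulr0n; ring.
have -> : (fun k => (k.+1%:R - c) ^+ 2) = (fun k : nat => (k%:R - (c - 1)) ^+ 2).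
  by apply/funext => k; rewrite -natr1; ring.
by rewrite !IH -natr1; ring.
Qed.

Lemma normr_binomial_mean n u g : 0 <= u <= 1 ->
  `|binomial_mean n u g| <= binomial_mean n u (fun k => `|g k|).
Proof.
move=> /andP[u0 u1]; elim: n g => //= n IH g.
rewrite (le_trans (ler_normD _ _))// !normrM (ger0_norm u0).
by rewrite (@ger0_norm _ (1 - u)) ?subr_ge0// lerD// ler_wpM2l ?subr_ge0.
Qed.

(* AM-GM in the form |a| <= (e + a^2 / e) / 2 turns the variance bound into a
   first moment bound. *)
Lemma binomial_mean_dist n u : 0 <= u <= 1 ->
  binomial_mean (n.+1 ^ 2)%N u (fun k => `|k%:R / (n.+1 ^ 2)%:R - u|) <= n.+1%:R^-1.
Proof.
move=> u01; set N := (n.+1 ^ 2)%N; set e : R := n.+1%:R^-1.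
have n0 : (0 : R) < n.+1%:R by rewrite ltr0n.
have e0 : 0 < e by rewrite invr_gt0.
have NE : N%:R = n.+1%:R ^+ 2 :> R by rewrite natrX.
have N0 : (0 : R) < N%:R by rewrite NE exprn_gt0.
have H k : `|k%:R / N%:R - u| <=
    e / 2 + (e / 2) ^+ 1 * (e ^+ 2 * (k%:R - N%:R * u) ^+ 2).
  have : 0 <= (`|k%:R / N%:R - u| - e) ^+ 2 by rewrite sqr_ge0.
  rewrite sqrrB real_normK ?num_real// => h.
  rewrite -(ler_pM2l (mulr_gt0 (ltr0n _ 2) e0)).
  set a := `|_| in h *.
  suff -> : e ^+ 2 * (k%:R - N%:R * u) ^+ 2 = e ^+ 2 * N%:R ^+ 2 * (k%:R / N%:R - u) ^+ 2.
    have -> : e ^+ 2 * N%:R ^+ 2 = e ^- 2.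
      by rewrite NE /e; field; rewrite gt_eqF.
    rewrite expr1; set q := (_ - u) ^+ 2 in h *.
    have -> : 2 * e * (e / 2 + e / 2 * (e ^- 2 * q)) = e ^+ 2 + q.
      by field; rewrite gt_eqF.
    by rewrite -subr_ge0; move: h; rewrite -mulr_natl; lra.
  by field; rewrite gt_eqF.
apply: le_trans (le_binomial_mean _ u01 H) _.
rewrite binomial_meanD binomial_mean_cst binomial_meanZ binomial_meanZ.
rewrite binomial_mean_sqr subrr expr0n/= add0r.
have -> : (e / 2) ^+ 1 * (e ^+ 2 * (N%:R * u * (1 - u))) = e / 2 * (u * (1 - u)).
  by rewrite NE /e; field; rewrite addrC natr1 gt_eqF.
have : u * (1 - u) <= 1.
  by case/andP: u01 => ? ?; rewrite mulr_ile1// ?subr_ge0//; lra.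
rewrite -(ler_pM2l (divr_gt0 e0 (ltr0n _ 2))); lra.
Qed.

End binomial_average.

(** * Cosine averages determine averages of exponentials of Lipschitz functions *)

Section equal_laws.
Context {R : realType} {J : finType}.
Context d1 (T1 : measurableType d1) (P1 : probability T1 R) (X1 : J -> T1 -> R).
Context d2 (T2 : measurableType d2) (P2 : probability T2 R) (X2 : J -> T2 -> R).

Definition same_mean (h : (J -> R) -> R) :=
  [/\ bounded_mfun (fun t => h (X1 ^~ t)), bounded_mfun (fun t => h (X2 ^~ t)) &
      \int[P1]_t h (X1 ^~ t) = \int[P2]_t h (X2 ^~ t)].

Lemma same_meanD h k : same_mean h -> same_mean k ->
  same_mean (fun x => h x + k x).
Proof.
move=> [h1 h2 he] [k1 k2 ke]; split; try exact: bounded_mfunD.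
by rewrite !bounded_RintegralD// he ke.
Qed.

Lemma same_meanZ c h : same_mean h -> same_mean (fun x => c * h x).
Proof.
move=> [h1 h2 he]; split; try exact: bounded_mfunZ.
by rewrite !bounded_RintegralZ// he.
Qed.

Lemma same_mean_cvg (h_ : nat -> (J -> R) -> R) h M :
  (forall n, same_mean (h_ n)) -> (forall n x, `|h_ n x| <= M) ->
  (forall x, (fun n => h_ n x) @ \oo --> h x) -> same_mean h.
Proof.
move=> eh Mh hh.
have [b1 c1] := @bounded_mfun_cvg _ _ _ P1 (fun n t => h_ n (X1 ^~ t))
  (fun t => h (X1 ^~ t)) M ltac:(by move=> n; case: (eh n)) ltac:(by []) ltac:(by []).
have [b2 c2] := @bounded_mfun_cvg _ _ _ P2 (fun n t => h_ n (X2 ^~ t))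
  (fun t => h (X2 ^~ t)) M ltac:(by move=> n; case: (eh n)) ltac:(by []) ltac:(by []).
split => //; apply: (cvg_unique _ c1); first exact: Rhausdorff.
suff -> : (fun n => \int[P1]_t h_ n (X1 ^~ t)) = (fun n => \int[P2]_t h_ n (X2 ^~ t)).
  by [].
by apply/funext => n; case: (eh n).
Qed.

(** Phases make sines available, and closure under products follows from the product-to-sum formula
    ([trigM]), so these functions form an algebra. *)
Inductive trig_poly : ((J -> R) -> R) -> Prop :=
| trig_cos a c : trig_poly (fun x => cos (\sum_j a j * x j + c))
| trigD u v : trig_poly u -> trig_poly v -> trig_poly (fun x => u x + v x)
| trigZ c u : trig_poly u -> trig_poly (fun x => c * u x).

Lemma eq_trig u v : trig_poly u -> u =1 v -> trig_poly v.
Proof. by move=> tu /funext <-. Qed.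

Lemma trig_cst c : trig_poly (fun=> c).
Proof.
apply: eq_trig (trigZ c (trig_cos (fun=> 0) 0)) _ => x.
by rewrite big1 ?addr0 ?cos0 ?mulr1// => j _; rewrite mul0r.
Qed.

Lemma trigM u v : trig_poly u -> trig_poly v -> trig_poly (fun x => u x * v x).
Proof.
move=> tu tv; elim: tu => [a c|u1 u2 _ t1 _ t2|k u1 _ t1]; last 2 first.
- by apply: eq_trig (trigD t1 t2) _ => x; rewrite mulrDl.
- by apply: eq_trig (trigZ k t1) _ => x; rewrite mulrA.
elim: tv => [b e|v1 v2 _ t1 _ t2|k v1 _ t1]; last 2 first.
- by apply: eq_trig (trigD t1 t2) _ => x; rewrite mulrDr.
- by apply: eq_trig (trigZ k t1) _ => x; rewrite mulrCA.
apply: eq_trig (trigD (trigZ 2^-1 (trig_cos (fun j => a j + b j) (c + e)))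
                      (trigZ 2^-1 (trig_cos (fun j => a j - b j) (c - e)))) _ => x.
have -> : \sum_j (a j + b j) * x j = \sum_j a j * x j + \sum_j b j * x j.
  by rewrite -big_split; apply: eq_bigr => j _; rewrite mulrDl.
have -> : \sum_j (a j - b j) * x j = \sum_j a j * x j - \sum_j b j * x j.
  by rewrite -sumrB; apply: eq_bigr => j _; rewrite mulrBl.
set p := \sum_j _; set q := \sum_j _.
rewrite [p + q + _]addrACA [p - q + _]addrACA -opprD cosD cosB.
by set y := cos _; set z := cos _; field.
Qed.

Lemma trig_sin r a : trig_poly (fun x => sin (x a / r)).
Proof.
have -> : (fun x : J -> R => sin (x a / r)) =
    (fun x => cos (\sum_j (if j == a then r^-1 else 0) * x j - pi / 2)).
  apply/funext => x; rewrite cosBpihalf (bigD1 a)//= eqxx big1 ?addr0 1?mulrC//.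
  by move=> j /negbTE ->; rewrite mul0r.
exact: (trig_cos (fun j => _)).
Qed.

Hypothesis mX1 : forall j, measurable_fun setT (X1 j).
Hypothesis mX2 : forall j, measurable_fun setT (X2 j).
Hypothesis same_cos : forall (a : J -> R) c,
  \int[P1]_t cos (\sum_j a j * X1 j t + c) = \int[P2]_t cos (\sum_j a j * X2 j t + c).

Lemma trig_same_mean w : trig_poly w -> same_mean w.
Proof.
elim=> [a c|u v _ hu _ hv|c u _ hu].
- split => //; apply: bounded_mfun_cos; apply: measurable_funD => //;
    by apply: measurable_sum => j; exact: measurable_funM.
- exact: same_meanD.
- exact: same_meanZ.
Qed.

(** Each step of the recursion only multiplies by u or 1 - u, which the trigonometric factor [w]
    absorbs. *)
Lemma binomial_same_mean n (g : nat -> (J -> R) -> R) u w :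
  (forall k w', trig_poly w' -> same_mean (fun x => g k x * w' x)) ->
  trig_poly u -> trig_poly w ->
  same_mean (fun x => binomial_mean n (u x) (g ^~ x) * w x).
Proof.
move=> gw tu; elim: n g w gw => [|n IH] g w gw tw /=; first exact: gw.
have -> : (fun x => (u x * binomial_mean n (u x) (fun k => g k.+1 x) +
     (1 - u x) * binomial_mean n (u x) (g^~ x)) * w x) =
  (fun x => binomial_mean n (u x) (fun k => g k.+1 x) * (u x * w x) +
            binomial_mean n (u x) (g^~ x) * ((1 + -1 * u x) * w x)).
  by apply/funext => x; ring.
apply: same_meanD.
  by apply: (IH (fun k => g k.+1)) => [k|]; [exact: gw|exact: trigM].
apply: IH => //; apply: trigM => //.
by apply: trigD; [exact: trig_cst|exact: trigZ].
Qed.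

(** Induction on the list of coordinates on which [h] may depend. The head coordinate is replaced by
    a Bernstein average in u = (1 + sin(x_a / r)) / 2, whose nodes freeze that coordinate and leave
    a function of the tail. The trigonometric factor [w] collects the powers of u and 1 - u produced
    by earlier coordinates. *)
Lemma lip_sin_same_mean r (s : seq J) l h M w : 0 < r -> 0 <= l ->
  (forall x, `|h x| <= M) ->
  (forall x y, `|h x - h y| <= l * \sum_(j <- s) `|x j - y j|) ->
  trig_poly w ->
  same_mean (fun x => h (fun j => r * sin (x j / r)) * w x).
Proof.
move=> r0 l0; elim: s h w => [|a s IH] h w hM hl tw.
  have -> : (fun x => h (fun j => r * sin (x j / r)) * w x) =
            (fun x => h (fun=> 0) * w x).
    apply/funext => x; congr (_ * _); apply/eqP; rewrite -subr_eq0 -normr_le0.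
    by rewrite (le_trans (hl _ _))// big_nil mulr0.
  exact/same_meanZ/trig_same_mean.
pose S (x : J -> R) j := r * sin (x j / r).
pose upd (x : J -> R) c j := if j == a then c else x j.
(* The square makes the mean error of the Bernstein average 1 / (n + 1). The node [c n k] is the
   value of r sin(x_a / r) at which u equals k / N. *)
pose N n : nat := (n.+1 ^ 2)%N.
pose c n k : R := r * (2 * (k%:R / (N n)%:R) - 1).
pose u (x : J -> R) := 2^-1 * (1 + sin (x a / r)).
have u01 x : 0 <= u x <= 1.
  by rewrite /u; have := sin_geN1 (x a / r); have := sin_le1 (x a / r); lra.
pose B n x := binomial_mean (N n) (u x) (fun k => h (upd (S x) (c n k))).
have hk n k w' : trig_poly w' -> same_mean (fun x => h (upd (S x) (c n k)) * w' x).
  apply: (IH (fun x => h (upd x (c n k)))) => // x y.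
  rewrite (le_trans (hl _ _))// ler_wpM2l// big_cons /upd eqxx subrr normr0 add0r.
  by apply: ler_sum => j _; case: eqP => // _; rewrite subrr normr0.
have Bl n x : `|B n x - h (S x)| <= l * (size s).+1%:R * (2 * r) / n.+1%:R.
  rewrite -[h (S x)](binomial_mean_cst (N n) (u x)).
  apply: le_trans (_ : l * (size s).+1%:R * (2 * r) *
     binomial_mean (N n) (u x) (fun k => `|k%:R / (N n)%:R - u x|) <= _).
    rewrite -binomial_meanZ -mulN1r -binomial_meanZ -binomial_meanD.
    apply: le_trans (normr_binomial_mean _ _ (u01 x)) _.
    apply: le_binomial_mean => // k.
    rewrite mulN1r (le_trans (hl _ _))// -!mulrA ler_wpM2l//.
    set c0 := (X in _ <= _ * X).
    rewrite [leRHS](_ : _ = \sum_(j <- a :: s) c0); last first.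
      by rewrite big_const_seq count_predT iter_addr addr0 mulr_natl.
    apply: ler_sum => j _; rewrite /upd /c0; case: eqP => [->|_]; last first.
      by rewrite subrr normr0 !mulr_ge0// ltW.
    rewrite mulrA -[2 * r]ger0_norm ?mulr_ge0 ?(ltW r0)// -normrM /c /u /S.
    set q := _ / (N n)%:R; set s0 := sin _.
    have -> : r * (2 * q - 1) - r * s0 = 2 * r * (q - 2^-1 * (1 + s0)) by field.
    exact: lexx.
  rewrite ler_wpM2l//; last exact: binomial_mean_dist.
  by rewrite !mulr_ge0// ltW.
have [N0 N0w] : exists K, forall x, `|w x| <= K.
  elim: tw => [b e|v1 v2 _ [K1 h1] _ [K2 h2]|k v1 _ [K1 h1]].
  - by exists 1 => x; exact: cos_max.
  - by exists (K1 + K2) => x; rewrite (le_trans (ler_normD _ _))// lerD.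
  - by exists (`|k| * K1) => x; rewrite normrM ler_wpM2l.
apply: (@same_mean_cvg (fun n x => B n x * w x) _ (M * N0)).
- move=> n; apply: (@binomial_same_mean (N n) (fun k x => h (upd (S x) (c n k))) u) => //.
    by move=> k w' tw'; exact: hk.
  by apply: trigZ; apply: trigD; [exact: trig_cst|exact: trig_sin].
- move=> n x; rewrite normrM ler_pM//.
  rewrite (le_trans (normr_binomial_mean _ _ (u01 x)))//.
  by rewrite -[leRHS](binomial_mean_cst (N n) (u x)) le_binomial_mean.
- move=> x; apply: cvgM; last exact: cvg_cst.
  set K := l * (size s).+1%:R * (2 * r).
  apply/cvgrPdist_le => e e0.
  have K0 : 0 < K + 1 by rewrite ltr_wpDl// /K !mulr_ge0// ltW.
  have /cvgrPdist_le/(_ _ (divr_gt0 e0 K0)) [m _ Hm] := @cvg_harmonic R.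
  exists m => // n /Hm; rewrite /= sub0r normrN ger0_norm ?invr_ge0// => Hn.
  rewrite distrC (le_trans (Bl n x))// -/K.
  rewrite ler_pdivlMr// in Hn; apply: le_trans Hn.
  by rewrite mulrC ler_wpM2l ?invr_ge0//; lra.
Qed.

Definition l1_lipschitz (l : R) (h : (J -> R) -> R) :=
  forall x y, `|h x - h y| <= l * \sum_j `|x j - y j|.

Lemma l1_lipschitz_cvg l h (x_ : nat -> J -> R) x : l1_lipschitz l h ->
  (forall j, (fun n => x_ n j) @ \oo --> x j) -> (fun n => h (x_ n)) @ \oo --> h x.
Proof.
move=> hl xx.
have d0 : (fun n => l * \sum_j `|x j - x_ n j|) @ \oo --> (0 : R).
  rewrite -[X in _ --> X](mulr0 l); apply: cvgM; first exact: cvg_cst.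
  rewrite [X in _ --> X](_ : _ = \sum_(j : J) (0 : R)); last by rewrite big1.
  apply: (cvg_sumr (f := fun j n => `|x j - x_ n j|)) => j.
  rewrite -[X in _ --> X](normr0 R) -(subrr (x j)).
  by apply: cvg_norm; apply: cvgB; [exact: cvg_cst|exact: xx].
apply/cvgrPdist_le => e e0.
move/cvgrPdist_le/(_ _ e0) : d0 => [m _ Hm]; exists m => // n /Hm /=.
rewrite sub0r normrN => H; apply: le_trans (hl _ _) _.
exact: le_trans (ler_norm _) H.
Qed.

(** Let the radius r of [lip_sin_same_mean] grow: r sin(x_j / r) tends to x_j and [h] is bounded, so
    dominated convergence applies. *)
Lemma lip_bounded_same_mean l h M : 0 <= l -> l1_lipschitz l h ->
  (forall x, `|h x| <= M) -> same_mean h.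
Proof.
move=> l0 hl hM.
pose S n (x : J -> R) j := n.+1%:R * sin (x j / n.+1%:R).
apply: (@same_mean_cvg (fun n x => h (S n x)) _ M) => [n|n x|x].
- have -> : (fun x => h (S n x)) = (fun x => h (S n x) * 1).
    by apply/funext => x; rewrite mulr1.
  apply: (@lip_sin_same_mean n.+1%:R (index_enum J) l h M (fun=> 1)) => //.
  exact: trig_cst.
- exact: hM.
- by apply: l1_lipschitz_cvg hl _ => j; exact: cvg_scaled_sin.
Qed.

(* [exp g] is not Lipschitz, but its truncations are. *)
Lemma lip_expR_same_integral l g : 0 <= l -> l1_lipschitz l g ->
  [/\ measurable_fun setT (fun t => g (X1 ^~ t)),
      measurable_fun setT (fun t => g (X2 ^~ t)) &
      (\int[P1]_t (expR (g (X1 ^~ t)))%:E = \int[P2]_t (expR (g (X2 ^~ t)))%:E)%E].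
Proof.
move=> l0 gl.
pose h (n : nat) x := Num.min (expR (g x)) n%:R.
have hn n : same_mean (h n).
  apply: (@lip_bounded_same_mean (n%:R * l) _ n%:R).
  - by rewrite mulr_ge0.
  (* With m = min(e^b, n), the increment is at most m (1 - e^(a-b)) <= m (b - a), and m <= n. *)
  - have H (a b : R) : a <= b -> Num.min (expR b) n%:R - Num.min (expR a) n%:R <= n%:R * (b - a).
      move=> ab; have [ena|ean] := leP n%:R (expR a).
        rewrite !min_r// ?subrr ?mulr_ge0 ?subr_ge0//.
        by apply: le_trans ena _; rewrite ler_expR.
      have n0 : 0 < n%:R :> R by exact: lt_trans (expR_gt0 a) ean.
      set m := Num.min _ _.
      have m0 : 0 < m by rewrite lt_min expR_gt0.
      apply: (@le_trans _ _ (m * (b - a))); last first.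
        by rewrite ler_wpM2r ?subr_ge0// ge_min lexx orbT.
      rewrite lerBlDr -lerBlDl -{1}[m]mulr1 -mulrBr.
      apply: (@le_trans _ _ (m * expR (a - b))).
        apply: ler_wpM2l; first exact: ltW.
        by have := expR_ge1Dx (a - b); lra.
      rewrite expRD expRN mulrCA ler_piMr ?expR_ge0//.
      by rewrite ler_pdivrMr ?expR_gt0// mul1r ge_min lexx.
    move=> x y; rewrite -mulrA; apply: le_trans (_ : n%:R * `|g x - g y| <= _); last first.
      by rewrite ler_wpM2l.
    have [xy|/ltW yx] := leP (g x) (g y).
      rewrite distrC (distrC (g x)) !ger0_norm ?subr_ge0//; first exact: H.
      by rewrite /h le_min !ge_min ler_expR ?xy ?yx lexx orbT.
    rewrite !ger0_norm ?subr_ge0//; first exact: H.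
    by rewrite /h le_min !ge_min ler_expR ?xy ?yx lexx orbT.
  - move=> x; rewrite ger0_norm; first by rewrite /h ge_min lexx orbT.
    by rewrite /h le_min expR_ge0 ler0n.
have h0 n x : 0 <= h n x by rewrite /h le_min expR_ge0 ler0n.
have hg x : (fun n => h n x) @ \oo --> expR (g x).
  apply: cvg_near_cst; have [m _ Hm] := nbhs_infty_ger (expR (g x)).
  by exists m => // n /Hm /= H; rewrite /h min_l.
have he x : (fun n => (h n x)%:E) @ \oo --> (expR (g x))%:E.
  by apply: cvg_EFin; [exact: nearW|exact: hg].
have hnd x : {homo (fun n => (h n x)%:E) : n m / (n <= m)%N >-> (n <= m)%E}.
  by move=> n m nm; rewrite lee_fin /h le_min !ge_min lexx ler_nat nm orbT.
(* Measurability of g(X) is itself a conclusion: it is the logarithm of a limit of measurable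
   truncations. *)
have meas d (T : measurableType d) (X : J -> T -> R) :
    (forall n, measurable_fun setT (fun t => h n (X ^~ t))) ->
    measurable_fun setT (fun t => g (X ^~ t)).
  move=> mh; have -> : (fun t => g (X ^~ t)) = @ln R \o (fun t => expR (g (X ^~ t))).
    by apply/funext => t /=; rewrite expRK.
  apply: measurableT_comp; first exact: measurable_ln.
  by apply: (measurable_fun_cvg mh) => t _; exact: hg.
have m1 : measurable_fun setT (fun t => g (X1 ^~ t)).
  by apply: meas => n; case: (hn n) => -[].
have m2 : measurable_fun setT (fun t => g (X2 ^~ t)).
  by apply: meas => n; case: (hn n) => _ [].
split=> //.
have mono d (T : measurableType d) (P : probability T R) (X : J -> T -> R) :
    (forall n, bounded_mfun (fun t => h n (X ^~ t))) ->
    (fun n => (\int[P]_t h n (X ^~ t))%:E) @ \oo --> (\int[P]_t (expR (g (X ^~ t)))%:E)%E.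
  move=> mh.
  have -> : (fun n => (\int[P]_t h n (X ^~ t))%:E) = (fun n => \int[P]_t (h n (X ^~ t))%:E)%E.
    apply/funext => n; rewrite fineK//; apply: integrable_fin_num => //.
    exact: bounded_mfun_integrable.
  have -> : (\int[P]_t (expR (g (X ^~ t)))%:E = \int[P]_t limn (fun n => (h n (X ^~ t))%:E))%E.
    by apply: eq_integral => t _; apply/esym/cvg_lim => //; exact: he.
  apply: cvg_monotone_convergence => //.
  - by move=> n; apply/measurable_EFinP; case: (mh n).
  - by move=> n t _; rewrite lee_fin.
apply: (cvg_unique _ (mono _ _ P1 X1 _)) => //; first by move=> n; case: (hn n).
have -> : (fun n => (\int[P1]_t h n (X1 ^~ t))%:E) = (fun n => (\int[P2]_t h n (X2 ^~ t))%:E).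
  by apply/funext => n; case: (hn n) => _ _ ->.
by apply: mono => n; case: (hn n).
Qed.

End equal_laws.

(** * Integrals against a density and under the normal law *)

Section density.
Context d (T : measurableType d) (R : realType).
Variables (mu nu : {measure set T -> \bar R}) (p : T -> R).
Hypothesis p0 : forall x, 0 <= p x.
Hypothesis mp : measurable_fun setT p.
Hypothesis nuE : forall A, measurable A -> (nu A = \int[mu]_(x in A) (p x)%:E)%E.
Import HBNNSimple.
Local Open Scope ereal_scope.

Let density_nnsfun (f : {nnsfun T >-> R}) :
  \int[nu]_x (f x)%:E = \int[mu]_x ((f x)%:E * (p x)%:E).
Proof.
under [LHS]eq_integral do rewrite fimfunE -fsumEFin//.
rewrite [LHS]ge0_integral_fsum//; last 2 first.
  - by move=> r; exact/measurable_EFinP/measurableT_comp.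
  - by move=> n x _; rewrite EFinM nnfun_muleindic_ge0.
under [RHS]eq_integral.
  move=> x xD; rewrite fimfunE -fsumEFin// ge0_mule_fsuml; last first.
    by move=> r; rewrite EFinM nnfun_muleindic_ge0.
  over.
rewrite [RHS]ge0_integral_fsum//; last 2 first.
  - move=> r; apply/measurable_EFinP; apply: measurable_funM => //.
    exact: measurable_funM.
  - move=> n x _; apply: mule_ge0; last by rewrite lee_fin.
    by rewrite EFinM nnfun_muleindic_ge0.
apply: eq_fsbigr => r _.
have mE : measurable (f @^-1` [set r]) by exact: measurable_funPTI.
have [r0|r0] := leP 0%R r.
  under [RHS]eq_integral do rewrite EFinM -muleA.
  rewrite ge0_integralZl//; last 2 first.
  - apply/measurable_EFinP; apply: measurable_funM => //.
  - by move=> x _; rewrite mule_ge0 ?lee_fin.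
  rewrite integralZl_indic_nnsfun//= integral_indic// setIT nuE//.
  rewrite integral_mkcond; congr *%E; apply: eq_integral => x _.
  by rewrite patchE indicE; case: ifPn => _; rewrite ?mul1e ?mul0e.
have E0 x : \1_(f @^-1` [set r]) x = 0%R :> R.
  rewrite indicE memNset// => /= fr.
  have : (0 <= f x)%R by [].
  by rewrite fr leNgt r0.
by rewrite !integral0_eq// => x _; rewrite E0 mulr0 ?mul0e.
Qed.

Lemma ge0_integral_density (f : T -> \bar R) :
  measurable_fun setT f -> (forall x, 0 <= f x) ->
  \int[nu]_x f x = \int[mu]_x (f x * (p x)%:E).
Proof.
move=> mf f0; pose f_ := nnsfun_approx measurableT mf.
have fcvg x : (fun n => (f_ n x)%:E) @ \oo --> f x by exact: cvg_nnsfun_approx.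
transitivity (limn (fun n => \int[nu]_x (f_ n x)%:E)).
  rewrite -monotone_convergence//=.
  - by apply: eq_integral => x _; apply/esym/cvg_lim => //; exact: fcvg.
  - by move=> n; exact/measurable_EFinP/measurable_funTS.
  - by move=> n ? _; rewrite lee_fin.
  - by move=> ? _ ? ? mn; rewrite lee_fin; exact/lefP/nd_nnsfun_approx.
under eq_fun do rewrite density_nnsfun.
rewrite -monotone_convergence//=.
- apply: eq_integral => x _; apply/cvg_lim => //.
  by apply: cvgeZr => //; exact: fcvg.
- by move=> n; apply/measurable_EFinP/measurable_funM => //; exact: measurable_funTS.
- by move=> n ? _; rewrite mule_ge0 ?lee_fin.
- move=> ? _ ? ? mn; rewrite lee_wpmul2r ?lee_fin//; exact/lefP/nd_nnsfun_approx.
Qed.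

End density.

Section normal.
Context {R : realType}.
Implicit Types m s t x : R.
Local Notation mu := lebesgue_measure.

(** Completing the square turns the integrand into a multiple of the normal density with mean m + t
    s^2. *)
Lemma normal_mgf m s t : s != 0 ->
  (\int[mu]_x (expR (t * x) * normal_pdf m s x)%:E =
   (expR (t * m + (t * s) ^+ 2 / 2))%:E)%E.
Proof.
move=> s0.
have E x : expR (t * x) * normal_pdf m s x =
    expR (t * m + (t * s) ^+ 2 / 2) * normal_pdf (m + t * s ^+ 2) s x.
  rewrite !normal_pdfE// /normal_fun mulrCA [RHS]mulrCA -!expRD.
  by congr (_ * expR _); field.
transitivity (\int[mu]_x ((expR (t * m + (t * s) ^+ 2 / 2))%:E *
    (normal_pdf (m + t * s ^+ 2) s x)%:E))%E.
  by apply: eq_integral => x _; rewrite E.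
rewrite ge0_integralZl ?integral_normal_pdf ?mule1//.
- by apply/measurable_EFinP; exact: measurable_normal_pdf.
- by move=> x _; rewrite lee_fin normal_pdf_ge0.
Qed.

Lemma normal_integrable s (h : R -> R) (K : R) : s != 0 -> measurable_fun setT h ->
  (forall x, `|h x| <= K * (expR x + expR (- x))) ->
  mu.-integrable setT (fun x => (h x * normal_pdf 0 s x)%:E).
Proof.
move=> s0 mh hK.
have ie (t : R) : mu.-integrable setT (fun x => (expR (t * x) * normal_pdf 0 s x)%:E).
  apply/integrableP; split.
    apply/measurable_EFinP; apply: measurable_funM; last exact: measurable_normal_pdf.
    by apply: measurableT_comp => //; exact: measurable_funM.
  under eq_integral do rewrite gee0_abs ?lee_fin ?mulr_ge0 ?expR_ge0 ?normal_pdf_ge0//.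
  by rewrite normal_mgf// ltry.
have := integrableZl measurableT K (integrableD measurableT (ie 1) (ie (-1))).
apply: le_integrable => //.
  by apply/measurable_EFinP; apply: measurable_funM => //; exact: measurable_normal_pdf.
move=> x _ /=; rewrite lee_fin mul1r mulN1r -mulrDl mulrA normrM (ger0_norm (normal_pdf_ge0 _ _ _)).
rewrite (le_trans _ (ler_norm _))// ler_wpM2r ?normal_pdf_ge0//.
Qed.

Lemma normr_le_cosh x : `|x| <= expR x + expR (- x).
Proof.
have := expR_ge1Dx x; have := expR_ge1Dx (- x).
have := expR_gt0 x; have := expR_gt0 (- x) => *.
by rewrite ler_norml; apply/andP; split; lra.
Qed.

Lemma one_le_cosh x : 1 <= expR x + expR (- x).
Proof. by have := cosh_ge_quad x; have := sqr_ge0 x; lra. Qed.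

Let p s := normal_pdf 0 s.

Let pE s x : s != 0 -> p s x = normal_peak s * expR (- x ^+ 2 / (s ^+ 2 *+ 2)).
Proof. by move=> s0; rewrite /p normal_pdfE// /normal_fun subr0. Qed.

Let is_derive_p s x : s != 0 -> is_derive x 1 (p s) (- x / s ^+ 2 * p s x).
Proof.
move=> s0; rewrite pE//.
have -> : p s = (fun x => normal_peak s * expR (x ^+ 2 * - (s ^+ 2 *+ 2)^-1)).
  by apply/funext => y; rewrite pE// mulrN mulNr.
apply: is_derive_eq; rewrite /GRing.scale/= ?mulr1.
have -> : - x ^+ 2 / (s ^+ 2 *+ 2) = x ^+ 2 * - (s ^+ 2 *+ 2)^-1 by rewrite mulrN mulNr.
set e := expR _.
by field.
Qed.

(** [F] is an antiderivative of [f] that vanishes at both ends of the line; integrating [f] to zero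
    is Gaussian integration by parts for the sine. *)
Let F s t c x : R := - s ^+ 2 * (sin (t * x + c) * p s x).
Let f s t c x : R := (x * sin (t * x + c) - t * s ^+ 2 * cos (t * x + c)) * p s x.

Let is_derive_F s t c x : s != 0 -> is_derive x 1 (F s t c) (f s t c x).
Proof.
move=> s0; have := is_derive_p x s0 => dp.
have dsin : is_derive x 1 (fun x => sin (t * x + c)) (t * cos (t * x + c)).
  by apply: is_derive_eq; rewrite /GRing.scale/= ?mulr1 addr0 mulrC.
have -> : F s t c = (fun x => - s ^+ 2 * ((fun x => sin (t * x + c)) x * p s x)) by [].
apply: is_derive_eq; rewrite /GRing.scale/= /f.
by field.
Qed.

Let continuous_trig t c : continuous (fun x => sin (t * x + c)) /\ continuous (fun x => cos (t * x + c)).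
Proof.
have cl : continuous (fun x : R => t * x + c).
  by move=> x; apply: cvgD; [apply: cvgM; [exact: cvg_cst|exact: cvg_id]|exact: cvg_cst].
split=> x; apply: (continuous_comp (cl x)); [exact: continuous_sin|exact: continuous_cos].
Qed.

Let continuous_f s t c : s != 0 -> continuous (f s t c).
Proof.
move=> s0 x; have [cs cc] := continuous_trig t c.
apply: cvgM; last exact: continuous_normal_pdf.
apply: cvgB; apply: cvgM; [exact: cvg_id|exact: cs|exact: cvg_cst|exact: cc].
Qed.

Let f_bound s t c x : `|f s t c x| <= ((1 + `|t * s ^+ 2|) * (expR x + expR (- x))) * p s x.
Proof.
rewrite /f normrM (ger0_norm (normal_pdf_ge0 _ _ _)) ler_wpM2r ?normal_pdf_ge0//.
rewrite (le_trans (ler_normB _ _))// !normrM mulrDl mul1r lerD//.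
  by rewrite (le_trans _ (normr_le_cosh x))// ler_piMr// sin_max.
by rewrite ler_wpM2l ?mulr_ge0// (le_trans (cos_max _))// one_le_cosh.
Qed.

Let continuous_p s : s != 0 -> continuous (p s).
Proof. exact: continuous_normal_pdf. Qed.

Let integrable_f s t c : s != 0 -> mu.-integrable setT (fun x => (f s t c x)%:E).
Proof.
move=> s0; have [cs cc] := continuous_trig t c.
apply: (@normal_integrable s _ (1 + `|t * s ^+ 2|)) => //; last first.
  move=> x; have := f_bound s t c x.
  rewrite /f normrM (ger0_norm (normal_pdf_ge0 _ _ _)) ler_pM2r//.
  by rewrite -/(p s x) pE// mulr_gt0 ?expR_gt0// normal_peak_gt0.
apply: continuous_measurable_fun => x.
apply: cvgB; apply: cvgM; [exact: cvg_id|exact: cs|exact: cvg_cst|exact: cc].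
Qed.

Let cvg_F s t c (e : R) : s != 0 -> (e == 1) || (e == -1) ->
  (fun n => F s t c (e * n.+1%:R)) @ \oo --> (0 : R).
Proof.
move=> s0 e1; set K := s ^+ 2 * (normal_peak s * (2 * s ^+ 2)).
have s20 : 0 < s ^+ 2 by rewrite exprn_even_gt0.
have bF n : `|F s t c (e * n.+1%:R)| <= K * n.+1%:R^-1.
  rewrite /F normrM normrN (ger0_norm (sqr_ge0 _)) /K -mulrA ler_wpM2l ?sqr_ge0//.
  rewrite normrM (ger0_norm (normal_pdf_ge0 _ _ _)).
  apply: le_trans (ler_piMl (normal_pdf_ge0 _ _ _) (sin_max _)) _.
  rewrite -/(p s _) pE// -mulrA ler_wpM2l ?normal_peak_ge0//.
  have -> : (e * n.+1%:R) ^+ 2 = n.+1%:R ^+ 2.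
    by rewrite exprMn; case/orP: e1 => /eqP ->; rewrite ?sqrrN expr1n mul1r.
  set y := n.+1%:R; have y1 : 1 <= y by rewrite ler1n.
  rewrite mulNr expRN; set z := y ^+ 2 / _.
  have zE : z = y ^+ 2 / (2 * s ^+ 2) by rewrite /z mulr_natl.
  have y0 : 0 < y := lt_le_trans ltr01 y1.
  have z0 : 0 < z by rewrite zE; apply: divr_gt0; [exact: exprn_gt0|exact: mulr_gt0].
  apply: (@le_trans _ _ z^-1).
    by rewrite lef_pV2 ?posrE ?expR_gt0// (le_trans _ (expR_ge1Dx z))// lerDr.
  rewrite zE invf_div (ler_pM2l (mulr_gt0 (ltr0n _ 2) s20)).
  rewrite lef_pV2 ?posrE ?exprn_gt0//.
  by rewrite expr2 ler_peMl// ltW.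
apply: normr_le_cvg0 bF _.
by rewrite -[X in _ --> X](mulr0 K); apply: cvgM; [exact: cvg_cst|exact: cvg_harmonic].
Qed.

Let integral_f s t c : s != 0 -> \int[mu]_x f s t c x = 0.
Proof.
move=> s0; have itf := integrable_f t c s0.
have mf : measurable_fun setT (f s t c).
  by apply: continuous_measurable_fun; exact: continuous_f.
pose D n : set R := `[- n.+1%:R, n.+1%:R]%classic.
have DE n : (\int[mu]_(x in D n) (f s t c x)%:E =
             (F s t c n.+1%:R - F s t c (- n.+1%:R))%:E)%E.
  have cF : continuous (F s t c).
    move=> x; apply/differentiable_continuous/derivable1_diffP.
    by case: (is_derive_F t c x s0).
  rewrite (@continuous_FTC2 _ (f s t c) (F s t c)) ?EFinB//.
  - by rewrite -subr_gt0 opprK -natrD ltr0n.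
  - by apply: continuous_subspaceT; exact: continuous_f.
  - split.
    + by move=> x _; case: (is_derive_F t c x s0).
    + by apply: cvg_at_right_filter; exact: cF.
    + by apply: cvg_at_left_filter; exact: cF.
  - by move=> x _; rewrite derive1E; have [_ ->] := is_derive_F t c x s0.
have c1 : (fun n => \int[mu]_(x in D n) (f s t c x)%:E)%E @ \oo -->
    (\int[mu]_x (f s t c x)%:E)%E.
  under eq_fun do rewrite integral_mkcond.
  apply: (@dominated_cvg _ _ _ mu _ measurableT
    (fun n => (fun x => (f s t c x)%:E) \_ (D n)) (fun x => (f s t c x)%:E)
    (fun x => (`|f s t c x|)%:E)) => //.
  - move=> n; apply/(measurable_restrictT _ _).1 => //.
      exact: measurable_itv.
    by apply: measurable_funTS; apply/measurable_EFinP.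
  - move=> x _; apply: cvg_near_cst.
    have [m _ Hm] := nbhs_infty_ger `|x|; exists m => // n /Hm /= H.
    rewrite patchE mem_set// /D /= in_itv/= -ler_norml.
    by rewrite (le_trans H)// ler_nat.
  - by have := integrable_abse itf.
  - by move=> n x _; rewrite patchE; case: ifPn => _ //; rewrite abse0 lee_fin.
have c2 : (fun n => \int[mu]_(x in D n) (f s t c x)%:E)%E @ \oo --> 0%E.
  under eq_fun do rewrite DE.
  apply: cvg_EFin; first exact: nearW.
  rewrite -[X in _ --> X](subr0 (0:R)); apply: cvgB.
    by have := @cvg_F s t c 1 s0; rewrite eqxx => /(_ isT); under eq_fun do rewrite mul1r.
  by have := @cvg_F s t c (-1) s0; rewrite eqxx orbT => /(_ isT); under eq_fun do rewrite mulN1r.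
by rewrite /Rintegral (cvg_unique _ c1 c2).
Qed.

Lemma normal_stein_sin s t c : s != 0 ->
  \int[mu]_x (x * sin (t * x + c) * normal_pdf 0 s x) =
  t * s ^+ 2 * \int[mu]_x (cos (t * x + c) * normal_pdf 0 s x).
Proof.
move=> s0; have := integral_f t c s0; have [cs cc] := continuous_trig t c.
have i1 : mu.-integrable setT (fun x => (x * sin (t * x + c) * normal_pdf 0 s x)%:E).
  apply: (@normal_integrable s _ 1) => //.
    apply: continuous_measurable_fun => x; apply: cvgM; [exact: cvg_id|exact: cs].
  move=> x; rewrite mul1r normrM (le_trans _ (normr_le_cosh x))//.
  by rewrite ler_piMr// sin_max.
have i2 : mu.-integrable setT (fun x => (cos (t * x + c) * normal_pdf 0 s x)%:E).
  apply: (@normal_integrable s _ 1) => //.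
    exact: continuous_measurable_fun.
  by move=> x; rewrite mul1r (le_trans (cos_max _))// one_le_cosh.
have -> : \int[mu]_x f s t c x = \int[mu]_x (x * sin (t * x + c) * normal_pdf 0 s x -
    t * s ^+ 2 * (cos (t * x + c) * normal_pdf 0 s x)).
  by apply: eq_Rintegral => x _; rewrite /f mulrBl -!mulrA.
rewrite RintegralB//; last first.
  by have := integrableZl measurableT (t * s ^+ 2) i2.
by rewrite RintegralZl// => /eqP; rewrite subr_eq0 => /eqP.
Qed.

(** As a function of t, the integral phi satisfies phi'(t) = - t s^2 phi(t): differentiate under the
    integral and apply [normal_stein_sin]. *)
Lemma normal_cos s t c : s != 0 ->
  \int[mu]_x (cos (t * x + c) * normal_pdf 0 s x) = cos c * expR (- (t * s) ^+ 2 / 2).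
Proof.
move=> s0.
pose g (t x : R) : R := cos (t * x + c) * normal_pdf 0 s x.
pose phi t := \int[mu]_x g t x.
have dg t1 x : is_derive t1 1 (g ^~ x) (- (x * sin (t1 * x + c) * normal_pdf 0 s x)).
  have -> : g ^~ x = (fun u => cos (u * x + c) * normal_pdf 0 s x) by [].
  by apply: is_derive_eq; rewrite /GRing.scale/= ?mulr1 ?mulr0 ?addr0 ?add0r; ring.
have d1g t1 x : partial1of2 g t1 x = - (x * sin (t1 * x + c) * normal_pdf 0 s x).
  by rewrite partial1of2E; exact: derive_val.
have ig t1 : mu.-integrable setT (EFin \o g t1).
  have [_ cc] := continuous_trig t1 c.
  apply: (@normal_integrable s _ 1) => //.
    exact: continuous_measurable_fun.
  by move=> x; rewrite mul1r (le_trans (cos_max _))// one_le_cosh.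
have G0 x : 0 <= `|x| * normal_pdf 0 s x by rewrite mulr_ge0 ?normal_pdf_ge0.
have iG : mu.-integrable setT (EFin \o (fun x => `|x| * normal_pdf 0 s x)).
  apply: (@normal_integrable s (fun x => `|x|) 1) => //.
  by move=> x; rewrite mul1r normr_id normr_le_cosh.
have dphi t1 : is_derive t1 1 phi (- (t1 * s ^+ 2) * phi t1).
  have It : `]t1 - 1, t1 + 1[%classic t1 by rewrite /= in_itv/=; lra.
  have bd (x y : R) : `]t1 - 1, t1 + 1[%classic x -> setT y ->
      `|partial1of2 g x y| <= `|y| * normal_pdf 0 s y.
    move=> _ _; rewrite d1g normrN normrM (ger0_norm (normal_pdf_ge0 _ _ _)).
    by rewrite ler_wpM2r ?normal_pdf_ge0// normrM ler_piMr// sin_max.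
  have dd (x y : R) : `]t1 - 1, t1 + 1[%classic x -> setT y -> derivable (g ^~ y) x 1.
    by move=> _ _; case: (dg x y).
  have h1 := derivable_under_integral measurableT It (fun x _ => ig x) dd G0 iG bd.
  have h2 := differentiation_under_integral measurableT It (fun x _ => ig x) dd G0 iG bd.
  apply: DeriveDef => //; rewrite -derive1E h2.
  under eq_Rintegral do rewrite d1g.
  have -> : \int[mu]_y (- (y * sin (t1 * y + c) * normal_pdf 0 s y)) =
      -1 * \int[mu]_y (y * sin (t1 * y + c) * normal_pdf 0 s y).
    rewrite -RintegralZl//.
      by apply: eq_Rintegral => y _; rewrite mulN1r.
    have [cs _] := continuous_trig t1 c.
    apply: (@normal_integrable s _ 1) => //.
      apply: continuous_measurable_fun => x; apply: cvgM; [exact: cvg_id|exact: cs].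
    move=> x; rewrite mul1r normrM (le_trans _ (normr_le_cosh x))//.
    by rewrite ler_piMr// sin_max.
  by rewrite normal_stein_sin// mulN1r mulNr.
(* Integrating factor: the product has zero derivative, so it equals its value cos c at t = 0. *)
pose psi t1 := phi t1 * expR ((t1 * s) ^+ 2 / 2).
have dpsi t1 : is_derive t1 1 psi 0.
  have -> : psi = (fun t1 => phi t1 * expR ((t1 * s) ^+ 2 / 2)) by [].
  apply: is_derive_eq; rewrite /GRing.scale/=.
  by field.
have := is_derive_0_is_cst t 0 dpsi.
rewrite /psi mul0r expr0n mul0r expR0 mulr1 => E.
have p0 : phi 0 = cos c.
  rewrite /phi /g; under eq_Rintegral do rewrite mul0r add0r.
  rewrite RintegralZl//; last exact: integrable_normal_pdf.
  by rewrite /Rintegral integral_normal_pdf mulr1.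
by rewrite -p0 -E -/(phi t) -mulrA -expRD mulNr subrr expR0 mulr1.
Qed.

End normal.

Section law.
Context {R : realType} d (T : measurableType d) (P : probability T R).
Context d' (T' : measurableType d') (nu : probability T' R) (U : T -> T').
Hypothesis mU : measurable_fun setT U.
Hypothesis nuE : forall A, measurable A -> P (U @^-1` A) = nu A.

Lemma ge0_integral_law (f : T' -> \bar R) :
  measurable_fun setT f -> (forall x, 0 <= f x)%E ->
  (\int[P]_w f (U w) = \int[nu]_x f x)%E.
Proof.
move=> mf f0.
have := @ge0_integral_pushforward _ _ _ _ _ U mU P setT f measurableT mf
  (fun x _ => f0 x).
rewrite preimage_setT => <-; apply: eq_measure_integral => A mA _.
exact: nuE.
Qed.

Lemma Rintegral_law (f : T' -> R) : bounded_mfun f ->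
  \int[P]_w f (U w) = \int[nu]_x f x.
Proof.
move=> bf; have [mf [M fM]] := bf.
have bfU : bounded_mfun (fun w => f (U w)).
  by split; [exact: measurableT_comp mf mU|exists M].
have m1 : measurable_fun setT (fun x => (M + f x)%:E).
  by apply/measurable_EFinP; apply: measurable_funD.
have f0 x : (0 <= (M + f x)%:E)%E.
  by rewrite lee_fin; move: (fM x); rewrite ler_norml => /andP[]; lra.
have /(congr1 fine) E := ge0_integral_law m1 f0.
have : \int[P]_w (M + f (U w)) = \int[nu]_x (M + f x) by [].
rewrite (bounded_RintegralD P (f := cst M))//; last exact: bounded_mfun_cst.
rewrite (bounded_RintegralD nu (f := cst M))//; last exact: bounded_mfun_cst.
by rewrite !Rintegral_probability_cst => /addrI.
Qed.

End law.

Section normal_prob_integrals.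
Context {R : realType}.
Local Notation mu := lebesgue_measure.
Implicit Types m s t : R.

Lemma normal_prob_mgf m s t : s != 0 ->
  (\int[normal_prob m s]_x (expR (t * x))%:E = (expR (t * m + (t * s) ^+ 2 / 2))%:E)%E.
Proof.
move=> s0; rewrite -normal_mgf//.
rewrite (ge0_integral_density (mu := lebesgue_measure) (p := normal_pdf m s))//.
- by move=> x; exact: normal_pdf_ge0.
- exact: measurable_normal_pdf.
- by apply/measurable_EFinP; apply: measurableT_comp => //.
Qed.

Lemma bounded_mfun_cos_affine t e : bounded_mfun (fun x : R => cos (t * x + e)).
Proof. by apply: bounded_mfun_cos; apply: measurable_funD => //; exact: measurable_funM. Qed.

Lemma normal_prob_cos s t e : s != 0 ->
  \int[normal_prob 0 s]_x cos (t * x + e) = cos e * expR (- (t * s) ^+ 2 / 2).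
Proof.
move=> s0; have bcos := bounded_mfun_cos_affine t e.
rewrite -normal_cos//.
have p1 : \int[normal_prob 0 s]_x 1 = \int[mu]_x normal_pdf 0 s x.
  by rewrite Rintegral_probability_cst /Rintegral integral_normal_pdf.
have := @ge0_integral_density _ (measurableTypeR R) R mu (normal_prob 0 s) (normal_pdf 0 s)
   (normal_pdf_ge0 0 s) (measurable_normal_pdf 0 s) (fun A _ => erefl)
   (fun x => (1 + cos (t * x + e))%:E).
have m1 : measurable_fun setT (fun x : R => (1 + cos (t * x + e))%:E).
  by apply/measurable_EFinP; apply: measurable_funD => //; case: bcos.
have f0 x : (0 <= (1 + cos (t * x + e))%:E)%E.
  by rewrite lee_fin; have := cos_geN1 (t * x + e); lra.
move=> /(_ m1 f0)/(congr1 fine) E.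
have : \int[normal_prob 0 s]_x (1 + cos (t * x + e)) =
    \int[mu]_x (normal_pdf 0 s x + cos (t * x + e) * normal_pdf 0 s x).
  by rewrite [LHS]E; congr fine; apply: eq_integral => x _; rewrite -EFinM mulrDl mul1r.
rewrite (bounded_RintegralD _ (f := cst 1)); [|exact: bounded_mfun_cst|exact: bcos].
rewrite RintegralD//; last 2 first.
- exact: integrable_normal_pdf.
- apply: (@normal_integrable _ s (fun x => cos (t * x + e)) 1) => //.
    by case: bcos.
  by move=> x; rewrite mul1r (le_trans (cos_max _))// one_le_cosh.
by rewrite p1 => /addrI.
Qed.

End normal_prob_integrals.

(** * Cosine average of a centered Gaussian variable with given variance *)

Section gaussian_variable.
Context {R : realType} d (T : measurableType d) (P : probability T R).
Local Notation mu := lebesgue_measure.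
Variable U : T -> R.
Hypothesis mU : measurable_fun setT U.

(** Letting y tend to 0 without a limit: y = a / (2D) is admissible, and it contradicts a > 0. *)
Let quad_le (a K s2 : R) : 0 <= K -> 0 <= s2 ->
  (forall y, 0 < y -> y * s2 < 1 -> a <= y * K) -> a <= 0.
Proof.
move=> K0 s0 H; rewrite leNgt; apply/negP => a0.
set D := a * s2 + K + 1.
have as0 : 0 <= a * s2 by rewrite mulr_ge0// ltW.
have D0 : 0 < D by rewrite /D; lra.
set y := a / (2 * D).
have y0 : 0 < y by rewrite divr_gt0 ?mulr_gt0.
have := H y y0.
have -> : y * s2 < 1.
  rewrite /y mulrAC ltr_pdivrMr ?mulr_gt0// mul1r /D; lra.
move=> /(_ isT); rewrite /y mulrAC ler_pdivlMr ?mulr_gt0// leNgt => /negP; apply.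
rewrite ltr_pM2l// /D; lra.
Qed.

(** The Gaussian hypothesis only provides some parameters m and s, possibly with a Dirac law. They
    are identified as m = 0 and s^2 = v by comparing transforms with the first two moments, after
    which the explicit cosine transform applies. *)
Lemma gaussian_cos v c : gaussian P U ->
  P.-integrable setT (EFin \o U) -> \int[P]_w U w = 0 ->
  P.-integrable setT (EFin \o (fun w => U w ^+ 2)) -> \int[P]_w U w ^+ 2 = v ->
  \int[P]_w cos (U w + c) = cos c * expR (- v / 2).
Proof.
move=> [m [s law]] iU EU iU2 EU2.
have v0 : 0 <= v by rewrite -EU2; apply: Rintegral_ge0 => x _; exact: sqr_ge0.
have mgf t : (\int[P]_w (expR (t * U w))%:E = (expR (t * m + (t * s) ^+ 2 / 2))%:E)%E.
  have me : measurable_fun setT (fun x : R => (expR (t * x))%:E).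
    apply/measurable_EFinP; apply: measurableT_comp => //.
  have e0 x : (0 <= (expR (t * x))%:E)%E by rewrite lee_fin expR_ge0.
  move: law; have [->|s0] := eqVneq s 0 => law.
    rewrite (ge0_integral_law (nu := \d_m) mU law me e0) integral_dirac//.
    by rewrite diracT mul1e mulr0 expr0n mul0r addr0.
  have := @ge0_integral_law R _ T P _ (measurableTypeR R) (normal_prob m s) U mU law _ me e0.
  by move=> ->; exact: normal_prob_mgf.
have imgf t : P.-integrable setT (fun w => (expR (t * U w))%:E).
  apply/integrableP; split.
    apply/measurable_EFinP; apply: measurableT_comp => //.
    exact: measurable_funM.
  under eq_integral do rewrite gee0_abs ?lee_fin ?expR_ge0//.
  by rewrite mgf ltry.
have Rmgf t : \int[P]_w expR (t * U w) = expR (t * m + (t * s) ^+ 2 / 2).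
  by rewrite /Rintegral mgf.
have cst1 : \int[P]_w 1 = 1 :> R.
  exact: Rintegral_probability_cst.
have icst (k : R) : P.-integrable setT (EFin \o (fun=> k)).
  exact: finite_measure_integrable_cst.
have iZ (k : R) (h : T -> R) : P.-integrable setT (EFin \o h) ->
  P.-integrable setT (EFin \o (fun w => k * h w)).
  by move=> ih; exact: (integrableZl measurableT k ih).
have iD (h k : T -> R) : P.-integrable setT (EFin \o h) -> P.-integrable setT (EFin \o k) ->
  P.-integrable setT (EFin \o (fun w => h w + k w)).
  by move=> ih ik; exact: (integrableD measurableT ih ik).
(* Since e^(tU) >= 1 + tU and U is centered, the exponent t m + (t s)^2 / 2 is nonnegative for all
   t; its minimum is at t = - m / s^2. *)
have m0 : m = 0.
  have H t : 0 <= t * m + (t * s) ^+ 2 / 2.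
    rewrite -ler_expR expR0 -Rmgf -[leLHS]addr0 -(mulr0 t) -EU -cst1.
    rewrite -RintegralZl// -RintegralD//; last exact: iZ.
    apply: le_Rintegral => //; [exact/iD/iZ|exact: imgf|].
    by move=> w _; exact: expR_ge1Dx.
  have [s0|s0] := eqVneq s 0.
    by have := H (- m); rewrite s0 mulr0 expr0n mul0r addr0 mulNr oppr_ge0 -expr2; rewrite real_exprn_even_le0 ?num_real//= => /eqP.
  have := H (- m / s ^+ 2).
  have -> : - m / s ^+ 2 * m + (- m / s ^+ 2 * s) ^+ 2 / 2 = - ((m / s) ^+ 2 / 2) by field.
  rewrite oppr_ge0 pmulr_lle0 ?invr_gt0// real_exprn_even_le0 ?num_real//=.
  by rewrite mulf_eq0 invr_eq0 (negbTE s0) orbF => /eqP.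
have bcos := @bounded_mfun_cos_affine R.
have Rcos t e : \int[P]_w cos (t * U w + e) = cos e * expR (- (t * s) ^+ 2 / 2).
  move: law; rewrite m0; have [->|s0] := eqVneq s 0 => law.
    rewrite (@Rintegral_law _ _ _ P _ _ (\d_(0 : R)) U mU law (fun x => cos (t * x + e)))//.
    rewrite /Rintegral integral_dirac//; last first.
      by apply/measurable_EFinP; case: (bcos t e).
    rewrite diracT mul1e /=.
    by rewrite !mulr0 add0r expr0n oppr0 mul0r expR0 mulr1.
  rewrite (@Rintegral_law R _ T P _ (measurableTypeR R) (normal_prob 0 s) U mU law (fun x => cos (t * x + e))); last exact: bcos.
  exact: normal_prob_cos.
have ch (t : R) : 2 + t ^+ 2 * v <= 2 * expR ((t * s) ^+ 2 / 2).
  have -> : 2 * expR ((t * s) ^+ 2 / 2) = \int[P]_w (expR (t * U w) + expR (- t * U w)).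
    rewrite RintegralD//; [|exact: imgf|exact: imgf].
    by rewrite !Rmgf m0 !mulr0 !add0r mulNr sqrrN mulr_natl mulr2n.
  have -> : 2 + t ^+ 2 * v = \int[P]_w (2 + t ^+ 2 * U w ^+ 2).
    rewrite (@RintegralD _ _ _ P setT (fun=> 2) (fun w => t ^+ 2 * U w ^+ 2) measurableT (icst 2) (iZ _ _ iU2)).
    by rewrite Rintegral_probability_cst RintegralZl// EU2.
  apply: le_Rintegral => //.
  - exact: (iD (fun=> 2) _ (icst 2) (iZ _ _ iU2)).
  - by apply: iD; exact: imgf.
  - by move=> w _; rewrite -exprMn mulNr; exact: cosh_ge_quad.
have cq (t : R) : 1 - t ^+ 2 / 2 * v <= expR (- (t * s) ^+ 2 / 2).
  have := Rcos t 0; rewrite cos0 mul1r => <-.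
  have -> : 1 - t ^+ 2 / 2 * v = \int[P]_w (1 + - (t ^+ 2 / 2) * U w ^+ 2).
    rewrite (@RintegralD _ _ _ P setT (fun=> 1) (fun w => - (t ^+ 2 / 2) * U w ^+ 2) measurableT (icst 1) (iZ _ _ iU2)).
    by rewrite Rintegral_probability_cst RintegralZl// EU2 mulNr.
  apply: le_Rintegral => //.
  - exact: (iD (fun=> 1) _ (icst 1) (iZ _ _ iU2)).
  - apply: bounded_mfun_integrable; have [mc [M cM]] := bcos t 0; split.
      exact: measurableT_comp mc mU.
    by exists M.
  - move=> w _; rewrite addr0; have := cos_ge_quad (t * U w).
    by rewrite exprMn; lra.
have tE (y : R) : 0 < y -> exists2 t, y = t ^+ 2 / 2 & 0 < y.
  move=> y0; exists (Num.sqrt (2 * y)) => //.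
  by rewrite sqr_sqrtr ?mulr_ge0 ?(ltW y0)// mulrC mulKf.
(* With y = t^2 / 2, the cosine bound gives (1 - y v)(1 + y s^2) <= 1 and the cosh bound gives (1 +
   y v)(1 - y s^2) <= 1. Each is divided by y, and y is taken small. *)
have sv : s ^+ 2 = v.
  apply/eqP; rewrite eq_le -(subr_le0 v) -(subr_le0 (s ^+ 2)).
  apply/andP; split.
  - apply: (@quad_le _ (v * s ^+ 2) (s ^+ 2)) => [||y y0 ys1]; rewrite ?sqr_ge0//.
      by rewrite mulr_ge0 ?sqr_ge0.
    have [t tE' _] := tE y y0; have := cq t; rewrite -tE'.
    have -> : - (t * s) ^+ 2 / 2 = - (y * s ^+ 2) by rewrite tE' exprMn; field.
    rewrite expRN; set q := y * s ^+ 2 in ys1 *.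
    have q0 : 0 <= q by rewrite mulr_ge0 ?sqr_ge0// ltW.
    have h : (expR q)^-1 <= (1 + q)^-1.
      rewrite lef_pV2 ?posrE ?expR_gt0//; first exact: expR_ge1Dx.
      lra.
    move=> /le_trans/(_ h); rewrite -div1r ler_pdivlMr; last by lra.
    move=> hh; rewrite -(ler_pM2l y0); move: hh; rewrite /q; nra.
  - apply: (@quad_le _ (v * s ^+ 2) (s ^+ 2)) => [||y y0 ys1]; rewrite ?sqr_ge0//.
      by rewrite mulr_ge0 ?sqr_ge0.
    have [t tE' _] := tE y y0; have := ch t.
    have -> : (t * s) ^+ 2 / 2 = y * s ^+ 2 by rewrite tE' exprMn; field.
    have -> : t ^+ 2 = 2 * y by rewrite tE'; field.
    set q := y * s ^+ 2 in ys1 *.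
    have q0 : 0 <= q by rewrite mulr_ge0 ?sqr_ge0// ltW.
    have h : expR q <= (1 - q)^-1.
      rewrite -[leLHS]invrK lef_pV2 ?posrE ?invr_gt0 ?expR_gt0 ?subr_gt0//.
      rewrite -expRN; have := expR_ge1Dx (- q); lra.
    have : 2 * expR q <= 2 * (1 - q)^-1 by rewrite ler_pM2l.
    move=> h2 /le_trans/(_ h2); rewrite ler_pdivlMr ?subr_gt0//.
    move=> hh; rewrite -(ler_pM2l y0); move: hh; rewrite /q; nra.
have := Rcos 1 c; rewrite mul1r sv => <-.
by apply: eq_Rintegral => w _; rewrite mul1r.
Qed.

End gaussian_variable.

Lemma Rintegral_product_bounded {R : realType} d1 d2 (T1 : measurableType d1)
    (T2 : measurableType d2) (P1 : probability T1 R) (P2 : probability T2 R)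
    (f : T1 * T2 -> R) : bounded_mfun f ->
  \int[(P1 \x P2)%E]_z f z = \int[P1]_x \int[P2]_y f (x, y).
Proof.
move=> bf; have [mf [M fM]] := bf.
rewrite {1}/Rintegral -integral12_prod_meas1; last exact: bounded_mfun_integrable.
congr fine; apply: eq_integral => x _; rewrite /fubini_F /Rintegral fineK//.
apply: integrable_fin_num => //; apply: bounded_mfun_integrable; split.
  exact: measurableT_comp mf (pair1_measurable x).
by exists M.
Qed.

(** * Finite Gaussian families: rotation invariance and the Maurey-Pisier inequality *)

Section gaussian_family.
Context {R : realType} {J : finType}.
Context d (T : measurableType d) (P : probability T R) (X : J -> T -> R).
Hypothesis mX : forall j, measurable_fun setT (X j).
Variable S : J -> J -> R.
Definition quadratic_form (a : J -> R) : R := \sum_j \sum_k a j * a k * S j k.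
Hypothesis S_ge0 : forall a, 0 <= quadratic_form a.
Hypothesis cos_family : forall a c,
  \int[P]_w cos (\sum_j a j * X j w + c) = cos c * expR (- quadratic_form a / 2).

Let measurable_lin a : measurable_fun setT (fun w => \sum_j a j * X j w).
Proof. by apply: measurable_sum => j; exact: measurable_funM. Qed.

(** The linear form has the cosine averages of b N(0,1) with b^2 the quadratic form, so
    [lip_expR_same_integral] on a single coordinate transfers the normal moment generating
    function. *)
Lemma family_mgf a :
  (\int[P]_w (expR (\sum_j a j * X j w))%:E = (expR (quadratic_form a / 2))%:E)%E.
Proof.
pose b := Num.sqrt (quadratic_form a).
have sum1 (F : unit -> R) : \sum_u F u = F tt by rewrite (big_pred1 tt)//; case.
pose X1 (_ : unit) w := \sum_j a j * X j w.
pose X2 (_ : unit) (x : measurableTypeR R) : R := b * x.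
have mX2 u : measurable_fun setT (X2 u) by exact: measurable_funM.
have same (e : unit -> R) c : \int[P]_w cos (\sum_u e u * X1 u w + c) =
    \int[normal_prob 0 1]_x cos (\sum_u e u * X2 u x + c).
  have -> : \int[P]_w cos (\sum_u e u * X1 u w + c) =
      \int[P]_w cos (\sum_j (e tt * a j) * X j w + c).
    apply: eq_Rintegral => w _; congr (cos (_ + _)).
    rewrite sum1.
    by rewrite /X1 mulr_sumr; apply: eq_bigr => j _; rewrite mulrA.
  rewrite cos_family.
  transitivity (\int[normal_prob 0 1]_x cos ((e tt * b) * x + c)).
    have qE : quadratic_form (fun j => e tt * a j) = (e tt * b * 1) ^+ 2.
      rewrite mulr1 exprMn sqr_sqrtr// /quadratic_form mulr_sumr.
      by apply: eq_bigr => j _; rewrite mulr_sumr; apply: eq_bigr => k _; ring.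
    by rewrite qE; symmetry; exact: (normal_prob_cos _ _ (oner_neq0 R)).
  apply: eq_Rintegral => w _; congr (cos (_ + _)).
  by rewrite sum1 /X2 mulrA.
have lip : l1_lipschitz 1 (fun x : unit -> R => x tt).
  by move=> x y; rewrite mul1r sum1.
have [_ _] := lip_expR_same_integral (fun=> measurable_lin a) mX2 same ler01 lip.
rewrite /X1 => ->; rewrite normal_prob_mgf ?oner_neq0//.
by rewrite mulr0 add0r mulr1 sqr_sqrtr.
Qed.

(** Convexity separates the coordinates, and e^(c|x|) is at most e^(cx) + e^(-cx), which
    [family_mgf] integrates. *)
Lemma family_expR_norm_lty (c : J -> R) :
  (\int[P]_w (expR (\sum_j c j * `|X j w|))%:E < +oo)%E.
Proof.
have [J0|J0] := posnP #|J|.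
  rewrite (eq_integral (cst 1%E)); last first.
    by move=> w _; rewrite big_pred0 ?expR0// => j; have := fintype0 j J0.
  by rewrite integral_cst// mul1e; apply: le_lt_trans (ltry 1); exact: probability_le1.
set N : R := #|J|%:R.
pose g j (e : R) w := expR (\sum_k (if k == j then e * (N * c j) else 0) * X k w).
have gE j e w : g j e w = expR (e * (N * c j) * X j w).
  congr expR; rewrite (bigD1 j)//= eqxx big1 ?addr0// => k /negbTE ->.
  by rewrite mul0r.
have mg j e : measurable_fun setT (fun w => (g j e w)%:E).
  by apply/measurable_EFinP; apply: measurableT_comp => //; exact: measurable_lin.
apply: (@le_lt_trans _ _
   (\int[P]_w \sum_(j : J) ((N^-1)%:E * ((g j 1 w)%:E + (g j (-1) w)%:E))))%E.
  apply: ge0_le_integral => //.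
  - apply/measurable_EFinP; apply: measurableT_comp => //; apply: measurable_sum => j.
    apply: measurable_funM => //; exact: measurableT_comp.
  - apply: emeasurable_sum => j; apply: emeasurable_funM => //; exact: emeasurable_funD.
  - move=> w _; rewrite sumEFin lee_fin (le_trans (expR_mean_le _ J0))// mulr_sumr.
    apply: ler_sum => j _; rewrite ler_wpM2l ?invr_ge0// !gE.
    rewrite mulN1r mul1r !mulNr -!mulrA; have [x0|/ltW x0] := leP 0 (X j w).
      by rewrite ger0_norm// lerDl expR_ge0.
    by rewrite ler0_norm// !mulrN lerDr expR_ge0.
rewrite ge0_integral_sum//.
- apply/lte_sum_pinfty => j _.
  rewrite ge0_integralZl//.
  + rewrite ge0_integralD//; try by move=> w _; rewrite lee_fin expR_ge0.
    by rewrite !family_mgf -EFinD -EFinM ltry.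
  + exact: emeasurable_funD.
  + by move=> w _; rewrite adde_ge0// lee_fin expR_ge0.
  + by rewrite lee_fin invr_ge0.
- move=> j; apply: emeasurable_funM => //; exact: emeasurable_funD.
- by move=> j w _; rewrite mule_ge0// ?lee_fin ?invr_ge0// addr_ge0// expR_ge0.
Qed.

Local Notation PP := ((P \x P)%E : probability _ R).

Definition copies (a : J + J) (w : T * T) : R :=
  match a with inl j => X j w.1 | inr j => X j w.2 end.

Definition rotated (t : R) (a : J + J) (w : T * T) : R :=
  match a with
  | inl j => cos t * X j w.1 + sin t * X j w.2
  | inr j => - sin t * X j w.1 + cos t * X j w.2
  end.

Let mX_fst j : measurable_fun setT (fun w : T * T => X j w.1).
Proof. exact: measurableT_comp (mX j) measurable_fst. Qed.

Let mX_snd j : measurable_fun setT (fun w : T * T => X j w.2).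
Proof. exact: measurableT_comp (mX j) measurable_snd. Qed.

Lemma measurable_copies a : measurable_fun setT (copies a).
Proof. by case: a => j; [exact: mX_fst|exact: mX_snd]. Qed.

Lemma measurable_rotated t a : measurable_fun setT (rotated t a).
Proof. by case: a => j; apply: measurable_funD; apply: measurable_funM. Qed.

Let cos_product a b c :
  \int[PP]_w cos (\sum_j a j * X j w.1 + \sum_j b j * X j w.2 + c) =
  cos c * expR (- quadratic_form a / 2) * expR (- quadratic_form b / 2).
Proof.
rewrite Rintegral_product_bounded; last first.
  apply: bounded_mfun_cos; apply: measurable_funD => //; apply: measurable_funD.
    exact: measurableT_comp (measurable_lin a) measurable_fst.
  exact: measurableT_comp (measurable_lin b) measurable_snd.
transitivity (\int[P]_x (expR (- quadratic_form b / 2) * cos (\sum_j a j * X j x + c))).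
  apply: eq_Rintegral => x _; rewrite [RHS]mulrC -cos_family.
  by apply: eq_Rintegral => y _; rewrite /= addrAC [in RHS]addrC.
rewrite bounded_RintegralZ; last first.
  by apply: bounded_mfun_cos; apply: measurable_funD.
by rewrite cos_family mulrC.
Qed.

Let big_sumJ (F : J + J -> R) : \sum_a F a = \sum_j F (inl j) + \sum_j F (inr j).
Proof. exact: big_sumType. Qed.

Let quadratic_rotation t (a b : J -> R) :
  quadratic_form (fun j => a j * cos t - b j * sin t) +
  quadratic_form (fun j => a j * sin t + b j * cos t) =
  quadratic_form a + quadratic_form b.
Proof.
rewrite /quadratic_form -!big_split/=; apply: eq_bigr => j _.
rewrite -!big_split/=; apply: eq_bigr => k _.
have := cos2Dsin2 t; set x := cos t; set y := sin t => xy.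
transitivity ((x ^+ 2 + y ^+ 2) * (a j * a k * S j k + b j * b k * S j k)); first by ring.
by rewrite xy mul1r.
Qed.

(** Both copies have the same quadratic form, and a rotation of the coefficient pair (a, b)
    preserves the sum of its two values. *)
Lemma cos_rotated t (a : J + J -> R) c :
  \int[PP]_w cos (\sum_e a e * rotated t e w + c) =
  \int[PP]_w cos (\sum_e a e * copies e w + c).
Proof.
pose al j := a (inl j); pose ar j := a (inr j).
transitivity (\int[PP]_w cos (\sum_j (al j * cos t - ar j * sin t) * X j w.1 +
                             \sum_j (al j * sin t + ar j * cos t) * X j w.2 + c)).
  apply: eq_Rintegral => w _; congr (cos (_ + _)).
  rewrite big_sumJ -!big_split/=; apply: eq_bigr => j _.
  by rewrite /rotated /al /ar; ring.
transitivity (\int[PP]_w cos (\sum_j al j * X j w.1 + \sum_j ar j * X j w.2 + c)); last first.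
  by apply: eq_Rintegral => w _; rewrite big_sumJ.
by rewrite !cos_product -!mulrA -!expRD -!mulrDl -!opprD quadratic_rotation.
Qed.

(* Rotation invariance of the pair of independent copies. *)
Lemma rotated_expR_integral t l g : 0 <= l -> l1_lipschitz l g ->
  [/\ measurable_fun setT (fun w => g (rotated t ^~ w)),
      measurable_fun setT (fun w => g (copies ^~ w)) &
      (\int[PP]_w (expR (g (rotated t ^~ w)))%:E =
       \int[PP]_w (expR (g (copies ^~ w)))%:E)%E].
Proof.
apply: lip_expR_same_integral => [a|a|a c].
- exact: measurable_rotated.
- exact: measurable_copies.
- exact: cos_rotated.
Qed.

(* A one-sided second order expansion with gradient [phi]; it is stable under
   minima, unlike differentiability. *)
Definition semismooth (w : J -> R) (f : (J -> R) -> R) :=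
  exists (phi : (J -> R) -> J -> R) (K : R),
  [/\ forall j, measurable_fun setT (fun t => phi (X ^~ t) j),
      forall x j, `|phi x j| <= w j,
      forall x y, f y - f x <=
        \sum_j phi x j * (y j - x j) + K * \sum_j (y j - x j) ^+ 2 &
      forall x y, `|f y - f x| <= \sum_j w j * `|y j - x j| ].

Section maurey_pisier.
Variables (w : J -> R) (f : (J -> R) -> R) (Q : R).
Hypothesis fw : semismooth w f.
Hypothesis wQ : forall a, (forall j, `|a j| <= w j) -> quadratic_form a <= Q.

Let w0 j : 0 <= w j.
Proof. by have [phi [K [_ h _ _]]] := fw; rewrite (le_trans _ (h (fun=> 0) j)). Qed.

Let f_lip : l1_lipschitz (\sum_j w j) f.
Proof.
have [phi [K [_ _ _ h]]] := fw => x y; apply: le_trans (h _ _) _.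
rewrite mulr_sumr ler_sum// => j _; rewrite ler_wpM2r//.
by rewrite (bigD1 j)//= lerDl sumr_ge0.
Qed.

Let sum_w_ge0 : 0 <= \sum_j w j. Proof. exact: sumr_ge0. Qed.

Let step n : R := (pi / 2) / n.+1%:R.

(** The increment of [f] along the first of the n + 1 arcs of the quarter circle, multiplied by the
    number of arcs. *)
Let g n (x : J + J -> R) : R :=
  n.+1%:R * (f (fun j => cos (step n) * x (inl j) + sin (step n) * x (inr j)) -
             f (fun j => x (inl j))).

Let g_lip n : l1_lipschitz (n.+1%:R * (2 * \sum_j w j)) (g n).
Proof.
move=> x y; rewrite /g -mulrBr normrM ger0_norm// -!mulrA ler_wpM2l//.
set a1 := f _; set a2 := f _; set a3 := f _; set a4 := f _.
have -> : a1 - a2 - (a3 - a4) = (a1 - a3) + (a4 - a2) by ring.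
rewrite mulr2n mulrDl mul1r; apply: le_trans (ler_normD _ _) _; apply: lerD.
  apply: le_trans (f_lip _ _) _; rewrite ler_wpM2l// big_sumJ -big_split/=.
  apply: ler_sum => j _; rewrite opprD addrACA -!mulrBr.
  rewrite (le_trans (ler_normD _ _))// !normrM lerD//.
    by rewrite ler_piMl// cos_max.
  by rewrite ler_piMl// sin_max.
rewrite distrC; apply: le_trans (f_lip _ _) _.
by rewrite ler_wpM2l// big_sumJ lerDl sumr_ge0.
Qed.

Let I n := (\int[PP]_z (expR (g n (copies ^~ z)))%:E)%E.

(** f(X') - f(X) telescopes over the arcs into the mean of n + 1 rescaled increments. Convexity of
    exp moves the mean outside, and by rotation invariance every arc contributes the same integral
    [I n]. *)
Let le_I n : (\int[PP]_z (expR (f (X ^~ z.2) - f (X ^~ z.1)))%:E <= I n)%E.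
Proof.
have l0 : 0 <= n.+1%:R * (2 * \sum_j w j) by rewrite !mulr_ge0.
have rotE t := rotated_expR_integral t l0 (g_lip n).
pose A (k : nat) z := f (fun j => rotated (k%:R * step n) (inl j) z).
have gA k z : g n (rotated (k%:R * step n) ^~ z) = n.+1%:R * (A k.+1 z - A k z).
  rewrite /g /A; congr (_ * (f _ - _)); apply/funext => j; rewrite /rotated.
  rewrite -natr1 mulrDl mul1r cosD sinD; ring.
have A0 z : A 0%N z = f (X ^~ z.1).
  by rewrite /A; congr f; apply/funext => j; rewrite /= mul0r cos0 sin0; ring.
have AM z : A n.+1 z = f (X ^~ z.2).
  rewrite /A /step; congr f; apply/funext => j.
  have -> : n.+1%:R * (pi / 2 / n.+1%:R) = pi / 2 :> R.
    by rewrite mulrC divfK.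
  by rewrite /= cos_pihalf sin_pihalf; ring.
have mf z : f (X ^~ z.2) - f (X ^~ z.1) = \sum_(k < n.+1) (A k.+1 z - A k z).
  by rewrite -AM -A0 -(telescope_sumr (fun k => A k z))// big_mkord.
have mg k : measurable_fun setT (fun z => (expR (g n (rotated (k%:R * step n) ^~ z)))%:E).
  apply/measurable_EFinP; apply: measurableT_comp => //.
  by case: (rotE (k%:R * step n)).
have mD k : measurable_fun setT (fun z => A k.+1 z - A k z).
  have -> : (fun z => A k.+1 z - A k z) =
            (fun z => n.+1%:R^-1 * g n (rotated (k%:R * step n) ^~ z)).
    by apply/funext => z; rewrite gA mulKf.
  by apply: measurable_funM => //; case: (rotE (k%:R * step n)).
apply: (@le_trans _ _ (\int[PP]_z (\sum_(k < n.+1)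
    ((n.+1%:R^-1)%:E * (expR (g n (rotated (k%:R * step n) ^~ z)))%:E)))%E).
  apply: ge0_le_integral => //.
  - apply/measurable_EFinP; apply: measurableT_comp => //.
    under eq_fun do rewrite mf; exact: measurable_sum.
  - by apply: emeasurable_sum => k; exact: emeasurable_funM.
  - move=> z _; rewrite sumEFin lee_fin mf.
    have := @expR_mean_le R 'I_n.+1 (fun k => A k.+1 z - A k z).
    rewrite card_ord => /(_ isT) h; apply: (le_trans h).
    by rewrite mulr_sumr; apply: ler_sum => k _; rewrite gA.
rewrite ge0_integral_sum//; last first.
  by move=> k; exact: emeasurable_funM.
have E (k : 'I_n.+1) : (\int[PP]_z ((n.+1%:R^-1)%:E * (expR (g n (rotated (k%:R * step n) ^~ z)))%:E)
     = (n.+1%:R^-1)%:E * I n)%E.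
  rewrite ge0_integralZl//.
  by case: (rotE (k%:R * step n)) => _ _ ->.
under eq_bigr do rewrite E.
rewrite -ge0_sume_distrl; last by move=> k _; rewrite lee_fin invr_ge0.
by rewrite sumEFin sumr_const card_ord -[_ *+ _]mulr_natr mulVf// mul1e.
Qed.

(** Dominates [g n] on the two copies uniformly in n, since the arc length times n + 1 is pi / 2. *)
Let V (z : T * T) : R := pi / 2 * (\sum_j w j * `|X j z.1| + \sum_j w j * `|X j z.2|).

Let integrable_expV : PP.-integrable setT (fun z => (expR (V z))%:E).
Proof.
have mV : measurable_fun setT (fun z => (expR (V z))%:E).
  apply/measurable_EFinP; apply: measurableT_comp => //; apply: measurable_funM => //.
  apply: measurable_funD; apply: measurable_sum => j; apply: measurable_funM => //;
    by apply: measurableT_comp => //.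
apply/integrableP; split => //.
under eq_integral do rewrite gee0_abs ?lee_fin ?expR_ge0//.
rewrite fubini_tonelli1//=.
pose h t := expR (\sum_j (pi / 2 * w j) * `|X j t|).
have mh : measurable_fun setT (fun t => (h t)%:E).
  apply/measurable_EFinP; apply: measurableT_comp => //.
  by apply: measurable_sum => j; apply: measurable_funM => //; exact: measurableT_comp.
have VE x y : (expR (V (x, y)))%:E = ((h x)%:E * (h y)%:E)%E.
  rewrite -EFinM -expRD /V mulrDr !mulr_sumr.
  by congr (expR (_ + _))%:E; apply: eq_bigr => j _; rewrite mulrA.
have hl : (\int[P]_t (h t)%:E < +oo)%E := family_expR_norm_lty _.
have h0 t : (0 <= (h t)%:E)%E by rewrite lee_fin expR_ge0.
rewrite (eq_integral (fun x => (h x)%:E * \int[P]_y (h y)%:E)%E); last first.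
  move=> x _; rewrite /fubini_F; under eq_integral do rewrite VE.
  by rewrite ge0_integralZl// lee_fin expR_ge0.
rewrite ge0_integralZr//; last exact: integral_ge0.
by rewrite lte_mul_pinfty// ?integral_ge0// ge0_fin_numE// integral_ge0.
Qed.

(** Let the arcs of [le_I] shrink. The one-sided expansion of [f] bounds the rescaled increment by
    [U n], which tends to pi / 2 times the pairing of [phi] at X with X'. Conditionally on X this is
    a Gaussian linear form, with variance at most (pi / 2)^2 Q. *)
Theorem maurey_pisier :
  measurable_fun setT (fun t => f (X ^~ t)) /\
  (\int[PP]_z (expR (f (X ^~ z.2) - f (X ^~ z.1)))%:E <= (expR (pi ^+ 2 / 8 * Q))%:E)%E.
Proof.
have [phi [K [mphi phiw fphi flip]]] := fw.
have mfX : measurable_fun setT (fun t => f (X ^~ t)).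
  by have [] := @lip_expR_same_integral R J _ T P X _ T P X mX mX (fun a c => erefl) _ f sum_w_ge0 f_lip.
split=> //.
pose c n : R := n.+1%:R * (cos (step n) - 1).
pose s n : R := n.+1%:R * sin (step n).
pose u (z : T * T) j := phi (X ^~ z.1) j.
pose dz n (z : T * T) j := c n * X j z.1 + s n * X j z.2.
pose U n z := \sum_j u z j * dz n z j + n.+1%:R^-1 * (K * \sum_j dz n z j ^+ 2).
pose Uo z := pi / 2 * \sum_j u z j * X j z.2.
have gU n z : g n (copies ^~ z) <= U n z.
  rewrite /g /U /copies /=; set y := fun j => _ + _.
  have yE j : y j - X j z.1 = n.+1%:R^-1 * dz n z j.
    by rewrite /y /dz /c /s; field; rewrite addrC natr1 gt_eqF.
  have n0 : (0:R) < n.+1%:R by rewrite ltr0n.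
  apply: (le_trans (ler_wpM2l (ltW n0) (fphi (X ^~ z.1) y))).
  rewrite mulrDr; apply: lerD.
    rewrite mulr_sumr; apply: ler_sum => j _; rewrite yE /u mulrCA mulVKf ?gt_eqF//.
  have -> : \sum_j (y j - X j z.1) ^+ 2 = n.+1%:R^-1 ^+ 2 * \sum_j dz n z j ^+ 2.
    by rewrite mulr_sumr; apply: eq_bigr => j _; rewrite yE exprMn.
  set D := \sum_j _ ^+ 2.
  by rewrite le_eqVlt; apply/orP; left; apply/eqP; field; rewrite addrC natr1 gt_eqF.
have gV n z : g n (copies ^~ z) <= V z.
  rewrite /g /V /copies /=; set y := fun j => _ + _.
  have yE j : `|y j - X j z.1| <= step n * (`|X j z.1| + `|X j z.2|).
    have -> : y j - X j z.1 = (cos (step n) - 1) * X j z.1 + sin (step n) * X j z.2.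
      by rewrite /y; ring.
    have st0 : 0 <= step n by rewrite /step !divr_ge0// pi_ge0.
    rewrite mulrDr (le_trans (ler_normD _ _))// !normrM lerD// ler_wpM2r//.
      by have := cos_lip (step n) 0; rewrite cos0 subr0 (ger0_norm st0).
    by have := sin_lip (step n) 0; rewrite sin0 !subr0 (ger0_norm st0).
  have n0 : (0:R) < n.+1%:R by rewrite ltr0n.
  apply: (le_trans (ler_wpM2l (ltW n0) (le_trans (ler_norm _) (flip (X ^~ z.1) y)))).
  rewrite -big_split/= !mulr_sumr; apply: ler_sum => j _.
  apply: le_trans (_ : n.+1%:R * (w j * (step n * (`|X j z.1| + `|X j z.2|))) <= _).
    by rewrite ler_wpM2l// ler_wpM2l.
  rewrite /step le_eqVlt; apply/orP; left; apply/eqP.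
  set p := pi; set a := `|_|; set b := `|_|.
  by field; rewrite addrC natr1 gt_eqF.
have mXf j : measurable_fun setT (fun z : T * T => X j z.1) by exact: mX_fst.
have mXs j : measurable_fun setT (fun z : T * T => X j z.2) by exact: mX_snd.
have mu_ j : measurable_fun setT (fun z => u z j).
  exact: measurableT_comp (mphi j) measurable_fst.
have mdz n j : measurable_fun setT (fun z => dz n z j).
  by apply: measurable_funD; exact: measurable_funM.
have mU n : measurable_fun setT (U n).
  apply: measurable_funD.
    by apply: measurable_sum => j; exact: measurable_funM.
  do 2 apply: measurable_funM => //.
  by apply: measurable_sum => j; exact: measurable_funX.
have mV : measurable_fun setT V.
  apply: measurable_funM => //.
  apply: measurable_funD; apply: measurable_sum => j; apply: measurable_funM => //;
    by apply: measurableT_comp => //.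
have mUo : measurable_fun setT Uo.
  by apply: measurable_funM => //; apply: measurable_sum => j; exact: measurable_funM.
have cvgU z : (fun n => U n z) @ \oo --> Uo z.
  have cd j : (fun n => dz n z j) @ \oo --> pi / 2 * X j z.2.
    rewrite -[X in _ --> X]add0r -(mul0r (X j z.1)).
    apply: cvgD; (apply: cvgM; last exact: cvg_cst).
      exact: cvg_scaled_cos.
    exact: cvg_scaled_sin.
  rewrite -[X in _ --> X]addr0 -[X in _ --> _ + X](mul0r (K * \sum_j (pi / 2 * X j z.2) ^+ 2)).
  apply: cvgD.
    rewrite /Uo mulr_sumr; apply: cvg_sumr => j.
    by rewrite [X in _ --> X]mulrCA; apply: cvgM; [exact: cvg_cst|exact: cd].
  apply: cvgM; first exact: cvg_harmonic.
  apply: cvgM; first exact: cvg_cst.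
  by apply: cvg_sumr => j; rewrite expr2; under eq_fun do rewrite expr2; apply: cvgM.
(* [U n] has a quadratic term whose exponential need not be integrable; the minimum with [V] still
   bounds [g n] and is dominated by an integrable function. *)
pose h n z := expR (Num.min (U n z) (V z)).
have Ih n : (I n <= \int[PP]_z (h n z)%:E)%E.
  apply: ge0_le_integral => //.
  - apply/measurable_EFinP; apply: measurableT_comp => //.
    have l0 : 0 <= n.+1%:R * (2 * \sum_j w j) by rewrite !mulr_ge0.
    by case: (rotated_expR_integral 0 l0 (g_lip n)).
  - by apply/measurable_EFinP; apply: measurableT_comp => //; exact: measurable_minr.
  - by move=> z _; rewrite lee_fin ler_expR le_min gU gV.
have cvgh : (fun n => \int[PP]_z (h n z)%:E)%E @ \oo -->
    (\int[PP]_z (expR (Num.min (Uo z) (V z)))%:E)%E.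
  apply: (@dominated_cvg _ _ _ PP _ measurableT (fun n z => (h n z)%:E) _ (fun z => (expR (V z))%:E)) => //.
  - by move=> n; apply/measurable_EFinP; apply: measurableT_comp => //; exact: measurable_minr.
  - move=> z _; apply: cvg_EFin; first exact: nearW.
    have := @cvg_minr_cst R _ _ (V z) (cvgU z).
    by apply: continuous_cvg; exact: continuous_expR.
  - by move=> n z _; rewrite lee_fin ger0_norm ?expR_ge0// ler_expR ge_min lexx orbT.
apply: (@le_trans _ _ (\int[PP]_z (expR (Uo z))%:E)%E).
  apply: (@le_trans _ _ (\int[PP]_z (expR (Num.min (Uo z) (V z)))%:E)%E).
    rewrite -(cvg_lim _ cvgh)//; apply: lime_ge; first by apply/cvg_ex; eexists; exact: cvgh.
    by apply: nearW => n; exact: le_trans (le_I n) (Ih n).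
  apply: ge0_le_integral => //.
  - by apply/measurable_EFinP; apply: measurableT_comp => //; exact: measurable_minr.
  - by apply/measurable_EFinP; apply: measurableT_comp.
  - by move=> z _; rewrite lee_fin ler_expR ge_min lexx.
rewrite fubini_tonelli1//=; last by apply/measurable_EFinP; apply: measurableT_comp.
apply: (@le_trans _ _ (\int[P]_t cst (expR (pi ^+ 2 / 8 * Q))%:E t)%E); last first.
  rewrite integral_cst//= -[leRHS]mule1 lee_wpmul2l ?lee_fin ?expR_ge0//.
  exact: probability_le1.
apply: ge0_le_integral => //.
- by move=> t _; apply: integral_ge0 => y _; rewrite lee_fin expR_ge0.
- apply: measurable_fun_fubini_tonelli_F => //.
  by apply/measurable_EFinP; apply: measurableT_comp.
- move=> t _; rewrite /fubini_F.
  (* With the first copy frozen, the exponent is linear in the second one with coefficients pi / 2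
     times [phi]; the factor (pi / 2)^2 / 2 gives pi^2 / 8. *)
  rewrite (eq_integral (fun y => (expR (\sum_j (pi / 2 * phi (X ^~ t) j) * X j y))%:E)); last first.
    move=> y _; congr (expR _)%:E; rewrite /Uo mulr_sumr.
    by apply: eq_bigr => j _; rewrite mulrA.
  rewrite family_mgf lee_fin ler_expR.
  have -> : quadratic_form (fun j => pi / 2 * phi (X ^~ t) j) =
      (pi / 2) ^+ 2 * quadratic_form (phi (X ^~ t)).
    rewrite /quadratic_form mulr_sumr; apply: eq_bigr => j _.
    by rewrite mulr_sumr; apply: eq_bigr => k _; ring.
  have -> : pi ^+ 2 / 8 * Q = (pi / 2) ^+ 2 * Q / 2 by field.
  rewrite ler_wpM2r// ler_wpM2l ?sqr_ge0//.
  exact: wQ.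
Qed.

End maurey_pisier.

End gaussian_family.

(** * Smoothed absolute values and semismooth functions *)

Section smoothed_norm.
Context {R : realType}.
Implicit Types e x y : R.

Definition smooth_norm e x : R := Num.sqrt (e ^+ 2 + x ^+ 2).

Lemma smooth_norm_sqr e x : smooth_norm e x ^+ 2 = e ^+ 2 + x ^+ 2.
Proof. by rewrite sqr_sqrtr// addr_ge0 ?sqr_ge0. Qed.

Lemma smooth_norm_ge0 e x : 0 <= smooth_norm e x. Proof. exact: sqrtr_ge0. Qed.

Lemma le_smooth_norm e x : `|x| <= smooth_norm e x.
Proof. by rewrite -sqrtr_sqr ler_wsqrtr// lerDr sqr_ge0. Qed.

Lemma le_smooth_norm0 e x : 0 <= e -> e <= smooth_norm e x.
Proof. by move=> e0; rewrite -{1}(ger0_norm e0) -sqrtr_sqr ler_wsqrtr// lerDl sqr_ge0. Qed.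

Lemma smooth_norm_le e x : 0 <= e -> smooth_norm e x <= e + `|x|.
Proof.
move=> e0; have h : 0 <= e + `|x| by rewrite addr_ge0.
rewrite -[leRHS](ger0_norm h) -sqrtr_sqr ler_wsqrtr// sqrrD real_normK ?num_real//.
by rewrite addrAC lerDl mulrn_wge0// mulr_ge0.
Qed.

(** Concavity of the square root: s - r <= (s^2 - r^2) / (2r), whose right-hand side is exactly
    quadratic in y - x; then r >= e in the second order term. *)
Lemma smooth_norm_expansion e x y : 0 < e ->
  smooth_norm e y - smooth_norm e x <=
  x / smooth_norm e x * (y - x) + (2 * e)^-1 * (y - x) ^+ 2.
Proof.
move=> e0; set r := smooth_norm e x; set s := smooth_norm e y.
have er : e <= r by rewrite le_smooth_norm0// ltW.
have r0 : 0 < r by exact: lt_le_trans er.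
apply: (@le_trans _ _ (x / r * (y - x) + (2 * r)^-1 * (y - x) ^+ 2)); last first.
  rewrite lerD2l ler_wpM2r ?sqr_ge0// lef_pV2 ?posrE ?mulr_gt0//.
  by rewrite ler_pM2l.
have -> : x / r * (y - x) + (2 * r)^-1 * (y - x) ^+ 2 = (y ^+ 2 - x ^+ 2) / (2 * r).
  by field; rewrite gt_eqF.
rewrite ler_pdivlMr ?mulr_gt0//.
have := smooth_norm_sqr e x; have := smooth_norm_sqr e y.
rewrite -/r -/s; have := sqr_ge0 (s - r); nra.
Qed.

Lemma smooth_norm_lip e x y : `|smooth_norm e y - smooth_norm e x| <= `|y - x|.
Proof.
have H (a b : R) : smooth_norm e a <= smooth_norm e b + `|a - b|.
  have h : 0 <= smooth_norm e b + `|a - b| by rewrite addr_ge0 ?smooth_norm_ge0.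
  rewrite -[leRHS](ger0_norm h) -sqrtr_sqr ler_wsqrtr// sqrrD smooth_norm_sqr.
  rewrite real_normK ?num_real//.
  have : b * (a - b) <= smooth_norm e b * `|a - b|.
    apply: le_trans (ler_norm _) _; rewrite normrM ler_wpM2r//.
    exact: le_smooth_norm.
  rewrite -mulr_natl; nra.
rewrite ler_norml; apply/andP; split.
  by rewrite lerBrDl lerBlDr distrC H.
by rewrite lerBlDr addrC H.
Qed.

Lemma smooth_norm_continuous e : continuous (smooth_norm e).
Proof.
move=> x; apply/cvgrPdist_le => eps eps0.
have := nbhsx_ballx x eps eps0; apply: filterS => y /= xy.
by apply: le_trans (smooth_norm_lip _ _ _) _; exact: ltW.
Qed.

End smoothed_norm.

Section semismooth_closure.
Context {R : realType} {J : finType}.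
Context d (T : measurableType d) (X : J -> T -> R).
Hypothesis mX : forall j, measurable_fun setT (X j).
Variable w : J -> R.
Hypothesis w0 : forall j, 0 <= w j.

(** A smoothed cone of height [a] centred at [c], the building block of a McShane extension for the
    weighted distance. *)
Definition smooth_cone (a e : R) (c : J -> R) (x : J -> R) : R :=
  a + \sum_j w j * smooth_norm e (x j - c j).

Lemma semismooth_cone a e c : 0 < e -> semismooth X w (smooth_cone a e c).
Proof.
move=> e0.
have r0 x : 0 < smooth_norm e x :> R.
  exact: lt_le_trans e0 (le_smooth_norm0 _ (ltW e0)).
exists (fun x j => w j * ((x j - c j) / smooth_norm e (x j - c j))), ((\sum_j w j) / (2 * e)).
split=> [j|x j|x y|x y].
- apply: measurable_funM => //; apply: measurable_funM; first exact: measurable_funB.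
  have cc : continuous (fun z : R => (smooth_norm e z)^-1).
    move=> z; apply: cvgV; first by rewrite gt_eqF.
    exact: smooth_norm_continuous.
  apply: (measurableT_comp (f := fun z : R => (smooth_norm e z)^-1)).
    exact: continuous_measurable_fun.
  exact: measurable_funB.
- rewrite normrM (ger0_norm (w0 j)) ler_piMr// normrM normfV.
  by rewrite (ger0_norm (smooth_norm_ge0 _ _)) ler_pdivrMr// mul1r le_smooth_norm.
- rewrite /smooth_cone opprD addrACA subrr add0r -sumrB mulr_sumr -big_split/=.
  apply: ler_sum => j _; rewrite -mulrBr.
  apply: le_trans (ler_wpM2l (w0 j) (smooth_norm_expansion _ _ e0)) _.
  have -> : y j - c j - (x j - c j) = y j - x j by ring.
  rewrite mulrDr mulrA lerD2l mulrA ler_wpM2r ?sqr_ge0// ler_wpM2r//.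
    by rewrite invr_ge0 mulr_ge0// ltW.
  by rewrite (bigD1 j)//= lerDl sumr_ge0.
- rewrite /smooth_cone opprD addrACA subrr add0r -sumrB.
  apply: le_trans (ler_norm_sum _ _ _) _; apply: ler_sum => j _.
  rewrite -mulrBr normrM (ger0_norm (w0 j)) ler_wpM2l//.
  by apply: le_trans (smooth_norm_lip _ _ _) _; rewrite opprB addrA subrK.
Qed.

Lemma measurable_smooth_cone a e c :
  measurable_fun setT (fun t => smooth_cone a e c (X ^~ t)).
Proof.
apply: measurable_funD => //; apply: measurable_sum => j; apply: measurable_funM => //.
apply: (measurableT_comp (f := smooth_norm e)).
  by apply: continuous_measurable_fun; exact: smooth_norm_continuous.
exact: measurable_funB.
Qed.

(** At x, use the gradient of whichever function attains the minimum: the minimum at y is at most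
    that function at y, so the upper expansion persists. *)
Lemma semismooth_min f g :
  measurable_fun setT (fun t => f (X ^~ t)) -> measurable_fun setT (fun t => g (X ^~ t)) ->
  semismooth X w f -> semismooth X w g ->
  semismooth X w (fun x => Num.min (f x) (g x)).
Proof.
move=> mf mg [p [K [mp pw fp fl]]] [q [L [mq qw gq gl]]].
exists (fun x => if f x <= g x then p x else q x), (Num.max K L).
have sq0 (x y : J -> R) : 0 <= \sum_j (y j - x j) ^+ 2.
  by apply: sumr_ge0 => j _; exact: sqr_ge0.
split=> [j|x j|x y|x y].
- rewrite (_ : (fun t => _) = (fun t => if f (X ^~ t) <= g (X ^~ t) then p (X ^~ t) j else q (X ^~ t) j)); last first.
    by apply/funext => t; case: ifP.
  by apply: measurable_fun_ifT => //; exact: measurable_fun_ler.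
- by case: ifP.
- have [fg|gf] := leP (f x) (g x).
    apply: (@le_trans _ _ (f y - f x)); first by rewrite lerD2r ge_min lexx.
    by apply: le_trans (fp x y) _; rewrite lerD2l ler_wpM2r// le_max lexx.
  apply: (@le_trans _ _ (g y - g x)); first by rewrite lerD2r ge_min lexx orbT.
  by apply: le_trans (gq x y) _; rewrite lerD2l ler_wpM2r// le_max lexx orbT.
- set D := \sum_j _; have := fl x y; have := gl x y; rewrite -/D !ler_norml.
  by move=> /andP[? ?] /andP[? ?]; case: (leP (f x) (g x)) => ?; case: (leP (f y) (g y)) => ?; apply/andP; split; lra.
Qed.

End semismooth_closure.

(** * Exponential inequality for functionals that are Lipschitz up to a vanishing error *)

Section approximation.
Context {R : realType} d (T : measurableType d) (P : probability T R).
Variables (J : nat -> finType) (X : forall m, J m -> T -> R) (w : forall m, J m -> R).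
Variable S : forall m, J m -> J m -> R.
Hypothesis mX : forall m j, measurable_fun setT (@X m j).
Hypothesis w0 : forall m j, 0 <= @w m j.
Hypothesis S_ge0 : forall m a, 0 <= quadratic_form (@S m) a.
Hypothesis cos_family : forall m a c,
  \int[P]_t cos (\sum_j a j * @X m j t + c) = cos c * expR (- quadratic_form (@S m) a / 2).
Variable Q : R.
Hypothesis wQ : forall m a, (forall j, `|a j| <= @w m j) -> quadratic_form (@S m) a <= Q.
Variables (G : T -> R) (err : nat -> T -> R) (rho : T -> T -> R) (t_ : nat -> T).
Hypothesis err_cvg : forall t, (fun m => err m t) @ \oo --> (0 : R).
Hypothesis G_le : forall m s t, `|G s - G t| <=
  \sum_j @w m j * `|@X m j s - @X m j t| + err m s + err m t.
Hypothesis w_rho : forall m s t, \sum_j @w m j * `|@X m j s - @X m j t| <= rho s t.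
Hypothesis dense : forall t e, 0 < e -> exists i, rho t (t_ i) <= e.

Let G_rho s t : `|G s - G t| <= rho s t.
Proof.
have c0 : (fun m => rho s t + err m s + err m t) @ \oo --> rho s t.
  rewrite -[X in _ --> X]addr0 -[X in _ --> X + _]addr0.
  by apply: cvgD; [apply: cvgD; [exact: cvg_cst|]|].
apply: (ler_cvg_to (cvg_cst `|G s - G t|) c0).
apply: nearW => m; apply: le_trans (G_le m s t) _.
by rewrite !lerD2r.
Qed.

(** For the n-th approximation, a family fine enough that the errors at the first n + 1 centres are
    at most 1 / (n + 1). *)
Let level (n : nat) : {m | forall i, (i <= n)%N -> err m (t_ i) <= n.+1%:R^-1 & (n <= m)%N}.
Proof.
apply: cid2.
have : \forall m \near \oo, forall i : 'I_n.+1, err m (t_ i) <= n.+1%:R^-1.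
  apply: filter_forall => i.
  have n0 : (0 : R) < n.+1%:R^-1 by rewrite invr_gt0.
  have /cvgrPdist_le/(_ _ n0) := err_cvg (t_ i).
  apply: filterS => m; rewrite sub0r normrN; apply: le_trans; exact: ler_norm.
move=> [m _ Hm]; exists (maxn m n); last exact: leq_maxr.
move=> i; rewrite -ltnS => ilt; have := Hm (maxn m n) (leq_maxl _ _).
by move=> /(_ (Ordinal ilt)).
Qed.

Let m_ n := s2val (level n).
(** Chosen so that smoothing all the weighted absolute values costs at most 1 / (n + 1) in total. *)
Let eps n : R := (n.+1%:R * (1 + \sum_j @w (m_ n) j))^-1.

Let sw_ge0 n : 0 <= \sum_j @w n j. Proof. exact: sumr_ge0. Qed.

Let eps_gt0 n : 0 < eps n.
Proof. by rewrite invr_gt0 mulr_gt0// ltr_wpDr. Qed.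

Let cone n i := smooth_cone (@w (m_ n)) (G (t_ i)) (eps n) (fun j => @X (m_ n) j (t_ i)).

(** McShane extension from finitely many centres [t_]: the smallest of the cones of height
    [G (t_ k)], for k <= i. *)
Let Fixpoint inf_cone n i : (J (m_ n) -> R) -> R :=
  if i is k.+1 then fun x => Num.min (@inf_cone n k x) (@cone n k.+1 x) else @cone n 0%N.

Let inf_cone_semismooth n i :
  measurable_fun setT (fun t => @inf_cone n i (@X (m_ n) ^~ t)) /\
  semismooth (@X (m_ n)) (@w (m_ n)) (@inf_cone n i).
Proof.
have H k : measurable_fun setT (fun t => @cone n k (@X (m_ n) ^~ t)) /\
           semismooth (@X (m_ n)) (@w (m_ n)) (@cone n k).
  split; first exact: measurable_smooth_cone.
  exact: semismooth_cone.
elim: i => [|i [mi si]]; first exact: H.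
have [mk sk] := H i.+1; split; first exact: measurable_minr.
exact: semismooth_min.
Qed.

Let inf_cone_le n i k x : (k <= i)%N -> @inf_cone n i x <= @cone n k x.
Proof.
elim: i => [|i IH]; first by rewrite leqn0 => /eqP ->.
rewrite leq_eqVlt => /predU1P[->|]; first by rewrite /= ge_min lexx orbT.
by rewrite ltnS => /IH h; rewrite /= ge_min h.
Qed.

Let le_inf_cone n i x y : (forall k, (k <= i)%N -> y <= @cone n k x) -> y <= @inf_cone n i x.
Proof.
elim: i => [|i IH] H /=; first exact: H.
by rewrite le_min H// IH// => k ki; apply: H; exact: leqW.
Qed.

Let f n t := @inf_cone n n (@X (m_ n) ^~ t).

(** From below, every cone is above G up to the errors at t and at its centre. From above, a centre
    close to t gives a cone value close to G t, and density supplies one that is eventually among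
    those used. *)
Let f_cvg t : (fun n => f n t) @ \oo --> G t.
Proof.
have e1 n : \sum_j @w (m_ n) j * eps n <= n.+1%:R^-1.
  rewrite -mulr_suml /eps invfM mulrCA ler_piMr// ler_pdivrMr ?ltr_wpDr// mul1r.
  by rewrite lerDr.
have lower n : G t - err (m_ n) t - n.+1%:R^-1 <= f n t.
  apply: le_inf_cone => k kn.
  have := s2valP (level n) k kn; rewrite -/(m_ n) => ek.
  have := ler_normlW (G_le (m_ n) t (t_ k)) => h.
  have : \sum_j @w (m_ n) j * `|X j t - X j (t_ k)| <=
         \sum_j @w (m_ n) j * smooth_norm (eps n) (X j t - X j (t_ k)).
    by apply: ler_sum => j _; rewrite ler_wpM2l// le_smooth_norm.
  rewrite /cone /smooth_cone /=.
  move: h ek; set A := \sum_j _; set B := \sum_j _; set q := n.+1%:R^-1.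
  by move: (G t) (G (t_ k)) (err (m_ n) t) (err (m_ n) (t_ k)) A B q => *; lra.
have upper n i : (i <= n)%N -> f n t <= G t + 2 * rho t (t_ i) + n.+1%:R^-1.
  move=> ni; apply: le_trans (@inf_cone_le n n i _ ni) _.
  have : \sum_j @w (m_ n) j * smooth_norm (eps n) (X j t - X j (t_ i)) <=
      \sum_j @w (m_ n) j * eps n + \sum_j @w (m_ n) j * `|X j t - X j (t_ i)|.
    rewrite -big_split/=; apply: ler_sum => j _; rewrite -mulrDr ler_wpM2l//.
    by apply: smooth_norm_le; exact: ltW.
  have := w_rho (m_ n) t (t_ i); have := e1 n.
  have := G_rho t (t_ i); rewrite distrC => /ler_normlW.
  rewrite /cone /smooth_cone /=; set A := \sum_j _; set B := \sum_j _; set C := \sum_j _.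
  set q := n.+1%:R^-1; set rh := rho _ _; move: (G t) (G (t_ i)) A B C q rh => *; lra.
apply/cvgrPdist_le => e e0.
have e4 : 0 < e / 4 by rewrite divr_gt0.
have [i Hi] := dense t e4.
have /cvgrPdist_le/(_ _ e4) [N1 _ H1] := @cvg_harmonic R.
have /cvgrPdist_le/(_ _ e4) [N2 _ H2] := err_cvg t.
exists (maxn i (maxn N1 N2)) => // n /=; rewrite !geq_max => /andP[ni /andP[n1 n2]].
have := H1 n n1; rewrite /= sub0r normrN ger0_norm ?invr_ge0// => h1.
have := H2 (m_ n) (leq_trans n2 (s2valP' (level n))).
rewrite /= sub0r normrN => /ler_normlW h2.
have := lower n; have := upper n i ni; move: h1 h2 Hi.
set q := n.+1%:R^-1; move: (f n t) (G t) (err (m_ n) t) (rho t (t_ i)) q => F g E r q *.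
by rewrite ler_norml; apply/andP; split; lra.
Qed.

(** Each minimum of cones is semismooth, so [maurey_pisier] bounds it uniformly in n. The pointwise
    limit [f_cvg] makes [G] measurable, and Fatou passes the bound on. *)
Theorem approximation_expR : measurable_fun setT G /\
  (\int[(P \x P)%E]_z (expR (G z.2 - G z.1))%:E <= (expR (pi ^+ 2 / 8 * Q))%:E)%E.
Proof.
have mf n : measurable_fun setT (f n) by case: (inf_cone_semismooth n n).
have mG : measurable_fun setT G.
  by apply: (measurable_fun_cvg mf) => t _; exact: f_cvg.
split=> //.
have If n : (\int[(P \x P)%E]_z (expR (f n z.2 - f n z.1))%:E <= (expR (pi ^+ 2 / 8 * Q))%:E)%E.
  have [_ sn] := inf_cone_semismooth n n.
  by have [] := maurey_pisier (mX (m := m_ n)) (S_ge0 (m := m_ n)) (cos_family (m := m_ n)) sn (wQ (m := m_ n)).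
have mfz n : measurable_fun setT (fun z : T * T => (expR (f n z.2 - f n z.1))%:E).
  apply/measurable_EFinP; apply: measurableT_comp => //; apply: measurable_funB.
    exact: measurableT_comp (mf n) measurable_snd.
  exact: measurableT_comp (mf n) measurable_fst.
have lim z : limn_einf (fun n => (expR (f n z.2 - f n z.1))%:E) = (expR (G z.2 - G z.1))%:E.
  apply: (fst (cvg_limn_einf_sup _)); apply: cvg_EFin; first exact: nearW.
  have : (fun n => f n z.2 - f n z.1) @ \oo --> G z.2 - G z.1 by apply: cvgB.
  by apply: continuous_cvg; exact: continuous_expR.
rewrite (eq_integral (fun z => limn_einf (fun n => (expR (f n z.2 - f n z.1))%:E))); last first.
  by move=> z _; rewrite lim.
apply: le_trans (fatou _ _ _ _) _ => //.
rewrite limn_einf_lim; apply: lime_le; first exact: is_cvg_einfs.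
apply: nearW => n; apply: le_trans (If n).
by apply: ereal_inf_lbound; exists n => /=.
Qed.

End approximation.

(** * From the two-copy exponential inequality to a tail bound *)

Section chernoff_bound.
Context {R : realType} d (T : measurableType d) (P : probability T R).
Variables (G : T -> R) (c Q : R).
Hypothesis mG : measurable_fun setT G.
Hypotheses (c0 : 0 < c) (Q0 : 0 < Q).
Hypothesis GQ : forall l, 0 < l ->
  (\int[(P \x P)%E]_z (expR (l * (G z.2 - G z.1)))%:E <= (expR (c * l ^+ 2 * Q))%:E)%E.

Let me l : measurable_fun setT (fun t => (expR (l * G t))%:E).
Proof.
apply/measurable_EFinP; apply: measurableT_comp => //; exact: measurable_funM.
Qed.

Let factor l :
  (\int[(P \x P)%E]_z (expR (l * (G z.2 - G z.1)))%:E =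
   (\int[P]_t (expR (- l * G t))%:E) * \int[P]_t (expR (l * G t))%:E)%E.
Proof.
have mz : measurable_fun setT (fun z : T * T => (expR (l * (G z.2 - G z.1)))%:E).
  apply/measurable_EFinP; apply: measurableT_comp => //; apply: measurable_funM => //.
  by apply: measurable_funB; [exact: measurableT_comp mG measurable_snd|exact: measurableT_comp mG measurable_fst].
rewrite fubini_tonelli1//=.
rewrite (eq_integral (fun x => (expR (- l * G x))%:E * \int[P]_y (expR (l * G y))%:E)%E).
  by rewrite ge0_integralZr// integral_ge0// => y _; rewrite lee_fin expR_ge0.
move=> x _; rewrite /fubini_F -ge0_integralZl ?lee_fin ?expR_ge0//.
by apply: eq_integral => y _; rewrite -EFinM -expRD; congr (expR _)%:E; rewrite /=; ring.
Qed.

Let pos l : (0 < \int[P]_t (expR (l * G t))%:E)%E.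
Proof.
rewrite lt_neqAle integral_ge0 ?andbT; last by move=> t _; rewrite lee_fin expR_ge0.
apply/eqP => /esym E.
have /ae_eq_integral_abs : (\int[P]_t `|(expR (l * G t))%:E| = 0)%E.
  by under eq_integral do rewrite gee0_abs ?lee_fin ?expR_ge0//.
move=> /(_ measurableT (me l)) [N [mN N0 subN]].
have : (P setT <= P N)%E.
  apply: le_measure; rewrite ?inE//.
  move=> t _; apply: subN => /= /(_ I) /eqP; rewrite eqe.
  by rewrite expR_eq0.
by rewrite probability_setT N0 leNgt lte01.
Qed.

(** The double integral is a product of two strictly positive factors, so its finiteness forces that
    of both. *)
Let finite l : l != 0 -> (\int[P]_t (expR (l * G t))%:E < +oo)%E.
Proof.
have H a : 0 < a -> (\int[P]_t (expR (a * G t))%:E < +oo)%E /\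
                    (\int[P]_t (expR (- a * G t))%:E < +oo)%E.
  move=> a0; have := GQ a0; rewrite factor.
  have := pos a; have := pos (- a).
  set A := (\int[P]_t (expR (- a * G t))%:E)%E; set B := (\int[P]_t (expR (a * G t))%:E)%E.
  by case: A => [x| |]; case: B => [y| |] //= x0 y0;
    rewrite ?ltry// ?gt0_muley ?gt0_mulye// leye_eq.
move=> l0; have [/H[]//|ln|/eqP] := ltgtP 0 l; last by rewrite eq_sym (negbTE l0).
have : 0 < - l by rewrite oppr_gt0.
by move=> /H[_]; rewrite opprK.
Qed.

Let integrable_exp l : l != 0 -> P.-integrable setT (fun t => (expR (l * G t))%:E).
Proof.
move=> l0; apply/integrableP; split; first exact: me.
under eq_integral do rewrite gee0_abs ?lee_fin ?expR_ge0//.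
exact: finite.
Qed.

Lemma exp_moment_integrable : P.-integrable setT (EFin \o G).
Proof.
have N1 : (-1 : R) != 0 by rewrite oppr_eq0 oner_neq0.
have := integrableD measurableT (integrable_exp (oner_neq0 R)) (integrable_exp N1).
apply: le_integrable => //; first exact/measurable_EFinP.
move=> t _ /=; rewrite lee_fin mul1r mulN1r (le_trans (normr_le_cosh _))//.
exact: ler_norm.
Qed.

(** By independence the two-copy moment is E exp(-lG) E exp(lG), and Jensen bounds the first factor
    below by exp(-l E G). This gives E exp(l(G - E G)) <= exp(c l^2 Q), to which Markov applies. *)
Lemma chernoff_expR (r : R) : 0 <= r ->
  (P [set t | r%:E < (G t)%:E - 'E_P[G]] <= (expR (- (r ^+ 2 / (4 * c * Q))))%:E)%E.
Proof.
move=> r0; have iG := exp_moment_integrable.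
set E := \int[P]_t G t.
have EE : ('E_P[G] = E%:E)%E.
  by rewrite unlock /E /Rintegral fineK//; exact: integrable_fin_num.
have setE : [set t | (r%:E < (G t)%:E - 'E_P[G])%E] = [set t | r + E < G t].
  by apply/seteqP; split => t /=; rewrite EE -EFinB lte_fin ltrBrDr.
rewrite setE.
have mS : measurable [set t | r + E < G t].
  have -> : [set t | r + E < G t] = G @^-1` `]r + E, +oo[%classic.
    by apply/seteqP; split => t /=; rewrite in_itv/= andbT.
  by rewrite -[X in measurable X]setTI; apply: mG => //; exact: measurable_itv.
have r1 := probability_le1 P mS.
have [rE|rN0] := eqVneq r 0.
  by rewrite {2}rE expr0n mul0r oppr0 expR0.
have rp : 0 < r by rewrite lt_neqAle eq_sym rN0.
(* Minimiser of - l r + c l^2 Q. *)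
set l := r / (2 * c * Q).
have l0 : 0 < l by rewrite divr_gt0// !mulr_gt0.
have lN0 : - l != 0 by rewrite oppr_eq0 gt_eqF.
(* Jensen's inequality through the tangent line of the exponential. *)
have icE : P.-integrable setT (EFin \o cst E) by exact: finite_measure_integrable_cst.
have ib0 : P.-integrable setT (EFin \o (fun t => G t - E)).
  exact: (integrableB measurableT iG icE).
have ib : P.-integrable setT (EFin \o (fun t => - l * (G t - E))).
  exact: (integrableZl measurableT (- l) ib0).
have i1 : P.-integrable setT (EFin \o (fun=> 1 : R)).
  exact: finite_measure_integrable_cst.
have i2 : P.-integrable setT (EFin \o (fun t => 1 + - l * (G t - E))).
  exact: (integrableD measurableT i1 ib).
pose A := \int[P]_t expR (- l * G t).
have AE : (\int[P]_t (expR (- l * G t))%:E = A%:E)%E.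
  by rewrite /A /Rintegral fineK//; apply: integrable_fin_num => //; exact: integrable_exp.
have jensen : expR (- l * E) <= A.
  have -> : expR (- l * E) = \int[P]_t (expR (- l * E) * (1 + - l * (G t - E))).
    rewrite RintegralZl//.
    rewrite (@RintegralD _ _ _ P setT (fun=> 1) (fun t => - l * (G t - E)))//.
    rewrite RintegralZl// (@RintegralB _ _ _ P setT G (cst E))//.
    by rewrite !Rintegral_probability_cst subrr mulr0 addr0 mulr1.
  apply: le_Rintegral => //.
  - exact: (integrableZl measurableT (expR (- l * E)) i2).
  - exact: integrable_exp.
  - move=> t _; rewrite -[- l * G t](subrK (- l * E)) [X in _ <= expR X]addrC expRD.
    by rewrite ler_wpM2l ?expR_ge0// -mulrBr expR_ge1Dx.
pose C := \int[P]_t expR (l * G t).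
have lN : l != 0 by rewrite gt_eqF.
have CE : (\int[P]_t (expR (l * G t))%:E = C%:E)%E.
  by rewrite /C /Rintegral fineK//; apply: integrable_fin_num => //; exact: integrable_exp.
have C0 : 0 <= C by apply: Rintegral_ge0 => t _; exact: expR_ge0.
have CQ : expR (- l * E) * C <= expR (c * l ^+ 2 * Q).
  have := GQ l0; rewrite factor AE CE -EFinM lee_fin; apply: le_trans.
  exact: ler_wpM2r.
have markov_ineq : ((expR (l * (r + E)%R))%:E * P [set t | (r + E < G t)%R] <= C%:E)%E.
  have -> : P [set t | (r + E < G t)%R] = (\int[P]_t (\1_[set t | (r + E < G t)%R] t)%:E)%E.
    by rewrite integral_indic// setIT.
  have m1 : measurable_fun setT (fun t => (\1_[set t | (r + E < G t)%R] t : R)%:E).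
    by apply/measurable_EFinP; exact: measurable_indic.
  rewrite -CE -ge0_integralZl ?lee_fin ?expR_ge0//.
  apply: ge0_le_integral => //.
  - by apply: emeasurable_funM => //; apply/measurable_EFinP/measurable_indic.
  - move=> t _; rewrite -EFinM lee_fin indicE; case: (boolP (t \in _)) => [|_].
      by rewrite inE /= => /ltW h; rewrite mulr1 ler_expR ler_wpM2l// ltW.
    by rewrite mulr0 expR_ge0.
have -> : - (r ^+ 2 / (4 * c * Q)) = - (l * r) + c * l ^+ 2 * Q.
  by rewrite /l; field; rewrite !gt_eqF.
have e0 : (0 < (expR (l * (r + E)%R)%R)%:E)%E by rewrite lte_fin expR_gt0.
rewrite -(lee_pmul2l _ e0)//; apply: le_trans markov_ineq _.
rewrite -EFinM lee_fin -expRD.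
have -> : l * (r + E) + (- (l * r) + c * l ^+ 2 * Q) = l * E + c * l ^+ 2 * Q by ring.
rewrite expRD -(ler_pM2l (expR_gt0 (- l * E))); apply: le_trans CQ _.
have eN : expR (- l * E) * expR (l * E) = 1 by rewrite mulNr mulrC expRxMexpNx_1.
by rewrite [leRHS]mulrA eN mul1r.
Qed.

End chernoff_bound.

(** * Covariances of increments of fractional Brownian motion *)

Section power_increments.
Context {R : realType}.
Implicit Types p t x y a : R.

Lemma powR_convex p t x y : 1 <= p -> 0 <= t <= 1 -> 0 <= x -> 0 <= y ->
  (t * x + (1 - t) * y) `^ p <= t * x `^ p + (1 - t) * y `^ p.
Proof.
move=> p1 /andP[t0 t1] x0 y0.
have := @convex_powR R p p1 (Itv01 t0 t1) x y.
by rewrite !inE/= !in_itv/= !andbT => /(_ x0 y0); rewrite !convRE.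
Qed.

(** Apply convexity of the inverse power 1/p to x^p and y^p, then raise to the power p. *)
Lemma powR_concave p t x y : 0 < p <= 1 -> 0 <= t <= 1 -> 0 <= x -> 0 <= y ->
  t * x `^ p + (1 - t) * y `^ p <= (t * x + (1 - t) * y) `^ p.
Proof.
move=> /andP[p0 p1] /andP[t0 t1] x0 y0.
have q1 : 1 <= p^-1 by rewrite invf_ge1.
have t01 : 0 <= t <= 1 by rewrite t0.
have t1' : 0 <= 1 - t by rewrite subr_ge0.
have := powR_convex q1 t01 (powR_ge0 x p) (powR_ge0 y p).
rewrite -!powRrM divff ?gt_eqF// !powRr1// => h.
set m := t * x `^ p + _ in h *.
have m0 : 0 <= m by rewrite addr_ge0// mulr_ge0// powR_ge0.
have := ge0_ler_powR (ltW p0) _ _ h; rewrite !nnegrE powR_ge0 addr_ge0 ?mulr_ge0//.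
by move=> /(_ isT isT); rewrite -powRrM mulVf ?gt_eqF// powRr1.
Qed.

(** The sign of the convexity of x^p, so also of the correlation between disjoint increments; it
    lets both regimes of 2H share one argument. *)
Definition powR_sign p : R := if 1 <= p then 1 else -1.

(** The points y and x + a divide [x, y + a] with exchanged weights; add the two convexity (or
    concavity) inequalities. *)
Lemma powR_increment_mono p x y a : 0 < p -> 0 <= x -> x <= y -> 0 <= a ->
  powR_sign p * ((x + a) `^ p - x `^ p) <= powR_sign p * ((y + a) `^ p - y `^ p).
Proof.
move=> p0 x0 xy a0.
have [d0|dN0] := eqVneq (y - x + a) 0.
  have -> : y = x by lra.
  by [].
have d0 : 0 < y - x + a by rewrite lt_neqAle eq_sym dN0/=; lra.
set l := a / (y - x + a).
have l01 : 0 <= l <= 1.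
  by rewrite /l divr_ge0 ?(ltW d0)//= ler_pdivrMr// mul1r; lra.
have l01' : 0 <= 1 - l <= 1 by move: l01 => /andP[? ?]; apply/andP; split; lra.
have Ey : y = l * x + (1 - l) * (y + a) by rewrite /l; field.
have Ex : x + a = (1 - l) * x + (1 - (1 - l)) * (y + a) by rewrite /l; field.
have y0 : 0 <= y + a by lra.
rewrite /powR_sign; case: ifPn => [p1|]; last rewrite -ltNge => /ltW p1.
  have := powR_convex p1 l01 x0 y0; rewrite -Ey.
  have := powR_convex p1 l01' x0 y0; rewrite -Ex.
  set A := x `^ p; set B := (y + a) `^ p; set C := (x + a) `^ p; set D := y `^ p.
  rewrite !mul1r; lra.
have p01 : 0 < p <= 1 by rewrite p0.
have := powR_concave p01 l01 x0 y0; rewrite -Ey.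
have := powR_concave p01 l01' x0 y0; rewrite -Ex.
set A := x `^ p; set B := (y + a) `^ p; set C := (x + a) `^ p; set D := y `^ p.
rewrite !mulN1r; lra.
Qed.

(** Covariance of B_t - B_s and B_t' - B_s' when p = 2H; the terms depending on a single time
    cancel. *)
Definition increment_cov p s t s' t' : R :=
  2^-1 * (`|t - s'| `^ p + `|s - t'| `^ p - `|t - t'| `^ p - `|s - s'| `^ p).

Lemma increment_covC p s t s' t' : increment_cov p s t s' t' = increment_cov p s' t' s t.
Proof.
rewrite /increment_cov (distrC t s') (distrC s t') (distrC t t') (distrC s s').
by rewrite [X in X - _ - _]addrC.
Qed.

Definition second_diff p D (l : nat) : R :=
  powR_sign p * ((l.+1%:R * D) `^ p - (l%:R * D) `^ p - ((l%:R * D) `^ p - (l.-1%:R * D) `^ p)).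

(** The covariance is half a mixed second difference of x^p, of constant sign. By monotone
    increments, its absolute value grows when both increments are stretched to full blocks. *)
Lemma increment_cov_off p D (k l : nat) a a' : 0 < p -> 0 <= D -> (0 < l)%N ->
  0 <= a <= D -> 0 <= a' <= D ->
  `|increment_cov p (k%:R * D) (k%:R * D + a) ((k + l)%:R * D) ((k + l)%:R * D + a')|
    <= 2^-1 * second_diff p D l.
Proof.
move=> p0 D0 l0 /andP[a0 aD] /andP[a'0 a'D].
set x := l%:R * D; have xD : D <= x by rewrite /x ler_peMl// ler1n.
rewrite /increment_cov natrD mulrDl -/x; set s := k%:R * D.
have -> : `|s + a - (s + x)| = x - a by rewrite distrC ger0_norm; lra.
have -> : `|s - (s + x + a')| = x + a' by rewrite distrC ger0_norm; lra.
have -> : `|s + a - (s + x + a')| = x - a + a' by rewrite distrC ger0_norm; lra.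
have -> : `|s - (s + x)| = x by rewrite distrC ger0_norm; lra.
rewrite normrM ger0_norm// ler_wpM2l//.
have sg : `|powR_sign p| = 1 by rewrite /powR_sign; case: ifP => _; rewrite ?normrN normr1.
rewrite -[leLHS]mul1r -sg -normrM.
have m1 := @powR_increment_mono p (x - a) x a' p0 ltac:(lra) ltac:(lra) a'0.
have m2 := @powR_increment_mono p (x - a + a') (x + a') (D - a') p0 ltac:(lra) ltac:(lra) ltac:(lra).
have m3 := @powR_increment_mono p (x - D) (x - a) D p0 ltac:(lra) ltac:(lra) ltac:(lra).
rewrite /second_diff -/x.
have E1 : l.+1%:R * D = x + a' + (D - a') by rewrite -natr1 /x; ring.
have E2 : l.-1%:R * D = x - D.
  by rewrite /x -{2}(prednK l0) -natr1; ring.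
have E3 : x - a + D = x - a + a' + (D - a') by ring.
have E4 : x = x - D + D by ring.
move: m1 m2 m3; rewrite E1 E2 E3 subrK.
set A := (x + a' + (D - a')) `^ p; set B := x `^ p; set C := (x - D) `^ p.
set F := (x - a + a' + (D - a')) `^ p; set G := (x - a) `^ p.
set H := (x + a') `^ p; set I := (x - a + a') `^ p.
rewrite ler_norml => h1 h2 h3; apply/andP; split; lra.
Qed.

Lemma increment_cov_diag p D s a a' : 0 < p -> 0 <= D -> 0 <= a <= D -> 0 <= a' <= D ->
  `|increment_cov p s (s + a) s (s + a')| <= D `^ p.
Proof.
move=> p0 D0 /andP[a0 aD] /andP[a'0 a'D]; rewrite /increment_cov.
have mono x : 0 <= x -> x <= D -> 0 <= x `^ p <= D `^ p.
  by move=> x0 xD; rewrite powR_ge0 ge0_ler_powR ?nnegrE// ltW.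
have -> : `|s + a - s| = a by rewrite ger0_norm; lra.
have -> : `|s - (s + a')| = a' by rewrite distrC ger0_norm; lra.
rewrite subrr normr0 powR0 ?gt_eqF// subr0.
have /andP[? ?] := mono a a0 aD; have /andP[? ?] := mono a' a'0 a'D.
have /andP[? ?] : 0 <= `|s + a - (s + a')| `^ p <= D `^ p.
  by apply: mono => //; rewrite ler_norml; apply/andP; split; lra.
rewrite ler_norml; apply/andP; split; lra.
Qed.

(** The sum telescopes to a difference of two first increments of x^p. For p >= 1 the last one is at
    most 2 n^(p-1) D^p, since (1 - 1/n)^p >= (1 - 1/n)^2 when p <= 2. For p <= 1 the first one, D^p,
    suffices. *)
Lemma sum_second_diff p D n : 0 < p <= 2 -> 0 <= D -> (0 < n)%N ->
  \sum_(1 <= l < n) second_diff p D l <= 2 * (D `^ p * n%:R `^ (Num.max p 1 - 1)).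
Proof.
move=> /andP[p0 p2] D0 n0; have pN0 : p != 0 by rewrite gt_eqF.
have -> : \sum_(1 <= l < n) second_diff p D l =
    powR_sign p * ((n%:R * D) `^ p - (n.-1%:R * D) `^ p - D `^ p).
  case: n n0 => // n _.
  pose u l : R := (l.+1%:R * D) `^ p - (l%:R * D) `^ p.
  rewrite -mulr_sumr big_add1/=.
  rewrite (eq_bigr (fun l => u l.+1 - u l)); last by [].
  rewrite telescope_sumr// /u mul1r mul0r powR0// subr0.
  by congr (_ * _).
have mono (k : nat) : (k%:R * D) `^ p = k%:R `^ p * D `^ p by rewrite powRM.
have Dp : 0 <= D `^ p by exact: powR_ge0.
rewrite !mono /powR_sign; case: ifPn => [p1|]; last rewrite -ltNge => /ltW p1.
  rewrite mul1r max_l//.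
  have n0R : 0 < n%:R :> R by rewrite ltr0n.
  have -> : n%:R `^ (p - 1) = n%:R `^ p / n%:R :> R.
    by rewrite powRB ?powRr1 ?(ltW n0R)//; apply/implyP => _; rewrite gt_eqF.
  suff h : n%:R `^ p - n.-1%:R `^ p <= 2 * (n%:R `^ p / n%:R) :> R.
    have := ler_wpM2r Dp h; nra.
  set q : R := n.-1%:R / n%:R.
  have q01 : 0 <= q <= 1 by rewrite divr_ge0//= ler_pdivrMr// mul1r ler_nat leq_pred.
  have qE : n.-1%:R = q * n%:R :> R by rewrite divfK// gt_eqF.
  have qE2 : q = 1 - n%:R^-1.
    by rewrite /q -{2 3}(prednK n0) -natr1; field; rewrite gt_eqF// ltr_wpDl.
  have np : 0 <= n%:R `^ p :> R by exact: powR_ge0.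
  have q2 : q ^+ 2 <= q `^ p.
    have [->|qN0] := eqVneq q 0; first by rewrite expr0n powR0.
    case/andP: q01 => q0 q1; rewrite -powR_mulrn// ger_powR//.
    by rewrite lt_neqAle eq_sym qN0 q0.
  rewrite qE powRM//; last by case/andP: q01.
  have : (1 - q `^ p) * n%:R `^ p <= (1 - q ^+ 2) * n%:R `^ p.
    by rewrite ler_wpM2r// lerD2l lerN2.
  have : (1 - q ^+ 2) * n%:R `^ p <= (2 * n%:R^-1) * n%:R `^ p.
    by rewrite ler_wpM2r// qE2; have := sqr_ge0 (n%:R^-1 : R); nra.
  lra.
rewrite max_r// subrr powRr0 mulr1 mulN1r.
have h : n.-1%:R `^ p <= n%:R `^ p :> R.
  by apply: ge0_ler_powR; rewrite ?nnegrE ?ler0n ?ler_nat ?leq_pred// ltW.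
by have := ler_wpM2r Dp h; lra.
Qed.

Lemma second_diff_ge0 p D l : 0 < p -> 0 <= D -> (0 < l)%N -> 0 <= second_diff p D l.
Proof.
move=> p0 D0 l0; have xD : D <= l%:R * D by rewrite ler_peMl// ler1n.
have m := @powR_increment_mono p (l%:R * D - D) (l%:R * D) D p0 ltac:(lra) ltac:(lra) D0.
rewrite /second_diff -natr1 mulrDl mul1r.
have -> : l.-1%:R * D = l%:R * D - D by rewrite -{2}(prednK l0) -natr1; ring.
move: m; rewrite subrK; lra.
Qed.

(** Each distance l >= 1 from k is attained at most twice. *)
Lemma sum_nat_dist (r : nat -> R) n k : (forall l, (0 < l)%N -> 0 <= r l) -> (k < n)%N ->
  \sum_(0 <= i < n) r (maxn (k - i) (i - k)) <= r 0%N + 2 * \sum_(1 <= l < n) r l.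
Proof.
move=> r0 kn; rewrite (big_cat_nat (leq0n k) (ltnW kn))/=.
have sub m : (m <= n)%N -> \sum_(1 <= l < m) r l <= \sum_(1 <= l < n) r l.
  move=> mn; have [m1|m1] := leqP 1 m; last first.
    rewrite big_geq; last exact: ltnW.
    by rewrite big_nat_cond sumr_ge0// => l /andP[/andP[l1 _] _]; exact: r0.
  rewrite (big_cat_nat m1 mn)/= lerDl big_nat_cond sumr_ge0// => l.
  by move=> /andP[/andP[ml _] _]; apply: r0; exact: leq_trans ml.
have -> : \sum_(0 <= i < k) r (maxn (k - i) (i - k)) = \sum_(1 <= l < k.+1) r l.
  rewrite big_nat_rev/= big_add1/= !big_nat; apply: eq_bigr => i /andP[_ ik].
  congr r; rewrite add0n subKn// (eqP (_ : k - i.+1 - k == 0)%N) ?maxn0//.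
  by rewrite subn_eq0 leq_subr.
have -> : \sum_(k <= i < n) r (maxn (k - i) (i - k)) = r 0%N + \sum_(1 <= l < n - k) r l.
  rewrite -{1}[k]add0n big_addn big_ltn ?subn_gt0// add0n subnn maxn0.
  congr (_ + _); rewrite !big_nat; apply: eq_bigr => i _.
  by rewrite addnK (eqP (_ : k - (i + k) == 0)%N) ?max0n// subn_eq0 leq_addl.
have := sub _ kn; have := sub _ (leq_subr k n); lra.
Qed.

(** The covariance of two increments is bounded by a function [r] of the distance between their
    blocks only, so the weights factor out as the square of their sum. Each row of [r] sums to at
    most 3 D^p n^(max(p,1) - 1), one part from the diagonal and two from the rest; there are n
    rows. *)
Lemma increments_form_bound p D n m (w a : 'I_m -> R) (phi : 'I_n -> 'I_m -> R) :
  0 < p <= 2 -> 0 <= D -> (0 < n)%N -> (forall j, 0 <= a j <= D) ->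
  (forall k j, `|phi k j| <= w j) ->
  \sum_k \sum_j \sum_k' \sum_j' phi k j * phi k' j' *
     increment_cov p (k%:R * D) (k%:R * D + a j) (k'%:R * D) (k'%:R * D + a j')
  <= (\sum_j w j) ^+ 2 * (3 * (D `^ p * n%:R `^ (Num.max p 1))).
Proof.
move=> /andP[p0 p2] D0 n0 aD phiw.
pose r l : R := if l is 0%N then D `^ p else 2^-1 * second_diff p D l.
have covr (k k' : 'I_n) (j j' : 'I_m) :
    `|increment_cov p (k%:R * D) (k%:R * D + a j) (k'%:R * D) (k'%:R * D + a j')|
    <= r (maxn (k - k') (k' - k)).
  have [kk|kk|->] := ltngtP (k : nat) k'.
  - have -> : maxn (k - k') (k' - k) = (k' - k)%N.
      by apply/maxn_idPr; rewrite (eqP (_ : k - k' == 0)%N)// subn_eq0 ltnW.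
    have -> : r (k' - k)%N = 2^-1 * second_diff p D (k' - k)%N.
      by rewrite /r; case: (k' - k)%N (subn_gt0 k k') => //; rewrite kk.
    rewrite -{1 2}(subnKC (ltnW kk)); apply: increment_cov_off => //.
    by rewrite subn_gt0.
  - have -> : maxn (k - k') (k' - k) = (k - k')%N.
      by apply/maxn_idPl; rewrite (eqP (_ : k' - k == 0)%N)// subn_eq0 ltnW.
    have -> : r (k - k')%N = 2^-1 * second_diff p D (k - k')%N.
      by rewrite /r; case: (k - k')%N (subn_gt0 k' k) => //; rewrite kk.
    rewrite increment_covC -{1 2}(subnKC (ltnW kk)); apply: increment_cov_off => //.
    by rewrite subn_gt0.
  - by rewrite subnn maxnn; exact: increment_cov_diag.
have w0 j : 0 <= w j.
  by apply: le_trans (phiw (Ordinal n0) j).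
have r0 l : (0 < l)%N -> 0 <= r l.
  by case: l => // l _; rewrite /r mulr_ge0// second_diff_ge0.
have step1 (k k' : 'I_n) (j j' : 'I_m) : phi k j * phi k' j' *
     increment_cov p (k%:R * D) (k%:R * D + a j) (k'%:R * D) (k'%:R * D + a j')
    <= w j * w j' * r (maxn (k - k') (k' - k)).
  apply: le_trans (ler_norm _) _; rewrite normrM [X in X * _]normrM; apply: ler_pM => //.
  exact: ler_pM.
apply: (@le_trans _ _ (\sum_(k < n) \sum_(j < m) \sum_(k' < n) \sum_(j' < m)
    w j * w j' * r (maxn (k - k') (k' - k)))).
  apply: ler_sum => k _; apply: ler_sum => j _; apply: ler_sum => k1 _; apply: ler_sum => j1 _; exact: step1.
have -> : \sum_(k < n) \sum_(j < m) \sum_(k' < n) \sum_(j' < m)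
    w j * w j' * r (maxn (k - k') (k' - k)) =
    (\sum_j w j) ^+ 2 * \sum_(k < n) \sum_(k' < n) r (maxn (k - k') (k' - k)).
  rewrite mulr_sumr; apply: eq_bigr => k _.
  rewrite expr2 -mulrA mulr_suml; apply: eq_bigr => j _.
  rewrite mulrA [w j * _]mulrC -mulrA mulr_sumr mulr_sumr; apply: eq_bigr => k' _.
  rewrite mulr_suml; apply: eq_bigr => j' _; ring.
rewrite ler_wpM2l ?sqr_ge0//.
have nR : 0 < n%:R :> R by rewrite ltr0n.
set e := Num.max p 1 - 1.
have e0 : 0 <= e by rewrite subr_ge0 le_max lexx orbT.
have n1 : 1 <= n%:R `^ e :> R by rewrite -[leLHS](powRr0 n%:R) ler_powR// ler1n.
have row (k : 'I_n) : \sum_(k' < n) r (maxn (k - k') (k' - k)) <= 3 * (D `^ p * n%:R `^ e).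
  rewrite -(big_mkord xpredT (fun k' => r (maxn (k - k') (k' - k)))).
  apply: le_trans (sum_nat_dist r0 (ltn_ord k)) _.
  have -> : \sum_(1 <= l < n) r l = 2^-1 * \sum_(1 <= l < n) second_diff p D l.
    rewrite mulr_sumr !big_nat; apply: eq_bigr => l /andP[l1 _].
    by case: l l1.
  have h := @sum_second_diff p D n ltac:(by rewrite p0) D0 n0.
  have := ler_peMr (powR_ge0 D p) n1.
  rewrite /= /e in h *; lra.
apply: le_trans (ler_sum _ (fun k _ => row k)) _.
have E : n%:R `^ e * n%:R = n%:R `^ Num.max p 1 :> R.
  have h : (Num.max p 1 == 1) ==> (n%:R != 0 :> R) by rewrite (gt_eqF nR) implybT.
  by rewrite /e (powRB h) powRr1 ?(ltW nR)// divfK ?(gt_eqF nR).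
by rewrite sumr_const card_ord -E -[_ *+ n]mulr_natr !mulrA.
Qed.

End power_increments.

Lemma Rintegral_sum {R : realType} d (T : measurableType d) (P : {measure set T -> \bar R})
    (D : set T) I (s : seq I) (f : I -> T -> R) : measurable D ->
  (forall i, P.-integrable D (EFin \o f i)) ->
  P.-integrable D (EFin \o (fun t => \sum_(i <- s) f i t)) /\
  \int[P]_(t in D) (\sum_(i <- s) f i t) = \sum_(i <- s) \int[P]_(t in D) f i t.
Proof.
move=> mD fi; elim: s => [|i s [IH1 IH2]].
  split.
    rewrite (_ : EFin \o _ = cst 0%E); first exact: integrable0.
    by apply/funext => t /=; rewrite big_nil.
  rewrite big_nil /Rintegral; under eq_integral do rewrite big_nil.
  by rewrite integral0.
have E : (fun t => \sum_(k <- i :: s) f k t) = (fun t => f i t + \sum_(k <- s) f k t).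
  by apply/funext => t; rewrite big_cons.
rewrite E big_cons; split; first exact: (integrableD mD (fi i) IH1).
by rewrite RintegralD// IH2.
Qed.

(** * Independence and cosine averages of sums *)

Section independent_integral.
Import HBNNSimple.
Context {R : realType} d (T : measurableType d) (P : probability T R).
Variables (W U : T -> R).
Hypothesis bW : bounded_mfun W.
Hypothesis mU : measurable_fun setT U.
Hypothesis WU : forall A : set R, measurable A ->
  \int[P]_t (W t * \1_(U @^-1` A) t) = (\int[P]_t W t) * \int[P]_t \1_(U @^-1` A) t.

Let good (g : R -> R) := bounded_mfun g /\
  \int[P]_t (W t * g (U t)) = (\int[P]_t W t) * \int[P]_t g (U t).

Let bU (g : R -> R) : bounded_mfun g -> bounded_mfun (fun t => g (U t)).
Proof. by move=> [mg [M gM]]; split; [exact: measurableT_comp mg mU|exists M]. Qed.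

Let goodD g h : good g -> good h -> good (fun x => g x + h x).
Proof.
move=> [bg eg] [bh eh]; split; first exact: bounded_mfunD.
rewrite (bounded_RintegralD P (bU bg) (bU bh)) mulrDr -eg -eh.
rewrite -bounded_RintegralD; [|exact: bounded_mfunM bW (bU bg)|exact: bounded_mfunM bW (bU bh)].
by apply: eq_Rintegral => t _; rewrite mulrDr.
Qed.

Let goodZ k g : good g -> good (fun x => k * g x).
Proof.
move=> [bg eg]; split; first exact: bounded_mfunZ.
rewrite (bounded_RintegralZ P k (bU bg)) mulrCA -eg.
rewrite -bounded_RintegralZ; last exact: bounded_mfunM bW (bU bg).
by apply: eq_Rintegral => t _; rewrite mulrCA.
Qed.

Let good_indic A : measurable A -> good (\1_A : R -> R).
Proof.
move=> mA; split.
  split; first exact: measurable_indic.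
  by exists 1 => x; rewrite indicE; case: (x \in A); rewrite /= ?normr1 ?normr0.
have E : \1_(U @^-1` A) = (fun t => \1_A (U t)) :> (T -> R).
  by apply/funext => t; rewrite !indicE; congr (_%:R); apply/idP/idP; rewrite !inE.
by have := WU mA; rewrite E.
Qed.

Let good_cst c : good (fun=> c).
Proof.
split; first exact: bounded_mfun_cst.
rewrite Rintegral_probability_cst -[RHS]mulrC -bounded_RintegralZ//.
by apply: eq_Rintegral => t _; rewrite mulrC.
Qed.

Let good_sum n (f : 'I_n -> R -> R) : (forall i, good (f i)) -> good (fun x => \sum_i f i x).
Proof.
elim: n f => [|n IH] f fg.
  rewrite (_ : (fun x => _) = (fun=> 0)); first exact: good_cst.
  by apply/funext => x; rewrite big_ord0.
rewrite (_ : (fun x => _) = (fun x => f ord0 x + \sum_i f (lift ord0 i) x)).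
  by apply: goodD => //; exact: IH.
by apply/funext => x; rewrite big_ord_recl.
Qed.

Let good_cvg (g_ : nat -> R -> R) g M : (forall n, good (g_ n)) ->
  (forall n x, `|g_ n x| <= M) -> (forall x, (fun n => g_ n x) @ \oo --> g x) ->
  bounded_mfun g -> good g.
Proof.
move=> gg gM gc bg; split=> //; have [mW [N WN]] := bW.
have [_ c1] := @bounded_mfun_cvg _ _ _ P (fun n t => g_ n (U t)) (fun t => g (U t)) M
  (fun n => bU (gg n).1) (fun n t => gM n (U t)) (fun t => gc (U t)).
have [_ c2] := @bounded_mfun_cvg _ _ _ P (fun n t => W t * g_ n (U t))
  (fun t => W t * g (U t)) (N * M) (fun n => bounded_mfunM bW (bU (gg n).1))
  ltac:(by move=> n t; rewrite normrM ler_pM) (fun t => cvgM (cvg_cst (W t)) (gc (U t))).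
apply: (cvg_unique _ c2); first exact: Rhausdorff.
have -> : (fun n => \int[P]_t (W t * g_ n (U t))) =
    (fun n => (\int[P]_t W t) * \int[P]_t g_ n (U t)).
  by apply/funext => n; rewrite (gg n).2.
by apply: cvgM => //; exact: cvg_cst.
Qed.

Let good_ge0 (g : R -> R) : bounded_mfun g -> (forall x, 0 <= g x) -> good g.
Proof.
move=> bg g0; have [mg [M gM]] := bg.
have mgE : measurable_fun setT (EFin \o g) by exact/measurable_EFinP.
pose f_ := nnsfun_approx measurableT mgE.
have fc x : (fun n => f_ n x) @ \oo --> g x.
  have : (fun n => (f_ n x)%:E) @ \oo --> (g x)%:E.
    by apply: cvg_nnsfun_approx => // y _; rewrite lee_fin.
  by move/fine_cvg.
apply: (@good_cvg (fun n => f_ n : R -> R) g M) => //.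
- move=> n; have /funext -> := fimfunEord (f_ n).
  apply: good_sum => i; apply: goodZ; apply: good_indic.
  exact: measurable_funPTI.
- move=> n x; rewrite ger0_norm//.
  apply: le_trans (_ : g x <= M); last by rewrite (le_trans (ler_norm _)).
  rewrite -(cvg_lim _ (fc x))//; apply: nondecreasing_cvgn_le.
    by move=> a b ab; exact/lefP/nd_nnsfun_approx.
  by apply/cvg_ex; exists (g x); exact: fc.
Qed.

(** The factorization passes from indicators to simple functions, by bounded convergence to
    nonnegative functions, and by adding a constant to all bounded ones. [W] may have any sign,
    which is needed when it contains a cosine. *)
Lemma independent_integral (g : R -> R) : bounded_mfun g ->
  \int[P]_t (W t * g (U t)) = (\int[P]_t W t) * \int[P]_t g (U t).
Proof.
move=> bg; have [mg [M gM]] := bg.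
suff [] : good g by [].
have -> : g = (fun x => (g x + M) + - M) by apply/funext => x; rewrite addrK.
apply: goodD; last exact: good_cst.
apply: good_ge0; first by apply: bounded_mfunD => //; exact: bounded_mfun_cst.
by move=> x; have := gM x; rewrite ler_norml => /andP[]; lra.
Qed.

End independent_integral.

Section independent_cos.
Context {R : realType} d (T : measurableType d) (P : probability T R).
Context {n : nat}.
Variables (F : 'I_n -> set (set T)) (U : 'I_n -> T -> R) (v : 'I_n -> R).
Hypothesis mF : forall i A, F i A -> measurable A.
Hypothesis FT : forall i, F i setT.
Hypothesis Findep : forall A : 'I_n -> set T, (forall i, F i (A i)) ->
  P (\bigcap_i A i) = (\prod_(i < n) P (A i))%E.
Hypothesis FU : forall i (A : set R), measurable A -> F i (U i @^-1` A).
Hypothesis cosU : forall i c, \int[P]_t cos (U i t + c) = cos c * expR (- v i / 2).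

Let mU i : measurable_fun setT (U i).
Proof. by move=> _ A mA; rewrite setTI; apply: (mF (i := i)); exact: FU. Qed.

Let p (A : set T) : R := \int[P]_t \1_A t.

Let pE A : measurable A -> P A = (p A)%:E.
Proof.
move=> mA; rewrite /p /Rintegral integral_indic// setIT fineK//.
exact: fin_num_measure.
Qed.

(** Hybrid state of the induction: the first k components already appear inside the cosine, while
    the others are still tested by indicators. *)
Let lower k t : R := \sum_(i < n | (i < k)%N) U i t.
Let upper k (A : 'I_n -> set T) t : R := \prod_(i < n | (k <= i)%N) \1_(A i) t.

Let measurable_lower k : measurable_fun setT (lower k).
Proof.
rewrite (_ : lower k = fun t => \sum_(i < n) (if (i < k)%N then U i t else 0)).
  have h (i : 'I_n) : measurable_fun setT (fun t : T => if (i < k)%N then U i t else 0 : R).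
    by case: (i < k)%N => //; exact: mU.
  exact: measurable_sum.
by apply/funext => t; rewrite /lower big_mkcond.
Qed.

Let bounded_upper k A : (forall i, F i (A i)) -> bounded_mfun (upper k A).
Proof.
move=> FA; split.
  rewrite (_ : upper k A = fun t => \prod_(i <- index_enum 'I_n) if (k <= i)%N then \1_(A i) t else 1).
    have h (i : 'I_n) : measurable_fun setT (fun t : T => if (k <= i)%N then \1_(A i) t else (1 : R)).
      case: (k <= i)%N => //; by apply: measurable_indic; exact: mF (FA i).
    by apply: measurable_prod => i _; exact: h.
  by apply/funext => t; rewrite /upper big_mkcond.
exists 1 => t; rewrite /upper normr_prod; apply: prodr_ile1 => i _.
by rewrite normr_ge0/= indicE; case: (_ \in _); rewrite ?normr1 ?normr0.
Qed.

Let bounded_cos_upper k l A c : (forall i, F i (A i)) ->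
  bounded_mfun (fun t => cos (lower k t + c) * upper l A t).
Proof.
move=> FA; apply: bounded_mfunM; last exact: bounded_upper.
by apply: bounded_mfun_cos; apply: measurable_funD.
Qed.

(** Induction on the number of components moved into the cosine. The hypothesis for k, with
    arbitrary events in place k, says that component k factorizes against indicators;
    [independent_integral] extends this to cos and sin of it. *)
Let main k A c : (k <= n)%N -> (forall i, F i (A i)) ->
  \int[P]_t (cos (lower k t + c) * upper k A t) =
  cos c * expR (- (\sum_(i < n | (i < k)%N) v i) / 2) *
  \prod_(i < n | (k <= i)%N) p (A i).
Proof.
elim: k A c => [|k IH] A c kn FA.
  have mI : measurable (\bigcap_i A i).
    by apply: fin_bigcap_measurable => // i _; exact: mF (FA i).
  have -> : \prod_(i < n | (0 <= i)%N) p (A i) = p (\bigcap_i A i).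
    apply: EFin_inj; rewrite -pE// Findep//.
    rewrite (eq_bigr (fun i => (p (A i))%:E)); last by move=> i _; rewrite pE//; exact: mF (FA i).
    by rewrite prodEFin.
  rewrite [\sum_(i < n | _) v i]big_pred0 // oppr0 mul0r expR0 mulr1 /p.
  rewrite -bounded_RintegralZ; last first.
    split; first exact: measurable_indic.
    by exists 1 => t; rewrite indicE; case: (_ \in _); rewrite ?normr1 ?normr0.
  apply: eq_Rintegral => t _; rewrite /lower big_pred0// add0r; congr (_ * _).
  rewrite /upper; have [At|/existsNP[i nAi]] := pselect (forall i, A i t).
    rewrite indicE mem_set; last by move=> i _; exact: At.
    by rewrite big1// => i _; rewrite indicE mem_set//; exact: At.
  rewrite indicE memNset; last by move/(_ i I).
  by rewrite (bigD1 i)//= indicE memNset// mul0r.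
pose i0 := Ordinal kn.
have lowerS t : lower k.+1 t = U i0 t + lower k t.
  rewrite /lower (bigD1 i0)/=; last by rewrite ltnSn.
  congr (_ + _); apply: eq_bigl => i.
  by rewrite ltnS (ltn_neqAle i k) andbC.
have vS : \sum_(i < n | (i < k.+1)%N) v i = v i0 + \sum_(i < n | (i < k)%N) v i.
  rewrite (bigD1 i0)/=; last by rewrite ltnSn.
  congr (_ + _); apply: eq_bigl => i.
  by rewrite ltnS (ltn_neqAle i k) andbC.
have upperE (B : 'I_n -> set T) t : upper k B t = \1_(B i0) t * upper k.+1 B t.
  rewrite /upper (bigD1 i0)/=; last by rewrite leqnn.
  congr (_ * _); apply: eq_bigl => i.
  by rewrite (ltn_neqAle k i) andbC eq_sym.
have pS (B : 'I_n -> set T) : \prod_(i < n | (k <= i)%N) p (B i) =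
    p (B i0) * \prod_(i < n | (k < i)%N) p (B i).
  rewrite (bigD1 i0)/=; last by rewrite leqnn.
  congr (_ * _); apply: eq_bigl => i.
  by rewrite (ltn_neqAle k i) andbC eq_sym.
pose W e t := cos (lower k t + e) * upper k.+1 A t.
have WE e E : F i0 E -> \int[P]_t (W e t * \1_E t) =
   cos e * expR (- (\sum_(i < n | (i < k)%N) v i) / 2) * (p E * \prod_(i < n | (k < i)%N) p (A i)).
  move=> FE; pose A' i := if i == i0 then E else A i.
  have FA' i : F i (A' i) by rewrite /A'; case: eqP => [->|].
  have := IH A' e (ltnW kn) FA'; rewrite pS.
  have -> : \prod_(i < n | (k < i)%N) p (A' i) = \prod_(i < n | (k < i)%N) p (A i).
    apply: eq_bigr => i ki; rewrite /A'; case: eqP => // ii0.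
    by move: ki; rewrite ii0 /= ltnn.
  rewrite {2}/A' eqxx => <-; apply: eq_Rintegral => t _.
  rewrite upperE /A' eqxx /W -mulrA; congr (_ * _); rewrite mulrC; congr (_ * _).
  apply: eq_bigr => i ki; case: eqP => // ii0.
  by move: ki; rewrite ii0 /= ltnn.
have p1 : p setT = 1.
  rewrite /p; under eq_Rintegral do rewrite indicT.
  exact: Rintegral_probability_cst.
have W1 e : \int[P]_t W e t =
    cos e * expR (- (\sum_(i < n | (i < k)%N) v i) / 2) * \prod_(i < n | (k < i)%N) p (A i).
  have := WE e setT (FT i0); rewrite p1 mul1r => <-.
  by apply: eq_Rintegral => t _; rewrite indicT mulr1.
have bW e : bounded_mfun (W e) by exact: bounded_cos_upper.
have WU e g : bounded_mfun g ->
    \int[P]_t (W e t * g (U i0 t)) = \int[P]_t W e t * \int[P]_t g (U i0 t).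
  apply: independent_integral => // B mB.
  by rewrite WE; [rewrite W1 -/(p _); ring|exact: FU].
have bc e : bounded_mfun (fun x : R => cos (x + e)).
  by apply: bounded_mfun_cos; exact: measurable_funD.
(* Addition formula for the cosine, with both sines written as cosines of phase - pi / 2; the sine
   term integrates to zero because cos(- pi / 2) = 0. *)
transitivity (\int[P]_t (W c t * cos (U i0 t + 0) + -1 * (W (c - pi / 2) t * cos (U i0 t + - (pi / 2))))).
  apply: eq_Rintegral => t _; rewrite lowerS /W addr0 addrA !cosBpihalf.
  by rewrite -addrA addrC (cosD (lower k t + c)); ring.
rewrite bounded_RintegralD; last 2 first.
- by apply: bounded_mfunM => //; apply: bounded_mfun_cos; exact: measurable_funD.
- apply: bounded_mfunZ; apply: bounded_mfunM => //; apply: bounded_mfun_cos; exact: measurable_funD.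
rewrite bounded_RintegralZ; last first.
  apply: bounded_mfunM => //; apply: bounded_mfun_cos; exact: measurable_funD.
rewrite (WU c (fun x => cos (x + 0)))// (WU _ (fun x => cos (x + - (pi / 2))))//.
rewrite !cosU W1 cos0 cosN cos_pihalf vS; set q := \sum_(i < n | _) v i.
have -> : - (v i0 + q) / 2 = - v i0 / 2 + - q / 2 by rewrite opprD mulrDl.
rewrite expRD; set e1 := expR (- v i0 / 2); set e2 := expR (- q / 2).
rewrite mul0r mulr0 mulr0 addr0 mul1r; ring.
Qed.

Lemma independent_cos c :
  \int[P]_t cos (\sum_i U i t + c) = cos c * expR (- (\sum_i v i) / 2).
Proof.
have := @main n (fun=> setT) c (leqnn n) FT.
rewrite [\prod_(i < n | _) _]big_pred0; last by move=> i; rewrite leqNgt ltn_ord.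
rewrite mulr1 (eq_bigl xpredT); last by move=> i; rewrite ltn_ord.
move=> <-; apply: eq_Rintegral => t _; rewrite /upper /lower.
rewrite [\prod_(i < n | _) _]big_pred0; last by move=> i; rewrite leqNgt ltn_ord.
by rewrite mulr1; congr (cos (_ + _)); apply: eq_bigl => i; rewrite ltn_ord.
Qed.

End independent_cos.

(** * Increments of fractional Brownian motion as a Gaussian family *)

Section fbm_component.
Context {R : realType} d (T : measurableType d) (P : probability T R).
Variables (H : R) (X : R -> {RV P >-> R}).
Hypotheses (H0 : 0 < H) (hX : fbm1 H X).

Let p := 2 * H.
Let C s t : R := 2^-1 * (t `^ p + s `^ p - `|t - s| `^ p).

Let product_moment s t : 0 <= s -> 0 <= t ->
  (\int[P]_w (X t w * X s w)%:E = (C s t)%:E)%E.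
Proof.
move=> s0 t0; rewrite -(fbm1_covariance hX s0 t0) covariance.unlock !(fbm1_centered hX)//=.
rewrite expectation.unlock; apply: eq_integral => w _.
by rewrite !fctE /= !subr0.
Qed.

Let integrable_sqr t : 0 <= t -> P.-integrable setT (EFin \o (fun w => X t w ^+ 2)).
Proof.
move=> t0; apply/integrableP; split; first by apply/measurable_EFinP; exact: measurable_funX.
under eq_integral do rewrite /= ger0_norm ?sqr_ge0// expr2.
by rewrite product_moment// ltry.
Qed.

Let integrable_product s t : 0 <= s -> 0 <= t ->
  P.-integrable setT (EFin \o (fun w => X s w * X t w)).
Proof.
move=> s0 t0; have := integrableD measurableT (integrable_sqr s0) (integrable_sqr t0).
apply: le_integrable => //.
  by apply/measurable_EFinP; exact: measurable_funM.
move=> w _ /=; rewrite lee_fin (le_trans _ (ler_norm _))// normrM.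
have := sqr_ge0 (`|X s w| - `|X t w|); rewrite sqrrB !real_normK ?num_real//.
have : 0 <= `|X s w| * `|X t w| by rewrite mulr_ge0.
rewrite -mulr_natl; lra.
Qed.

Let integrable_X t : 0 <= t -> P.-integrable setT (EFin \o X t).
Proof.
move=> t0.
have i1 : P.-integrable setT (EFin \o (fun=> 1 : R)) by exact: finite_measure_integrable_cst.
have := integrableD measurableT i1 (integrable_sqr t0).
apply: le_integrable => //; first exact/measurable_EFinP.
move=> w _ /=; rewrite lee_fin (le_trans _ (ler_norm _))//.
by have := sqr_ge0 (`|X t w| - 1); rewrite sqrrB real_normK ?num_real// mulr1 expr1n -mulr_natl; have := normr_ge0 (X t w); lra.
Qed.

Let mean_X t : 0 <= t -> \int[P]_w X t w = 0.
Proof. by move=> t0; rewrite /Rintegral -expectation_def (fbm1_centered hX). Qed.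

Let Rproduct s t : 0 <= s -> 0 <= t -> \int[P]_w (X t w * X s w) = C s t.
Proof. by move=> s0 t0; rewrite /Rintegral product_moment. Qed.

(** The variance at time 0 vanishes, which gives B_0 = 0 almost surely but not for every outcome. *)
Lemma fbm1_null : {ae P, forall w, X 0 w = 0}.
Proof.
have mX2 : measurable_fun setT (fun w => (X 0 w ^+ 2)%:E).
  by apply/measurable_EFinP; exact: measurable_funX.
have C0 : C 0 0 = 0.
  by rewrite /C subrr normr0 powR0 ?subr0 ?addr0 ?mulr0// mulf_neq0// gt_eqF.
have : (\int[P]_w `|(X 0 w ^+ 2)%:E| = 0)%E.
  under eq_integral do rewrite abse_EFin ger0_norm ?sqr_ge0// expr2.
  by rewrite product_moment// C0.
move/(ae_eq_integral_abs P measurableT mX2); apply: filterS => w /(_ Logic.I) /= [].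
by move/eqP; rewrite sqrf_eq0 => /eqP.
Qed.

Variables (I : finType) (s t phi : I -> R).
Hypotheses (s0 : forall e, 0 <= s e) (t0 : forall e, 0 <= t e).

Let D e w := X (t e) w - X (s e) w.
Let U w := \sum_e phi e * D e w.

(** A combination of increments is a combination of values at the times indexed by I + I, with
    opposite coefficients at the two ends. *)
Let gaussian_U : gaussian P U.
Proof.
pose tau (x : I + I) := match x with inl e => t e | inr e => s e end.
pose c (x : I + I) := match x with inl e => phi e | inr e => - phi e end.
have tau0 x : 0 <= tau x by case: x.
have := @fbm1_gaussian _ _ _ _ _ _ hX #|{: I + I}| (fun k => tau (enum_val k))
  (fun k => c (enum_val k)) (fun k => tau0 (enum_val k)).
rewrite (_ : (fun w => _) = U)//; apply/funext => w.
rewrite -(big_enum_val (A := {: I + I}) (fun x => c x * X (tau x) w)) big_sumType/= -big_split/=.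
by apply: eq_bigr => e _; rewrite /D mulNr -mulrBr.
Qed.

Let integrable_D e : P.-integrable setT (EFin \o D e).
Proof. exact: (integrableB measurableT (integrable_X (t0 e)) (integrable_X (s0 e))). Qed.

Let D_product e e' : P.-integrable setT (EFin \o (fun w => D e w * D e' w)) /\
  \int[P]_w (D e w * D e' w) = increment_cov p (s e) (t e) (s e') (t e').
Proof.
have i1 := integrable_product (t0 e) (t0 e').
have i2 := integrable_product (t0 e) (s0 e').
have i3 := integrable_product (s0 e) (t0 e').
have i4 := integrable_product (s0 e) (s0 e').
have j1 := integrableB measurableT i1 i2.
have j2 := integrableB measurableT i3 i4.
have E : (fun w => D e w * D e' w) = (fun w => (X (t e) w * X (t e') w - X (t e) w * X (s e') w) -
   (X (s e) w * X (t e') w - X (s e) w * X (s e') w)).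
  by apply/funext => w; rewrite /D; ring.
rewrite E; split; first exact: (integrableB measurableT j1 j2).
rewrite (@RintegralB _ _ _ P setT (fun w => X (t e) w * X (t e') w - X (t e) w * X (s e') w)
  (fun w => X (s e) w * X (t e') w - X (s e) w * X (s e') w))//.
rewrite !RintegralB// !Rproduct// /C /increment_cov; ring.
Qed.

Let form := \sum_e \sum_e' phi e * phi e' *
  increment_cov (2 * H) (s e) (t e) (s e') (t e').

Let integrable_U2 : P.-integrable setT (EFin \o (fun w => U w ^+ 2)) /\
  \int[P]_w U w ^+ 2 = form.
Proof.
have iDD e e' : P.-integrable setT (EFin \o (fun w => phi e * phi e' * (D e w * D e' w))).
  exact: (integrableZl measurableT (phi e * phi e') (D_product e e').1).
have sumDD e := Rintegral_sum (index_enum I) measurableT (iDD e).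
have [iU2 EU2] := Rintegral_sum (index_enum I) measurableT (fun e => (sumDD e).1).
have UE : (fun w => U w ^+ 2) = (fun w => \sum_e \sum_e' phi e * phi e' * (D e w * D e' w)).
  apply/funext => w; rewrite /U expr2 mulr_suml; apply: eq_bigr => e _.
  by rewrite mulr_sumr; apply: eq_bigr => e' _; ring.
rewrite UE; split=> //; rewrite EU2; apply: eq_bigr => e _; rewrite (sumDD e).2.
by apply: eq_bigr => e' _; rewrite RintegralZl ?(D_product e e').2//; exact: (D_product e e').1.
Qed.

Lemma fbm_increments_form_ge0 : 0 <= \sum_e \sum_e' phi e * phi e' *
  increment_cov (2 * H) (s e) (t e) (s e') (t e').
Proof.
rewrite -/form -integrable_U2.2; apply: Rintegral_ge0 => // w _; exact: sqr_ge0.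
Qed.

Lemma fbm_increments_cos c : \int[P]_w cos (\sum_e phi e * (X (t e) w - X (s e) w) + c) =
  cos c * expR (- (\sum_e \sum_e' phi e * phi e' *
                    increment_cov (2 * H) (s e) (t e) (s e') (t e')) / 2).
Proof.
have iD e : P.-integrable setT (EFin \o (fun w => phi e * D e w)).
  exact: (integrableZl measurableT (phi e) (integrable_D e)).
have [iU EU] := Rintegral_sum (index_enum I) measurableT iD.
have EU0 : \int[P]_w U w = 0.
  rewrite EU big1// => e _; rewrite RintegralZl//.
  by rewrite RintegralB ?mean_X ?subr0 ?mulr0//; exact: integrable_X.
have [iU2 EU2] := integrable_U2.
apply: (gaussian_cos (U := U)) => //.
apply: measurable_sum => e; apply: measurable_funM => //; exact: measurable_funB.
Qed.

End fbm_component.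

Lemma sum_pair {R : nmodType} (I K : finType) (F : I * K -> R) :
  \sum_j F j = \sum_i \sum_k F (i, k).
Proof. by rewrite pair_bigA; apply: eq_bigr => -[]. Qed.

Section fbm_family.
Context {R : realType} disp (T : measurableType disp) (P : probability T R).
Context {d : nat}.
Variables (H : R) (B : 'I_d -> R -> {RV P >-> R}).
Hypotheses (H0 : 0 < H) (hB : fbm H B).
Variables (I : finType) (s t : I -> R).
Hypotheses (s0 : forall e, 0 <= s e) (t0 : forall e, 0 <= t e).

Definition increments (j : 'I_d * I) (w : T) : R := B j.1 (t j.2) w - B j.1 (s j.2) w.

Definition increments_cov (j j' : 'I_d * I) : R :=
  if j.1 == j'.1 then increment_cov (2 * H) (s j.2) (t j.2) (s j'.2) (t j'.2) else 0.

Lemma measurable_increments j : measurable_fun setT (increments j).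
Proof. exact: measurable_funB. Qed.

Lemma increments_formE a : quadratic_form increments_cov a =
  \sum_i \sum_e \sum_e' a (i, e) * a (i, e') *
    increment_cov (2 * H) (s e) (t e) (s e') (t e').
Proof.
rewrite /quadratic_form sum_pair.
apply: eq_bigr => i _; apply: eq_bigr => e _; rewrite sum_pair.
rewrite (bigD1 i)//= [X in _ + X]big1 ?addr0; first by apply: eq_bigr => e' _; rewrite /increments_cov/= eqxx.
move=> i' /negbTE ii'; rewrite big1// => e' _.
by rewrite /increments_cov/= eq_sym ii' mulr0.
Qed.

Lemma increments_form_ge0 a : 0 <= quadratic_form increments_cov a.
Proof.
rewrite increments_formE sumr_ge0// => i _.
exact: (fbm_increments_form_ge0 (fbm_component hB i)).
Qed.

Let sub_process i (u : R) (A : set R) : 0 <= u -> measurable A ->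
  process_sigma_algebra (B i) (B i u @^-1` A).
Proof.
move=> u0 mA; apply: sub_gen_smallest; exists u; first by rewrite /= in_itv/= u0.
by exists A => //; rewrite setTI.
Qed.

Lemma increments_cos a c : \int[P]_w cos (\sum_j a j * increments j w + c) =
  cos c * expR (- quadratic_form increments_cov a / 2).
Proof.
pose U i w := \sum_e a (i, e) * (B i (t e) w - B i (s e) w).
rewrite increments_formE.
transitivity (\int[P]_w cos (\sum_i U i w + c)).
  apply: eq_Rintegral => w _; congr (cos (_ + _)); exact: sum_pair.
apply: (@independent_cos _ _ _ _ _ (fun i => process_sigma_algebra (B i))).
- move=> i A; apply: smallest_sub; first exact: sigma_algebra_measurable.
  move=> _ [u _ [A' mA' <-]]; rewrite setTI; rewrite -[X in measurable X]setTI.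
  exact: measurable_funP.
- move=> i; rewrite /process_sigma_algebra; set G := bigcup _ _; exact: (@measurableT _ (g_sigma_algebraType G)).
- exact: fbm_independent hB.
- move=> i A mA.
  pose G := \bigcup_(u in `[0, +oo[) preimage_set_system setT (B i u) measurable.
  have mB u : 0 <= u -> measurable_fun setT (B i u : g_sigma_algebraType G -> R).
    by move=> u0 _ A' mA'; rewrite setTI; exact: sub_process.
  have mU : measurable_fun setT (U i : g_sigma_algebraType G -> R).
    apply: measurable_sum => e; apply: measurable_funM => //.
    by apply: measurable_funB; apply: mB.
  by have := mU measurableT A mA; rewrite setTI.
- by move=> i c'; exact: (fbm_increments_cos (fbm_component hB i)).
Qed.

End fbm_family.

Section null_extension.
Context {R : realType} d (T : measurableType d) (P : probability T R).
Variables (J N : finType) (X : J -> T -> R) (Z : N -> T -> R) (S : J -> J -> R).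
Hypotheses (mX : forall j, measurable_fun setT (X j))
  (mZ : forall i, measurable_fun setT (Z i)).
Hypothesis cos_family : forall a c,
  \int[P]_w cos (\sum_j a j * X j w + c) = cos c * expR (- quadratic_form S a / 2).
Hypothesis Z0 : forall i, {ae P, forall w, Z i w = 0}.

(** The pathwise estimates hold for all outcomes and so contain the value of [B] at time 0.
    Adjoining such almost surely null coordinates, with zero covariance, keeps the Gaussian
    formula. *)
Definition null_ext (e : J + N) : T -> R :=
  match e with inl j => X j | inr i => Z i end.

Definition null_ext_cov (e e' : J + N) : R :=
  match e, e' with inl j, inl j' => S j j' | _, _ => 0 end.

Lemma measurable_null_ext e : measurable_fun setT (null_ext e).
Proof. by case: e. Qed.

Lemma null_ext_formE a :
  quadratic_form null_ext_cov a = quadratic_form S (fun j => a (inl j)).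
Proof.
rewrite /quadratic_form big_sumType/= [X in _ + X]big1 ?addr0; last first.
  by move=> i _; rewrite big1// => -[] ? _; rewrite mulr0.
apply: eq_bigr => j _; rewrite big_sumType/= [X in _ + X]big1 ?addr0//.
by move=> i _; rewrite mulr0.
Qed.

Lemma null_ext_cos a c : \int[P]_w cos (\sum_e a e * null_ext e w + c) =
  cos c * expR (- quadratic_form null_ext_cov a / 2).
Proof.
rewrite null_ext_formE -cos_family /Rintegral; congr fine.
apply: ae_eq_integral => //.
- by apply/measurable_EFinP; apply: (bounded_mfun_cos _).1; apply: measurable_funD => //;
    apply: measurable_sum => e; apply: measurable_funM => //; exact: measurable_null_ext.
- by apply/measurable_EFinP; apply: (bounded_mfun_cos _).1; apply: measurable_funD => //;
    apply: measurable_sum => e; apply: measurable_funM.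
have : \forall w \ae P, forall i, Z i w = 0 by exact: filter_forall.
apply: filterS => w Zw _; rewrite big_sumType/= [X in _ + X + _]big1 ?addr0// => i _.
by rewrite Zw mulr0.
Qed.

End null_extension.

(** * The Euclidean norm *)

Section euclidean_norm.
Context {R : realType} {d : nat}.
Implicit Types x y z : 'cV[R]_d.

Lemma scalprod_ge0 x : 0 <= scalprod x x.
Proof. by rewrite sumr_ge0// => i _; rewrite -expr2 sqr_ge0. Qed.

Lemma enorm_ge0 x : 0 <= enorm x. Proof. exact: sqrtr_ge0. Qed.

Lemma sqr_enorm x : enorm x ^+ 2 = scalprod x x.
Proof. by rewrite sqr_sqrtr// scalprod_ge0. Qed.

Lemma scalprodC x y : scalprod x y = scalprod y x.
Proof. by apply: eq_bigr => i _; rewrite mulrC. Qed.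

Lemma scalprodDl x y z : scalprod (x + y) z = scalprod x z + scalprod y z.
Proof. by rewrite -big_split; apply: eq_bigr => i _; rewrite mxE mulrDl. Qed.

(** Expand the square of a x - b y with a = |y| and b = |x|, and divide by |x| |y|. *)
Lemma scalprod_le x y : scalprod x y <= enorm x * enorm y.
Proof.
have H0 a b : 0 <= a ^+ 2 * enorm x ^+ 2 + b ^+ 2 * enorm y ^+ 2 - 2 * a * b * scalprod x y.
  have -> : a ^+ 2 * enorm x ^+ 2 + b ^+ 2 * enorm y ^+ 2 - 2 * a * b * scalprod x y =
      \sum_i (a * x i 0 - b * y i 0) ^+ 2.
    rewrite !sqr_enorm /scalprod !mulr_sumr -sumrN -!big_split.
    by apply: eq_bigr => i _ /=; ring.
  by rewrite sumr_ge0// => i _; rewrite sqr_ge0.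
have [x0|x0] := eqVneq (enorm x) 0.
  have e (i : 'I_d) : x i 0 = 0.
    have /eqP : scalprod x x = 0 by rewrite -sqr_enorm x0 expr0n.
    rewrite psumr_eq0; last by move=> j _; rewrite -expr2 sqr_ge0.
    by move=> /allP/(_ i (mem_index_enum _)) /=; rewrite mulf_eq0 orbb => /eqP.
  by rewrite x0 mul0r /scalprod big1// => i _; rewrite e mul0r.
have [y0|y0] := eqVneq (enorm y) 0.
  have e (i : 'I_d) : y i 0 = 0.
    have /eqP : scalprod y y = 0 by rewrite -sqr_enorm y0 expr0n.
    rewrite psumr_eq0; last by move=> j _; rewrite -expr2 sqr_ge0.
    by move=> /allP/(_ i (mem_index_enum _)) /=; rewrite mulf_eq0 orbb => /eqP.
  by rewrite y0 mulr0 /scalprod big1// => i _; rewrite e mulr0.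
have xy : 0 < enorm x * enorm y by rewrite mulr_gt0// lt_def ?x0 ?y0 enorm_ge0.
rewrite -subr_ge0 -(pmulr_rge0 _ xy); have := H0 (enorm y) (enorm x).
set e := enorm x; set f := enorm y; set s := scalprod x y; nra.
Qed.

Lemma enormD x y : enorm (x + y) <= enorm x + enorm y.
Proof.
rewrite -(@ler_pXn2r _ 2)// ?nnegrE ?addr_ge0 ?enorm_ge0//.
rewrite sqr_enorm scalprodDl 2!(scalprodC _ (x + y)) !scalprodDl -!sqr_enorm (scalprodC y x).
by rewrite sqrrD -mulr_natr; have := scalprod_le x y; lra.
Qed.

Lemma enormN x : enorm (- x) = enorm x.
Proof. by congr Num.sqrt; apply: eq_bigr => i _; rewrite !mxE mulrNN. Qed.

Lemma enorm0 : enorm (0 : 'cV[R]_d) = 0.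
Proof. by rewrite /enorm /scalprod big1 ?sqrtr0// => i _; rewrite mxE mul0r. Qed.

Lemma normr_le_enorm x i : `|x i 0| <= enorm x.
Proof.
rewrite -(@ler_pXn2r _ 2)// ?nnegrE ?enorm_ge0// sqr_enorm real_normK ?num_real//.
rewrite /scalprod (bigD1 i)//= -expr2 lerDl sumr_ge0// => j _.
by rewrite -expr2 sqr_ge0.
Qed.

Lemma enorm_le_sum x : enorm x <= \sum_i `|x i 0|.
Proof.
rewrite -(@ler_pXn2r _ 2)// ?nnegrE ?enorm_ge0 ?sumr_ge0// sqr_enorm expr2 mulr_suml.
apply: ler_sum => i _; rewrite -expr2 -[leLHS]real_normK ?num_real// expr2 ler_wpM2l//.
by rewrite (bigD1 i)//= lerDl sumr_ge0.
Qed.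

Lemma enorm_mulmx_le (sigma : 'M[R]_d) x :
  enorm (sigma *m x) <= (\sum_i \sum_j `|sigma i j|) * \sum_i `|x i 0|.
Proof.
apply: le_trans (enorm_le_sum _) _; rewrite mulr_suml ler_sum// => i _.
rewrite mxE; apply: le_trans (ler_norm_sum _ _ _) _.
rewrite mulr_suml ler_sum// => j _; rewrite normrM ler_wpM2l//.
by rewrite (bigD1 j)//= lerDl sumr_ge0.
Qed.

Lemma continuous_scalprod (f g : R -> 'cV[R]_d) :
  (forall i, continuous (fun t => f t i 0)) -> (forall i, continuous (fun t => g t i 0)) ->
  continuous (fun t => scalprod (f t) (g t)).
Proof.
move=> cf cg t; apply: cvg_sumr => i.
by apply: cvgM; [exact: cf|exact: cg].
Qed.

Lemma continuous_enorm (f : R -> 'cV[R]_d) :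
  (forall i, continuous (fun t => f t i 0)) -> continuous (fun t => enorm (f t)).
Proof.
move=> cf t; apply: (@continuous_comp _ _ _ (fun t => scalprod (f t) (f t)) Num.sqrt).
  exact: continuous_scalprod.
exact: sqrt_continuous.
Qed.

End euclidean_norm.

(** * Integrals of continuous functions and a dissipative integral inequality *)

Section calculus.
Context {R : realType}.
Implicit Types (f g : R -> R) (a c e t : R).

Lemma continuous_integrable f a e : continuous f ->
  lebesgue_measure.-integrable `[a, e] (EFin \o f).
Proof.
move=> cf; apply: continuous_compact_integrable; first exact: segment_compact.
exact: continuous_subspaceT.
Qed.

Lemma Rintegral_split f a c e : continuous f -> a <= c -> c <= e ->
  \int[lebesgue_measure]_(t in `[a, e]) f t =
  \int[lebesgue_measure]_(t in `[a, c]) f t + \int[lebesgue_measure]_(t in `[c, e]) f t.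
Proof.
move=> cf ac ce; rewrite -(@Rintegral_itv_obnd_cbnd _ c (BRight e)); last first.
  apply: integrableS (continuous_integrable c e cf) => //.
  by apply: subset_itvr; rewrite bnd_simp.
rewrite -(@Rintegral_itvB _ f (BLeft a) (BRight e) c)//.
- by rewrite addrC subrK.
- exact: continuous_integrable.
Qed.

Lemma Rintegral_le f g a e : continuous f -> continuous g ->
  (forall t, a <= t <= e -> f t <= g t) ->
  \int[lebesgue_measure]_(t in `[a, e]) f t <= \int[lebesgue_measure]_(t in `[a, e]) g t.
Proof.
move=> cf cg fg; apply: le_Rintegral; [by []|exact: continuous_integrable..|].
by move=> t; rewrite /= in_itv/=; exact: fg.
Qed.

Lemma Rintegral_segment_cst c a e : a <= e ->
  \int[lebesgue_measure]_(t in `[a, e]) c = c * (e - a).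
Proof.
move=> ae; rewrite Rintegral_cst// /= lebesgue_measure_itv/= lte_fin.
by case: ltgtP ae => //= -> _; rewrite subrr.
Qed.

(** Integrating from a - 1 makes the derivative at [a] two-sided. *)
Lemma primitive f a : continuous f ->
  exists F, (forall t, a <= t -> is_derive t (1 : R) F (f t)) /\
    (forall t, a <= t -> F t = \int[lebesgue_measure]_(u in `[a, t]) f u).
Proof.
move=> cf; pose F t := \int[lebesgue_measure]_(u in `[a - 1, t]) f u.
exists (fun t => F t - F a); split=> t at_; last first.
  by rewrite /F (@Rintegral_split _ (a - 1) a t)//; [ring|lra].
have t1 : t < t + 1 by rewrite ltrDl.
have [|dF FE] := continuous_FTC1_closed t1 (continuous_integrable (a - 1) (t + 1) cf) _ (cf t).
  by rewrite ltrBlDr (le_lt_trans at_)// ltrDl.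
rewrite -[f t]subr0; apply: is_deriveB.
by apply: DeriveDef => //; rewrite -FE derive1E.
Qed.

End calculus.

Section contraction.
Context {R : realType} {d : nat}.
Variables (u beta : R -> 'cV[R]_d) (w : R -> R) (alpha a e : R).
Hypotheses (ae : a <= e) (alpha0 : 0 <= alpha).
Hypotheses (cu : forall i, continuous (fun t => u t i 0))
  (cbeta : forall i, continuous (fun t => beta t i 0)) (cw : continuous w).
Hypothesis w0 : forall t, 0 <= w t.
Hypothesis uE : forall t i, a <= t <= e ->
  u t i 0 = u a i 0 + \int[lebesgue_measure]_(s in `[a, t]) beta s i 0.
Hypothesis dissipative : forall t, a <= t <= e ->
  scalprod (beta t) (u t) <= w t * enorm (u t) - alpha * enorm (u t) ^+ 2.

Let cnu : continuous (fun t => enorm (u t)).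
Proof. exact: continuous_enorm. Qed.

(** The norm is not differentiable at 0, so sqrt(eps^2 + |u|^2) replaces it. Dissipativity makes its
    sum with the primitive of the integrand nonincreasing. *)
Let smoothed (eps : R) : 0 < eps ->
  enorm (u e) + \int[lebesgue_measure]_(t in `[a, e]) (alpha * (enorm (u t) - eps) - w t)
    <= enorm (u a) + eps.
Proof.
move=> eps0.
(* The integral equation for [u] holds only on [a, e]; [V] continues it past e as a function
   differentiable at every t >= a. *)
have [V VP] : exists V : 'I_d -> R -> R, forall i,
    (forall t, a <= t -> is_derive t (1 : R) (V i) (beta t i 0)) /\
    (forall t, a <= t <= e -> V i t = u t i 0).
  have H i : exists F : R -> R, (forall t, a <= t -> is_derive t (1 : R) F (beta t i 0)) /\
      (forall t, a <= t <= e -> F t = u t i 0).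
    have [F [dF FE]] := primitive a (@cbeta i).
    exists (fun t => u a i 0 + F t); split=> t ta; last first.
      by rewrite [RHS]uE// FE//; case/andP: ta.
    by rewrite -[beta t i 0]add0r; apply: is_deriveD; exact: dF.
  by exists (fun i => sval (cid (H i))) => i; exact: (svalP (cid (H i))).
have ck : continuous (fun t => alpha * (enorm (u t) - eps) - w t).
  move=> t; apply: cvgB; last exact: cw.
  by apply: cvgMr; apply: cvgB; [exact: cnu|exact: cvg_cst].
have [K [dK KE]] := primitive a ck.
pose q t := eps ^+ 2 + \sum_i V i t ^+ 2.
have q0 t : 0 < q t.
  by rewrite ltr_pwDl ?exprn_gt0// sumr_ge0// => i _; rewrite sqr_ge0.
have qE t : a <= t <= e -> q t = eps ^+ 2 + enorm (u t) ^+ 2.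
  move=> ta; rewrite sqr_enorm; congr (_ + _); apply: eq_bigr => i _.
  by rewrite (VP i).2// expr2.
have dq t : a <= t -> is_derive t (1 : R) q (\sum_i 2 * V i t * beta t i 0).
  move=> ta; rewrite -[X in is_derive _ _ _ X]add0r; apply: is_deriveD.
  have -> : (fun t => \sum_i V i t ^+ 2) = \sum_(i < d) (V i ^+ 2).
    by apply/funext => s; rewrite fct_sumE; apply: eq_bigr.
  apply: is_derive_sum => i.
  have := is_deriveX 2 ((VP i).1 t ta).
  by rewrite /= expr1 -mulr_natl.
pose Phi t := Num.sqrt (q t) + K t.
have dPhi t : a <= t -> is_derive t (1 : R) Phi
    ((2 * Num.sqrt (q t))^-1 * (\sum_i 2 * V i t * beta t i 0) +
     (alpha * (enorm (u t) - eps) - w t)).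
  move=> ta; apply: is_deriveD; last exact: dK.
  apply: (@is_derive1_comp _ Num.sqrt q); last exact: dq.
  exact: is_derive1_sqrt.
have : Phi e <= Phi a.
  apply: (@ler0_derive1_nincr _ Phi a e) => //.
  - by move=> t; rewrite in_itv/= => /andP[/ltW ta _]; have [] := dPhi t ta.
  - move=> t; rewrite in_itv/= => /andP[/ltW at_ /ltW te].
    have ta : a <= t <= e by rewrite at_.
    have [_ dE] := dPhi t at_; rewrite derive1E dE {dE}.
    have -> : \sum_i 2 * V i t * beta t i 0 = 2 * scalprod (beta t) (u t).
      rewrite mulr_sumr; apply: eq_bigr => i _; rewrite (VP i).2//; ring.
    set r := Num.sqrt (q t).
    have r0 : 0 < r by rewrite sqrtr_gt0.
    have r2 : r ^+ 2 = eps ^+ 2 + enorm (u t) ^+ 2 by rewrite sqr_sqrtr ?qE// -qE// ltW.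
    rewrite invfM mulrACA mulVf ?pnatr_eq0// mul1r addrA -(pmulr_rle0 _ r0).
    have := dissipative ta; have := enorm_ge0 (u t); have := w0 t.
    set n := enorm (u t) in r2 *; set s := scalprod _ _; set W := w t => W0 n0 ds.
    have -> : r * (r^-1 * s + alpha * (n - eps) - W) = s + r * (alpha * (n - eps)) - r * W.
      by field; rewrite gt_eqF.
    have nr : n <= r by nra.
    have rn : r <= n + eps by nra.
    have h : r * (n - eps) <= n ^+ 2 by nra.
    have := ler_wpM2l alpha0 h; have := ler_wpM2r W0 nr; nra.
  - apply: continuous_in_subspaceT => t; rewrite inE/= in_itv/= => /andP[ta _].
    apply: differentiable_continuous; apply/derivable1_diffP.
    by have [] := dPhi t ta.
rewrite /Phi !KE// set_itv1 Rintegral_set1 addr0 !qE ?ae ?lexx// => h.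
apply: le_trans (le_trans h _).
  rewrite lerD2r -[leLHS]ger0_norm ?enorm_ge0// -sqrtr_sqr ler_sqrt ?addr_ge0 ?sqr_ge0//.
  by rewrite lerDr sqr_ge0.
rewrite -[leRHS]ger0_norm ?addr_ge0 ?enorm_ge0 ?(ltW eps0)// -sqrtr_sqr ler_sqrt ?sqr_ge0//.
have := enorm_ge0 (u a); nra.
Qed.

Lemma enorm_contraction :
  enorm (u e) + alpha * \int[lebesgue_measure]_(t in `[a, e]) enorm (u t) <=
  enorm (u a) + \int[lebesgue_measure]_(t in `[a, e]) w t.
Proof.
apply/ler_addgt0Pr => eps eps0.
(* Smoothing at level eps / c costs (eps / c)(1 + alpha (e - a)) = eps in total. *)
pose c := 1 + alpha * (e - a).
have c0 : 0 < c by rewrite ltr_wpDr// mulr_ge0// subr_ge0.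
have := smoothed (divr_gt0 eps0 c0).
have i1 := continuous_integrable a e cnu.
have iw := continuous_integrable a e cw.
have ic := continuous_integrable a e (@cst_continuous R R (eps / c)).
have mI : measurable (`[a, e]%classic : set (measurableTypeR R)) by [].
have iB := integrableB mI i1 ic.
rewrite (RintegralB mI (integrableZl mI alpha iB) iw).
rewrite (RintegralZl alpha mI iB) (RintegralB mI i1 ic) Rintegral_segment_cst//.
set I1 := \int[_]_(_ in _) enorm _; set Iw := \int[_]_(_ in _) w _.
have : eps = eps / c * c by rewrite divfK// gt_eqF.
rewrite {2}/c; lra.
Qed.

End contraction.

Lemma Rintegral_blocks {R : realType} (f : R -> R) (a D : R) n : continuous f -> 0 <= D ->
  \int[lebesgue_measure]_(t in `[a, a + n%:R * D]) f t =
  \sum_(k < n) \int[lebesgue_measure]_(t in `[a + k%:R * D, a + k.+1%:R * D]) f t.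
Proof.
move=> cf D0; elim: n => [|n IH].
  by rewrite big_ord0 mul0r addr0 set_itv1 Rintegral_set1.
rewrite big_ord_recr/= -IH; apply: Rintegral_split => //.
  by rewrite lerDl mulr_ge0.
by rewrite lerD2l ler_wpM2r// ler_nat.
Qed.

(** * Pathwise comparison of two solutions *)

Section two_solutions.
Context {R : realType} {d : nat}.
Variables (b : 'cV[R]_d -> 'cV[R]_d) (alpha L : R).
Hypotheses (cb : continuous b) (alpha0 : 0 < alpha) (L0 : 0 < L).
Hypothesis b_drift : forall y z : 'cV[R]_d,
  scalprod (b y - b z) (y - z) <= - alpha * enorm (y - z) ^+ 2 /\
  enorm (b y - b z) <= L * enorm (y - z).
Variables (y1 y2 g1 g2 : R -> 'cV[R]_d) (x : 'cV[R]_d).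
Hypotheses (cy1 : continuous y1) (cy2 : continuous y2)
  (cg1 : continuous g1) (cg2 : continuous g2).
Hypothesis y1E : forall t, 0 <= t ->
  y1 t = x + \col_i (\int[lebesgue_measure]_(s in `[0, t]) (b (y1 s)) i 0) + g1 t.
Hypothesis y2E : forall t, 0 <= t ->
  y2 t = x + \col_i (\int[lebesgue_measure]_(s in `[0, t]) (b (y2 s)) i 0) + g2 t.

Let z t := y1 t - y2 t.
Let h t := g1 t - g2 t.

Let continuous_coord (f : R -> 'cV[R]_d) i : continuous f -> continuous (fun t => f t i 0).
Proof.
move=> cf t; apply: (@continuous_comp _ _ _ f (fun M : 'cV[R]_d => M i 0)).
  exact: cf.
exact: coord_continuous.
Qed.

Let continuous_by (y : R -> 'cV[R]_d) i : continuous y -> continuous (fun t => b (y t) i 0).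
Proof.
move=> cy; apply: (@continuous_coord (b \o y)) => t.
by apply: continuous_comp; [exact: cy|exact: cb].
Qed.

Let cz : continuous z.
Proof. by move=> t; apply: cvgB; [exact: cy1|exact: cy2]. Qed.

Let ch : continuous h.
Proof. by move=> t; apply: cvgB; [exact: cg1|exact: cg2]. Qed.

Section block.
Variables s e : R.
Hypotheses (s0 : 0 <= s) (se : s <= e).

(** Removing the noise increment since s from the difference of the solutions leaves [u], whose
    derivative is the drift difference [beta]. *)
Let v t := h t - h s.
Let u t := z t - v t.
Let beta t := b (y1 t) - b (y2 t).

Let cv : continuous v.
Proof. by move=> t; apply: cvgB; [exact: ch|exact: cvg_cst]. Qed.

Let cu : continuous u.
Proof. by move=> t; apply: cvgB; [exact: cz|exact: cv]. Qed.

Let betaE i : (fun t => beta t i 0) = (fun t => b (y1 t) i 0 - b (y2 t) i 0).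
Proof. by apply/funext => t; rewrite /beta !mxE. Qed.

Let cbeta i : continuous (fun t => beta t i 0).
Proof.
rewrite betaE => t.
by apply: cvgB; [exact: (continuous_by cy1)|exact: (continuous_by cy2)].
Qed.

Let cnv : continuous (fun t => L * enorm (v t)).
Proof.
move=> t; apply: cvgMr; apply: (@continuous_enorm _ _ v) => i.
exact: continuous_coord.
Qed.

Let cnu : continuous (fun t => enorm (u t)).
Proof. by apply: continuous_enorm => i; exact: continuous_coord. Qed.

Let uE a t i : s <= a -> a <= t ->
  u t i 0 = u a i 0 + \int[lebesgue_measure]_(r in `[a, t]) beta r i 0.
Proof.
move=> sa at_; have a0 := le_trans s0 sa; have t0 := le_trans a0 at_.
have E r : 0 <= r -> u r i 0 = h s i 0 +
    (\int[lebesgue_measure]_(q in `[0, r]) (b (y1 q)) i 0 -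
     \int[lebesgue_measure]_(q in `[0, r]) (b (y2 q)) i 0).
  by move=> r0; rewrite /u /v /z /h y1E// y2E// !mxE; ring.
rewrite !E// (Rintegral_split (continuous_by cy1) a0 at_).
rewrite (Rintegral_split (continuous_by cy2) a0 at_).
rewrite betaE.
rewrite RintegralB//; [ring|exact: continuous_integrable (continuous_by cy1)|].
exact: continuous_integrable (continuous_by cy2).
Qed.

(** Insert b(y1 - v) into the drift difference: since y1 - v - y2 = u, monotonicity controls one
    part, and the other costs L |v| by the Lipschitz bound. *)
Let dissipative t :
  scalprod (beta t) (u t) <= L * enorm (v t) * enorm (u t) - alpha * enorm (u t) ^+ 2.
Proof.
have -> : beta t = (b (y1 t) - b (y1 t - v t)) + (b (y1 t - v t) - b (y2 t)).
  by rewrite /beta [RHS]addrA subrK.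
rewrite scalprodDl; apply: lerD.
  apply: le_trans (scalprod_le _ _) _; rewrite ler_wpM2r ?enorm_ge0//.
  have [_] := b_drift (y1 t) (y1 t - v t); by rewrite subKr.
have -> : u t = (y1 t - v t) - y2 t by rewrite /u /z addrAC.
by rewrite -mulNr; have [] := b_drift (y1 t - v t) (y2 t).
Qed.

Let contraction a : s <= a -> a <= e ->
  enorm (u e) + alpha * \int[lebesgue_measure]_(t in `[a, e]) enorm (u t) <=
  enorm (u a) + L * \int[lebesgue_measure]_(t in `[a, e]) enorm (v t).
Proof.
move=> sa ae.
rewrite -[X in _ <= _ + X]RintegralZl//; last first.
  by apply: continuous_integrable; apply: continuous_enorm => i; exact: continuous_coord.
apply: (@enorm_contraction _ _ u beta) => //.
- exact: ltW.
- by move=> i; exact: continuous_coord.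
- by move=> t; rewrite mulr_ge0 ?enorm_ge0// ltW.
- by move=> t i /andP[at_ _]; exact: uE.
Qed.

Let V := \int[lebesgue_measure]_(t in `[s, e]) enorm (h t - h s).
Let U := \int[lebesgue_measure]_(t in `[s, e]) enorm (u t).

Let zue : enorm (z e) <= enorm (u e) + enorm (h e - h s).
Proof. by rewrite -[z e](subrK (v e)); exact: enormD. Qed.

(** The first estimate is the contraction on the whole block. The second averages the contraction
    over all starting times in the block, so that an endpoint value is controlled by the time
    integral [U]. The third is the triangle inequality. *)
Lemma block_contraction :
  [/\ enorm (z e) + alpha * U <= enorm (z s) + L * V + enorm (h e - h s),
      (e - s) * enorm (z e) <= U + L * (e - s) * V + (e - s) * enorm (h e - h s) &
      \int[lebesgue_measure]_(t in `[s, e]) enorm (z t) <= U + V].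
Proof.
have cnv1 : continuous (fun t => enorm (v t)).
  by apply: continuous_enorm => i; exact: continuous_coord.
split.
- have us : u s = z s by rewrite /u /v subrr subr0.
  have := contraction (lexx s) se; rewrite us -/V -/U.
  by have := zue; lra.
- have es : 0 <= e - s by rewrite subr_ge0.
  suff : (e - s) * enorm (u e) <= U + L * (e - s) * V.
    by have := ler_wpM2l es zue; lra.
  rewrite -lerBlDr -(mulrC (e - s)) -mulrA -mulrBr mulrC -Rintegral_segment_cst//.
  apply: Rintegral_le => //; first exact: cst_continuous.
  move=> t /andP[st te]; rewrite lerBlDr.
  have := contraction st te.
  have : \int[lebesgue_measure]_(r in `[t, e]) enorm (v r) <= V.
    rewrite /V (Rintegral_split cnv1 st te) lerDr Rintegral_ge0// => r _.
    exact: enorm_ge0.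
  have : 0 <= \int[lebesgue_measure]_(r in `[t, e]) enorm (u r).
    by rewrite Rintegral_ge0// => r _; exact: enorm_ge0.
  move: L0 alpha0; nra.
- rewrite /U /V -RintegralD//; [|exact: continuous_integrable..].
  apply: Rintegral_le => [|t|t _].
  + by apply: continuous_enorm => i; exact: continuous_coord.
  + by apply: cvgD; [exact: cnu|exact: cnv1].
  + by rewrite -[z t](subrK (v t)); exact: enormD.
Qed.

End block.

Variables (D : R) (n : nat).
Hypothesis D0 : 0 < D.

Let N := enorm (h 0) + D^-1 * (\sum_(k < n) \int[lebesgue_measure]_(t in `[k%:R * D, k.+1%:R * D])
    enorm (h t - h (k%:R * D))) + \sum_(k < n) enorm (h (k.+1%:R * D) - h (k%:R * D)).

(** The first block estimate telescopes, starting from z 0 = h 0, and bounds alpha times the sum of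
    the [U k] with a constant independent of [n]. The other two estimates then express both
    distances through this sum. *)
Lemma two_solutions_bound :
  \int[lebesgue_measure]_(t in `[0, n%:R * D]) enorm (z t) <=
    (alpha^-1 + (L / alpha + 1) * D) * N /\
  \sum_(k < n) enorm (z (k.+1%:R * D)) <= ((alpha * D)^-1 + L / alpha + L * D + 1) * N.
Proof.
pose V k := \int[lebesgue_measure]_(t in `[k%:R * D, k.+1%:R * D]) enorm (h t - h (k%:R * D)).
pose U k := \int[lebesgue_measure]_(t in `[k%:R * D, k.+1%:R * D])
  enorm (z t - (h t - h (k%:R * D))).
pose v k := enorm (h (k.+1%:R * D) - h (k%:R * D)).
have kD k : 0 <= k%:R * D by rewrite mulr_ge0// ltW.
have kkD k : k%:R * D <= k.+1%:R * D by rewrite ler_wpM2r ?ltW ?ltr_nat.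
have DE k : k.+1%:R * D - k%:R * D = D by rewrite -mulrBl -natrB// subSnn mul1r.
have blk k := block_contraction (kD k) (kkD k).
have sumU : enorm (z (n%:R * D)) + alpha * (\sum_(k < n) U k) <=
    enorm (h 0) + L * (\sum_(k < n) V k) + \sum_(k < n) v k.
  elim: n => [|m IH].
    rewrite !big_ord0 !mulr0 !addr0 mul0r; suff -> : z 0 = h 0 by [].
    rewrite /z /h y1E// y2E//; apply/matrixP => i j.
    by rewrite !mxE set_itv1 !Rintegral_set1; ring.
  rewrite !big_ord_recr/=; have [+ _ _] := blk m.
  by rewrite -/(V m) -/(U m) -/(v m); move: IH; lra.
have := enorm_ge0 (z (n%:R * D)); have := enorm_ge0 (h 0).
have V0 : 0 <= \sum_(k < n) V k.
  by rewrite sumr_ge0// => k _; rewrite Rintegral_ge0// => t _; exact: enorm_ge0.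
have v0 : 0 <= \sum_(k < n) v k by rewrite sumr_ge0// => k _; exact: enorm_ge0.
rewrite /N; set SV := \sum_(k < n) V k in sumU V0 *.
set Sv := \sum_(k < n) v k in sumU v0 *.
have zU : \int[lebesgue_measure]_(t in `[0, n%:R * D]) enorm (z t) <= (\sum_(k < n) U k) + SV.
  rewrite -[n%:R * D]add0r Rintegral_blocks; first last.
  - exact: ltW.
  - by apply: continuous_enorm => i; exact: continuous_coord.
  by rewrite /SV -big_split/=; apply: ler_sum => k _; rewrite !add0r; have [] := blk k.
have zs : D * (\sum_(k < n) enorm (z (k.+1%:R * D))) <=
    (\sum_(k < n) U k) + L * D * SV + D * Sv.
  rewrite /SV /Sv !mulr_sumr -!big_split/=; apply: ler_sum => k _.
  by have [_] := blk k; rewrite DE.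
move: sumU zU zs; set SU := \sum_(k < n) U k; set Z := \int[_]_(_ in _) _.
set Y := \sum_(k < n) _; set h0 := enorm (h 0); set zn := enorm _ => sumU zU zs h00 zn0.
have SUle : SU <= alpha^-1 * (h0 + L * SV + Sv).
  by rewrite ler_pdivlMl//; lra.
have DI : D * D^-1 = 1 by rewrite divff// gt_eqF.
have aI : 0 < alpha^-1 by rewrite invr_gt0.
have DI0 : 0 < D^-1 by rewrite invr_gt0.
split.
  apply: le_trans zU _; apply: le_trans (lerD SUle (lexx SV)) _.
  have -> : (alpha^-1 + (L / alpha + 1) * D) * (h0 + D^-1 * SV + Sv) =
     alpha^-1 * (h0 + Sv) + (L / alpha + 1) * (D * D^-1) * SV + alpha^-1 * (D^-1 * SV)
     + (L / alpha + 1) * D * (h0 + Sv) by ring.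
  rewrite DI.
  have : 0 <= alpha^-1 * (D^-1 * SV) by rewrite !mulr_ge0// ltW.
  have : 0 <= (L / alpha + 1) * D * (h0 + Sv).
    by rewrite !mulr_ge0 ?addr_ge0// ?mulr_ge0// ltW.
  lra.
rewrite -(ler_pM2l D0); apply: le_trans zs _.
have -> : D * (((alpha * D)^-1 + L / alpha + L * D + 1) * (h0 + D^-1 * SV + Sv)) =
   (D * D^-1) * alpha^-1 * (h0 + D^-1 * SV + Sv) +
   (L / alpha + L * D) * ((D * D^-1) * SV + D * (h0 + Sv)) + (D * D^-1) * SV + D * (h0 + Sv).
  by rewrite invfM; ring.
rewrite DI !mul1r.
have : 0 <= alpha^-1 * (D^-1 * SV) by rewrite !mulr_ge0// ltW.
have : 0 <= (L / alpha + L * D) * (D * (h0 + Sv)).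
  by rewrite !mulr_ge0 ?addr_ge0// ?mulr_ge0// ltW.
have : 0 <= D * h0 by rewrite mulr_ge0// ltW.
move: SUle; lra.
Qed.

End two_solutions.

(** * Countable dense families of paths and their discretization *)

(** For each precision, points with equal codes are close and codes are countable; the sequence
    enumerates one representative for each precision and code. *)
Lemma dense_codes {R : realType} (T : Type) (K : countType) (t0 : T)
    (code : nat -> T -> K) (rho : T -> T -> R) (eps : nat -> R) :
  eps @ \oo --> (0 : R) -> (forall q s t, code q s = code q t -> rho s t <= eps q) ->
  exists t_ : nat -> T, forall t e, 0 < e -> exists i, rho t (t_ i) <= e.
Proof.
move=> eps0 same.
pose t_ n := if unpickle n is Some (q, c) then
    (if pselect (exists t, code q t = c) is left h then sval (cid h) else t0) else t0.
exists t_ => t e e0.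
have /cvgrPdist_le/(_ _ e0)[q _ /(_ q (leqnn q))] := eps0.
rewrite sub0r normrN => qe; exists (pickle (q, code q t)).
rewrite /t_ pickleK; case: pselect => [h|[]]; last by exists t.
apply: le_trans (same q _ _ _) (le_trans (ler_norm _) qe).
by rewrite (svalP (cid h)).
Qed.

Lemma continuous_comp_within {R : realType} {V : topologicalType} (A : set R)
    (f : R -> V) (c : R -> R) : {within A, continuous f} -> continuous c ->
  (forall t, A (c t)) -> continuous (f \o c).
Proof.
move=> /subspace_continuousP cf cc Ac t.
apply: cvg_comp (cf _ (Ac t)) => U; rewrite /within/= => AU.
have : nbhs t (fun s => A (c s) -> U (c s)) := @cc t _ AU.
by apply: filterS => s; apply.
Qed.

Section clamp.
Context {R : realType}.
Variables (M : R).
Hypothesis M0 : 0 <= M.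
Implicit Types (f g : R -> R) (s t : R).

(** Stopping the time at 0 and M makes a path on [0, +oo[ continuous and bounded on the whole line,
    unchanged on [0, M]. *)
Definition clamp t : R := Num.max 0 (Num.min t M).

Lemma clamp_itv t : 0 <= clamp t <= M.
Proof. by rewrite /clamp le_max lexx/= ge_max M0 ge_min lexx orbT. Qed.

Lemma clamp_id t : 0 <= t <= M -> clamp t = t.
Proof. by move=> /andP[t0 tM]; rewrite /clamp min_l// max_r. Qed.

Lemma clamp_dist s t : `|clamp s - clamp t| <= `|s - t|.
Proof.
have := ler_norm (s - t); have := ler_norm (t - s); rewrite (distrC t s) ler_norml.
rewrite /clamp /Order.max /Order.min.
by do 4 case: ifPn; rewrite -?leNgt => *; apply/andP; split; lra.
Qed.

Lemma continuous_clamp : continuous clamp.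
Proof.
move=> t; apply/cvgrPdist_le => e e0; near=> s.
apply: le_trans (clamp_dist t s) _; apply: ltW.
by near: s; exact: (nbhsx_ballx t e e0).
Unshelve. all: end_near. Qed.

Lemma continuous_comp_clamp f : {within `[0, +oo[, continuous f} -> continuous (f \o clamp).
Proof.
move=> cf; apply: (continuous_comp_within cf continuous_clamp) => t.
by rewrite /= in_itv/= andbT; have /andP[] := clamp_itv t.
Qed.

Variable f : R -> R.
Hypothesis cf : {within `[0, +oo[, continuous f}.
Let F := f \o clamp.

Lemma bounded_clamp : exists C, forall t, `|F t| <= C.
Proof.
have cF : continuous (fun t => `|F t|).
  by move=> t; apply: cvg_norm; exact: continuous_comp_clamp.
have [c _ cM] := EVT_max M0 (continuous_subspaceT cF).
exists `|F c| => t; have := cM (clamp t); rewrite in_itv/= clamp_itv => /(_ isT).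
by rewrite /F /= [clamp (clamp t)]clamp_id// clamp_itv.
Qed.

Definition oscillation (g : R -> R) (delta : R) : R :=
  sup [set q | exists s t, `|s - t| <= delta /\ q = `|g s - g t|].

Definition sup_norm (g : R -> R) : R := sup [set q | exists t, q = `|g t|].

Lemma sup_norm_ge (g : R -> R) t : (exists C, forall t, `|g t| <= C) -> `|g t| <= sup_norm g.
Proof.
move=> [C gC]; apply: ub_le_sup; last by exists t.
by exists C => _ [s ->].
Qed.

Lemma sup_norm_le (g : R -> R) C : (forall t, `|g t| <= C) -> sup_norm g <= C.
Proof.
by move=> gC; apply: ge_sup; [exists `|g 0|, 0|move=> _ [t ->]].
Qed.

Lemma oscillation_ge s t delta : `|s - t| <= delta -> `|F s - F t| <= oscillation F delta.
Proof.
move=> st; apply: ub_le_sup; last by exists s, t.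
have [C FC] := bounded_clamp; exists (C + C) => _ [s' [t' [_ ->]]].
by apply: le_trans (ler_normB _ _) _; exact: lerD.
Qed.

Lemma oscillation_ge0 delta : 0 <= delta -> 0 <= oscillation F delta.
Proof.
move=> d0; apply: le_trans (normr_ge0 (F 0 - F 0)) (oscillation_ge _).
by rewrite subrr normr0.
Qed.

(** Uniform continuity on the compact [0, M], from a finite covering argument. *)
Lemma oscillation_cvg (delta : nat -> R) : (forall m, 0 <= delta m) ->
  delta @ \oo --> (0 : R) -> (fun m => oscillation F (delta m)) @ \oo --> (0 : R).
Proof.
move=> d0 dc; apply/cvgrPdist_le => e e0.
have e20 : 0 < e / 2 by rewrite divr_gt0.
have cF := continuous_comp_clamp cf.
have : \forall m \near \oo, `[0, M]%classic `<=` (fun s => forall t, `|s - t| <= delta m ->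
    `|F s - F t| <= e).
  have /compact_near_coveringP := @segment_compact R 0 M; apply => x _.
  have /cvgrPdist_lt/(_ _ e20)/nbhs_ballP[r /= r0 Hr] := cF x.
  have r20 : 0 < r / 2 by rewrite divr_gt0.
  near=> s m => /= t st.
  have xs : `|x - s| < r / 2 by near: s; exact: (nbhsx_ballx x _ r20).
  have dm : delta m < r / 2.
    near: m; have /cvgrPdist_lt/(_ _ r20) := dc; apply: filterS => m.
    by rewrite sub0r normrN ger0_norm.
  have h1 : `|F x - F s| < e / 2.
    by apply: Hr; rewrite /= /ball/= (lt_le_trans xs)//; lra.
  have h2 : `|F x - F t| < e / 2.
    apply: Hr; rewrite /= /ball/= -(subrK s x) -addrA.
    by apply: le_lt_trans (ler_normD _ _) _; lra.
  rewrite -(subrK (F x) (F s)) -addrA; apply: le_trans (ler_normD _ _) _.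
  by rewrite distrC; lra.
apply: filterS => m Hm; rewrite sub0r normrN ger0_norm ?oscillation_ge0//.
apply: ge_sup; first by exists `|F 0 - F 0|, 0, 0; rewrite subrr normr0 d0.
move=> _ [s [t [st ->]]].
have FE u : F u = F (clamp u) by rewrite /F /= [clamp (clamp u)]clamp_id ?clamp_itv.
rewrite (FE s) (FE t); apply: Hm; last exact: le_trans (clamp_dist s t) st.
by rewrite /= in_itv/= clamp_itv.
Unshelve. all: end_near. Qed.

End clamp.

(** Comparison with the Riemann sum at right endpoints; on each cell the integrand differs from its
    endpoint value by at most [om]. *)
Lemma Rintegral_grid_le {R : realType} (f : R -> R) (a D om : R) m :
  continuous f -> 0 < D ->
  (forall s t, `|s - t| <= D / m.+1%:R -> `|f s - f t| <= om) ->
  D^-1 * \int[lebesgue_measure]_(t in `[a, a + D]) f t <=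
  m.+1%:R^-1 * (\sum_(j < m.+1) f (a + j.+1%:R * (D / m.+1%:R))) + om.
Proof.
move=> cf D0 fom; set delta := D / m.+1%:R in fom *.
have delta0 : 0 < delta by rewrite divr_gt0.
have mD : m.+1%:R * delta = D by rewrite mulrC divfK.
rewrite ler_pdivrMl// -{1}mD Rintegral_blocks//; last exact: ltW.
apply: (@le_trans _ _ (\sum_(j < m.+1) (f (a + j.+1%:R * delta) + om) * delta)).
  apply: ler_sum => j _.
  have jE : a + j.+1%:R * delta - (a + j%:R * delta) = delta.
    by rewrite -natr1; ring.
  have jj : a + j%:R * delta <= a + j.+1%:R * delta by rewrite -subr_ge0 jE ltW.
  rewrite -[in leRHS]jE -Rintegral_segment_cst//.
  apply: Rintegral_le => //; first exact: cst_continuous.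
  move=> t /andP[t1 t2]; rewrite -lerBlDl.
  apply: le_trans (ler_norm _) (fom _ _ _); rewrite ler_norml; lra.
rewrite -mulr_suml big_split/= sumr_const card_ord -mulr_natr mulrC.
rewrite le_eqVlt; apply/orP; left; apply/eqP; rewrite /delta.
by set s := \sum_(_ < _) _; field; rewrite addrC natr1 pnatr_eq0.
Qed.

Section block_variation.
Context {R : realType}.
Variables (D : R) (n : nat).

(* Seminorm of a path modulo its sampling mesh: the increments over each block
   are measured both at the end of the block and in time average. *)
Definition block_variation (h : R -> R) : R :=
  `|h 0| + D^-1 * (\sum_(k < n) \int[lebesgue_measure]_(t in `[k%:R * D, k.+1%:R * D])
     `|h t - h (k%:R * D)|) + \sum_(k < n) `|h (k.+1%:R * D) - h (k%:R * D)|.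

Hypothesis D0 : 0 < D.

Lemma eq_block_variation (h g : R -> R) : (forall t, 0 <= t <= n%:R * D -> h t = g t) ->
  block_variation h = block_variation g.
Proof.
move=> hg; rewrite /block_variation; have Dge0 := ltW D0.
have kn (k : nat) : (k <= n)%N -> 0 <= k%:R * D <= n%:R * D.
  by move=> kn; rewrite mulr_ge0//= ler_wpM2r// ler_nat.
congr (_ + _ * _ + _).
- by rewrite hg// lexx mulr_ge0.
- apply: eq_bigr => k _; apply: eq_Rintegral => t.
  rewrite inE/= in_itv/= => /andP[kt tk].
  have /andP[k0 _] := kn k (ltnW (ltn_ord k)).
  have /andP[_ k1] := kn k.+1 (ltn_ord k).
  by rewrite !hg ?(le_trans k0 kt) ?(le_trans tk k1)// kn// ltnW.
- by apply: eq_bigr => k _; rewrite !hg ?kn// ltnW.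
Qed.

End block_variation.

Section dense_paths.
Context {R : realType} {T : Type} {d : nat}.
Variables (t0 : T) (f : 'I_d -> T -> R -> R) (M : R).
Hypothesis M0 : 0 < M.
Hypothesis cf : forall i t, {within `[0, +oo[, continuous (f i t)}.

Let F i t := f i t \o clamp M.
Let M0' := ltW M0.

Let mesh q t : {p | forall i, oscillation (F i t) (M / p.+1%:R) <= q.+1%:R^-1}.
Proof.
apply: cid; have q0 : (0 : R) < q.+1%:R^-1 by rewrite invr_gt0.
have : \forall p \near \oo, forall i, oscillation (F i t) (M / p.+1%:R) <= q.+1%:R^-1.
  apply: filter_forall => i.
  have := oscillation_cvg M0' (@cf i t) _ (cvg_harmonicZ M).
  have M1 (m : nat) : 0 <= M / m.+1%:R by rewrite divr_ge0.
  move=> /(_ M1)/cvgrPdist_le/(_ _ q0); apply: filterS => m; rewrite sub0r normrN.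
  by apply: le_trans; exact: ler_norm.
by move=> [p _ /(_ p (leqnn p)) h]; exists p.
Qed.

(** Records a mesh adapted to the modulus of continuity of the path and its rounded values on that
    mesh. There are only countably many codes, although the mesh depends on the path. *)
Let code q t : nat * {ffun 'I_d -> seq int} :=
  let p := sval (mesh q t) in
  (p, [ffun i => mkseq (fun j => Num.floor (q.+1%:R * f i t (j%:R * (M / p.+1%:R)))) p.+2]).

(** The three errors are the oscillation of each path within a cell and the common rounding at the
    node. *)
Let same_code q s t i : code q s = code q t ->
  sup_norm (fun u => F i s u - F i t u) <= 3 / q.+1%:R.
Proof.
rewrite /code; have := svalP (mesh q t); have := svalP (mesh q s).
set p := sval (mesh q s); set p' := sval (mesh q t) => /(_ i) os ot' [pp' /ffunP/(_ i)].
rewrite -{}pp' {p'} in ot' *; have {ot'} ot := ot' i; rewrite !ffunE => fl.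
apply: sup_norm_le => u; set delta := M / p.+1%:R.
have delta0 : 0 < delta by rewrite divr_gt0.
have /andP[u0 uM] := clamp_itv M0' u.
pose j := Num.truncn (clamp M u / delta).
have /andP[j1 j2] : j%:R <= clamp M u / delta < j.+1%:R by apply: truncn_itv; rewrite divr_ge0// ltW.
(* The index p + 1 does occur, when the clamped time is M; hence p + 2 samples in the code. *)
have jp : (j < p.+2)%N.
  rewrite ltnS -(ler_nat R); apply: le_trans j1 _.
  rewrite ler_pdivrMr// /delta mulrC divfK//.
pose v := j%:R * delta.
have uv : `|clamp M u - v| <= delta.
  have : v <= clamp M u by rewrite /v -ler_pdivlMr.
  have : clamp M u < v + delta by rewrite /v -[X in _ + X]mul1r -mulrDl natr1 -ltr_pdivrMr.
  by rewrite ler_norml; lra.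
have vM : 0 <= v <= M.
  by rewrite mulr_ge0 ?(ltW delta0)//= (le_trans _ uM)// /v -ler_pdivlMr.
have FE x : F i x u = F i x (clamp M u) by rewrite /F /= [clamp M (clamp M u)]clamp_id// clamp_itv.
have Fv x : F i x v = f i x v by rewrite /F /= clamp_id.
have os' x : `|F i x u - F i x v| <= oscillation (F i x) delta.
  by rewrite FE; exact: (oscillation_ge M0').
have flv : Num.floor (q.+1%:R * f i s v) = Num.floor (q.+1%:R * f i t v).
  by have := congr1 (fun l => nth 0 l j) fl; rewrite !nth_mkseq.
have stv : `|F i s v - F i t v| <= q.+1%:R^-1.
  rewrite !Fv -(ler_pM2l (_ : 0 < q.+1%:R))// divff// -[X in X * _]ger0_norm// -normrM mulrBr.
  have := real_floor_itv (num_real (q.+1%:R * f i s v)).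
  have := real_floor_itv (num_real (q.+1%:R * f i t v)).
  rewrite flv intrD => /andP[a1 a2] /andP[b1 b2]; rewrite ler_norml; lra.
have -> : F i s u - F i t u = (F i s u - F i s v) + (F i s v - F i t v) - (F i t u - F i t v) by ring.
apply: le_trans (ler_normB _ _) _; apply: le_trans (lerD (ler_normD _ _) (lexx _)) _.
have := le_trans (os' s) os; have := le_trans (os' t) ot; move: stv.
set Q := q.+1%:R^-1; lra.
Qed.

Lemma dense_paths : exists t_ : nat -> T, forall t e, 0 < e -> exists k,
  \sum_i sup_norm (fun u => F i t u - F i (t_ k) u) <= e.
Proof.
have := @dense_codes R T _ t0 code (fun s t => \sum_i sup_norm (fun u => F i s u - F i t u))
  _ (cvg_harmonicZ (d%:R * 3)); apply => q s t st.
apply: le_trans (ler_sum _ (fun i _ => same_code i st)) _.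
by rewrite sumr_const card_ord -[leLHS]mulr_natl mulrA.
Qed.

End dense_paths.

(** * Concentration for functionals that are Lipschitz in block variation *)

Section fbm_concentration.
Context {R : realType} disp (T : measurableType disp) (P : probability T R).
Context {d : nat}.
Variables (H : R) (B : 'I_d -> R -> {RV P >-> R}) (D : R) (n : nat).
Hypotheses (H01 : 0 < H < 1) (hB : fbm H B) (D0 : 0 < D) (n0 : (0 < n)%N).

Let p := 2 * H.
Let M := n%:R * D.
Let M0 : 0 < M. Proof. by rewrite mulr_gt0// ltr0n. Qed.
Let H0 : 0 < H. Proof. by case/andP: H01. Qed.
Let p02 : 0 < p <= 2. Proof. by rewrite /p; case/andP: H01 => *; lra. Qed.

Let path i w t := B i t w.
Let cpath i w : {within `[0, +oo[, continuous (path i w)}.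
Proof. exact: fbm1_continuous (fbm_component hB i) w. Qed.

Let F i w := path i w \o clamp M.
Let cF i w : continuous (F i w). Proof. exact: (continuous_comp_clamp (ltW M0)). Qed.

Let diff i w w' t := path i w t - path i w' t.

Let grid := ('I_n * 'I_d)%type.
Let node m (j : 'I_m.+1) : R := j.+1%:R * (D / m.+1%:R).

Let node_itv m (j : 'I_m.+1) : 0 <= node j <= D.
Proof.
rewrite /node mulr_ge0 ?divr_ge0 ?(ltW D0)//= mulrCA -[leRHS]mulr1 ler_wpM2l ?(ltW D0)//.
by rewrite ler_pdivrMr// mul1r ler_nat.
Qed.

Let node_max m : node (@ord_max m) = D.
Proof. by rewrite /node mulrCA divff ?mulr1. Qed.

Let start m (e : 'I_n * 'I_m.+1) : R := e.1%:R * D.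
Let stop m (e : 'I_n * 'I_m.+1) : R := e.1%:R * D + node e.2.

Let start0 m e : 0 <= @start m e.
Proof. by rewrite mulr_ge0// ltW. Qed.

Let stop0 m e : 0 <= @stop m e.
Proof. by rewrite addr_ge0//; [exact: start0|case/andP: (node_itv e.2)]. Qed.

(** One coordinate per component, block and node, for the increment from the start of the block to
    the node, and one per component for the almost surely null value at time 0. *)
Let J m : finType := ('I_d * ('I_n * 'I_m.+1) + 'I_d)%type.
Let X m : J m -> T -> R := null_ext (increments B (@start m) (@stop m)) (fun i => B i 0).
Let S m : J m -> J m -> R :=
  @null_ext_cov _ _ 'I_d (@increments_cov _ d H _ (@start m) (@stop m)).

Variables (G : T -> R) (K : R).
Hypothesis K0 : 0 < K.
Hypothesis G_le : forall w w', `|G w - G w'| <=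
  K * \sum_i block_variation D n (fun t => B i t w - B i t w').

(** Every node carries the weight of a Riemann sum, and the last one, which is the end of the block,
    also that of the full block increment. The total per block is 2K for every m. *)
Let wt m (j : 'I_m.+1) : R := K * (m.+1%:R^-1 + (j == ord_max)%:R).
Let w_ m (e : J m) : R := match e with inl (i, (k, j)) => wt j | inr i => K end.

Let wt0 m (j : 'I_m.+1) : 0 <= wt j.
Proof. by rewrite /wt mulr_ge0 ?addr_ge0// ltW. Qed.

Let sum_wt m : \sum_(j < m.+1) wt j = 2 * K.
Proof.
rewrite -mulr_sumr big_split/= sumr_const card_ord -[_^-1 *+ _]mulr_natr mulVf//.
rewrite (bigD1 ord_max)//= eqxx big1 ?addr0; first by rewrite mulrC.
by move=> j /negbTE ->.
Qed.

Let Q := d%:R * ((2 * K) ^+ 2 * (3 * (D `^ p * n%:R `^ (Num.max p 1)))).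

Let wQ m a : (forall e, `|a e| <= @w_ m e) -> quadratic_form (@S m) a <= Q.
Proof.
move=> aw; rewrite /S null_ext_formE increments_formE.
have -> : Q = \sum_(i < d) (2 * K) ^+ 2 * (3 * (D `^ p * n%:R `^ (Num.max p 1))).
  by rewrite sumr_const card_ord /Q mulr_natl.
apply: ler_sum => i _; rewrite -(sum_wt m); apply: le_trans (increments_form_bound (m := m.+1) (w := @wt m)
  (a := @node m) (phi := fun k j => a (inl (i, (k, j)))) p02 (ltW D0) n0 _ _).
- rewrite sum_pair le_eqVlt; apply/orP; left; apply/eqP.
  by apply: eq_bigr => k _; apply: eq_bigr => j _; rewrite sum_pair.
- exact: node_itv.
- by move=> k j; exact: (aw (inl (i, (k, j)))).
Qed.

Let delta m : R := D / m.+1%:R.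
(** Cost of replacing the n time averages by Riemann sums of step [delta m]. *)
Let err m w := K * (n%:R * \sum_i oscillation (F i w) (delta m)).
Let rho w w' := K * (4 * n%:R + 1) * \sum_i sup_norm (fun t => F i w t - F i w' t).

Let err_cvg w : (fun m => err m w) @ \oo --> (0 : R).
Proof.
rewrite [X in _ --> X](_ : 0 = K * (n%:R * \sum_(i < d) 0)); last by rewrite big1// !mulr0.
apply: cvgMr; apply: cvgMr.
apply: cvg_sumr => i; apply: (oscillation_cvg (ltW M0)) => //.
  by move=> m; rewrite divr_ge0// ltW.
exact: cvg_harmonicZ.
Qed.

Let sum_weights m w w' : \sum_e @w_ m e * `|X e w - X e w'| =
  \sum_i (K * `|diff i w w' 0| + \sum_(k < n) \sum_(j < m.+1)
     wt j * `|diff i w w' (k%:R * D + node j) - diff i w w' (k%:R * D)|).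
Proof.
rewrite big_sumType/= addrC big_split/=; congr (_ + _).
rewrite sum_pair; apply: eq_bigr => i _; rewrite sum_pair.
apply: eq_bigr => k _; apply: eq_bigr => j _; congr (_ * `|_|).
by rewrite /increments/= /start /stop /diff /path/=; ring.
Qed.

Let clampE i w t : 0 <= t <= M -> path i w t = F i w t.
Proof. by move=> tM; rewrite /F /= clamp_id. Qed.

Let in_itv k (j : 'I_n) : 0 <= k <= D -> 0 <= j%:R * D + k <= M.
Proof.
move=> /andP[k0 kD]; rewrite addr_ge0 ?mulr_ge0 ?(ltW D0)//=.
apply: le_trans (_ : j%:R * D + D <= _); first by rewrite lerD2l.
by rewrite -[X in _ + X]mul1r -mulrDl natr1 ler_wpM2r ?(ltW D0)// ler_nat.
Qed.

Let in_itv0 (j : 'I_n) : 0 <= j%:R * D <= M.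
Proof. by rewrite -[_ * D]addr0; apply: in_itv; rewrite lexx ltW. Qed.

Let G_grid m w w' : `|G w - G w'| <=
  \sum_e @w_ m e * `|X e w - X e w'| + err m w + err m w'.
Proof.
apply: le_trans (G_le w w') _; rewrite sum_weights.
rewrite /err !mulr_sumr -!big_split/=; apply: ler_sum => i _.
set om := oscillation (F i w) _; set om' := oscillation (F i w') _.
pose h t := F i w t - F i w' t.
have hE t : 0 <= t <= M -> diff i w w' t = h t by move=> tM; rewrite /diff !clampE.
rewrite (@eq_block_variation _ _ _ D0 _ h)//.
have -> : K * `|diff i w w' 0| = K * `|h 0| by rewrite hE// lexx ltW.
rewrite -!addrA /block_variation !mulrDr -addrA lerD2l.
have kD (k : nat) : k%:R * D + D = k.+1%:R * D by rewrite -natr1 mulrDl mul1r.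
have -> : \sum_(k < n) \sum_(j < m.+1)
     wt j * `|diff i w w' (k%:R * D + node j) - diff i w w' (k%:R * D)| =
   K * \sum_(k < n) (m.+1%:R^-1 * \sum_(j < m.+1) `|h (k%:R * D + node j) - h (k%:R * D)|) +
   K * \sum_(k < n) `|h (k.+1%:R * D) - h (k%:R * D)|.
  rewrite -mulrDr -big_split/= mulr_sumr; apply: eq_bigr => k _.
  have -> : `|h (k.+1%:R * D) - h (k%:R * D)| =
      \sum_(j < m.+1) (j == ord_max)%:R * `|h (k%:R * D + node j) - h (k%:R * D)|.
    rewrite (bigD1 ord_max)//= eqxx node_max mul1r big1 ?addr0.
      by rewrite kD.
    by move=> j /negbTE ->; rewrite mul0r.
  rewrite mulr_sumr -big_split/= mulr_sumr; apply: eq_bigr => j _.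
  by rewrite !hE ?in_itv// /wt; ring.
suff : D^-1 * (\sum_(k < n) \int[lebesgue_measure]_(t in `[k%:R * D, k.+1%:R * D])
     `|h t - h (k%:R * D)|) <= \sum_(k < n) (m.+1%:R^-1 * \sum_(j < m.+1)
       `|h (k%:R * D + node j) - h (k%:R * D)|) + (n%:R * om + n%:R * om').
  move=> /(ler_wpM2l (ltW K0)); set A := K * (D^-1 * _).
  by rewrite !mulrDr; set A1 := K * \sum_(_ < _) _; set A2 := K * \sum_(_ < _) _; lra.
have -> : n%:R * om + n%:R * om' = \sum_(k < n) (om + om').
  by rewrite sumr_const card_ord -mulrDr mulr_natl.
rewrite mulr_sumr -big_split/=; apply: ler_sum => k _.
rewrite -kD; apply: (Rintegral_grid_le (f := fun t => `|h t - h (k%:R * D)|)) => //.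
  by move=> t; apply: cvg_norm; apply: cvgB; [apply: cvgB; exact: cF|exact: cvg_cst].
move=> s t st; apply: le_trans (ler_dist_dist _ _) _.
have -> : h s - h (k%:R * D) - (h t - h (k%:R * D)) =
   (F i w s - F i w t) - (F i w' s - F i w' t) by rewrite /h; ring.
apply: le_trans (ler_normB _ _) _; apply: lerD; exact: (oscillation_ge (ltW M0)).
Qed.

Let w_rho m w w' : \sum_e @w_ m e * `|X e w - X e w'| <= rho w w'.
Proof.
rewrite sum_weights /rho mulr_sumr; apply: ler_sum => i _.
set s := sup_norm _.
have hs t : 0 <= t <= M -> `|diff i w w' t| <= s.
  move=> tM; rewrite /diff !clampE//.
  apply: (sup_norm_ge (g := fun t => F i w t - F i w' t)).
  have [C1 h1] := bounded_clamp (ltW M0) (@cpath i w).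
  have [C2 h2] := bounded_clamp (ltW M0) (@cpath i w').
  by exists (C1 + C2) => u; apply: le_trans (ler_normB _ _) _; exact: lerD (h1 u) (h2 u).
have -> : K * (4 * n%:R + 1) * s = K * s + \sum_(k < n) \sum_(j < m.+1) wt j * (s + s).
  under eq_bigr do rewrite -mulr_suml sum_wt.
  by rewrite sumr_const card_ord -[_ * (s + s) *+ _]mulr_natl; ring.
apply: lerD; first by rewrite ler_pM2l// hs// lexx ltW.
apply: ler_sum => k _; apply: ler_sum => j _; rewrite ler_wpM2l//.
apply: le_trans (ler_normB _ _) _; apply: lerD; apply: hs => //.
exact: in_itv.
Qed.

Let point : T.
Proof.
have : [set: T] !=set0.
  apply/set0P/eqP => T0; have := @probability_setT _ _ _ P.
  by rewrite T0 measure0 => /esym/eqP; rewrite onee_eq0.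
by move=> /cid[t _]; exact: t.
Qed.

(** Instance of [approximation_expR]: the error vanishes by uniform continuity of each path, and the
    weighted distances are bounded, uniformly in m, by the sup distance [rho], for which paths are
    separable. *)
Lemma fbm_exp_moment : measurable_fun setT G /\
  (\int[(P \x P)%E]_z (expR (G z.2 - G z.1))%:E <= (expR (pi ^+ 2 / 8 * Q))%:E)%E.
Proof.
have [t_ dense] := dense_paths point M0 cpath.
apply: (@approximation_expR _ _ _ P J X w_ S _ _ _ _ _ _ _ err rho t_).
- move=> m; apply: measurable_null_ext => *; first exact: measurable_increments.
  by [].
- by move=> m [[i [k j]]|i] /=; [exact: wt0|exact: ltW].
- move=> m a; rewrite /S null_ext_formE.
  exact: (increments_form_ge0 hB (@start0 m) (@stop0 m)).
- move=> m a c; apply: null_ext_cos => [j|i|a' c'|i].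
  + exact: measurable_increments.
  + by [].
  + exact: (increments_cos hB (@start0 m) (@stop0 m)).
  + exact: (fbm1_null H0 (fbm_component hB i)).
- exact: wQ.
- exact: err_cvg.
- exact: G_grid.
- exact: w_rho.
- move=> w e e0.
  have c0 : 0 < K * (4 * n%:R + 1) by rewrite mulr_gt0// ltr_wpDl.
  have [k hk] := dense w _ (divr_gt0 e0 c0).
  by exists k; rewrite /rho mulrC -ler_pdivlMr.
Qed.

End fbm_concentration.

(** The 12 is 2^2 from the total weight 2K times the 3 of the row sums; d + 1 instead of d keeps the
    constant positive in dimension 0. *)
Definition fbm_constant {R : realType} (H D : R) (d : nat) : R :=
  pi ^+ 2 / 8 * (12 * d.+1%:R * D `^ (2 * H)).

Lemma fbm_constant_gt0 {R : realType} (H D : R) d : 0 < D -> 0 < fbm_constant H D d.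
Proof.
by move=> D0; rewrite /fbm_constant mulr_gt0 ?divr_gt0 ?exprn_gt0 ?pi_gt0 ?mulr_gt0 ?powR_gt0.
Qed.

Lemma fbm_concentration {R : realType} disp (T : measurableType disp)
    (P : probability T R) (d : nat) (H : R) (B : 'I_d -> R -> {RV P >-> R})
    (D : R) (n : nat) (G : T -> R) (K r : R) :
  0 < H < 1 -> fbm H B -> 0 < D -> (0 < n)%N -> 0 < K ->
  (forall w w', `|G w - G w'| <=
    K * \sum_i block_variation D n (fun t => B i t w - B i t w')) ->
  0 <= r ->
  (P [set t | r%:E < (G t)%:E - 'E_P[G]] <=
    (expR (- (r ^+ 2 / (4 * fbm_constant H D d * K ^+ 2 * n%:R `^ Num.max (2 * H) 1))))%:E)%E.
Proof.
move=> H01 hB D0 n0 K0 GK r0.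
have [mG _] := fbm_exp_moment H01 hB D0 n0 K0 GK.
set np := n%:R `^ _; have np0 : 0 < np by rewrite powR_gt0 ?ltr0n.
pose Q := 12 * d.+1%:R * D `^ (2 * H) * K ^+ 2 * np.
have DH : 0 < D `^ (2 * H) by rewrite powR_gt0.
have Q0 : 0 < Q by rewrite !mulr_gt0// exprn_gt0.
have c0 : (0 : R) < pi ^+ 2 / 8 by rewrite divr_gt0// exprn_gt0// pi_gt0.
have -> : 4 * fbm_constant H D d * K ^+ 2 * np = 4 * (pi ^+ 2 / 8) * Q.
  by rewrite /fbm_constant /Q; ring.
apply: chernoff_expR => // l l0.
(* The functional l G has Lipschitz constant l K, which makes the exponent quadratic in l. *)
have lGK w w' : `|l * G w - l * G w'| <=
    (l * K) * \sum_i block_variation D n (fun t => B i t w - B i t w').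
  by rewrite -mulrBr normrM gtr0_norm// -mulrA ler_pM2l.
have [_] := fbm_exp_moment H01 hB D0 n0 (mulr_gt0 l0 K0) lGK.
under eq_integral do rewrite -mulrBr.
move=> h; apply: le_trans h _; rewrite lee_fin ler_expR -[leRHS]mulrA ler_pM2l// -/np.
rewrite /Q -[d.+1%:R]natr1.
have : 0 <= 12 * (l ^+ 2 * K ^+ 2 * (D `^ (2 * H) * np)).
  by rewrite !mulr_ge0 ?sqr_ge0// ltW.
set x := D `^ _; set y := d%:R; nra.
Qed.

(** * Transfer to functionals of the solution *)

Section lipschitz.
Context {R : realType} {E : Type} (dist : E -> E -> R) (F : E -> R).
Hypothesis dist_ge0 : forall x y, 0 <= dist x y.
Hypothesis distxx : forall x, dist x x = 0.

(** If the set of quotients has no supremum, [sup] takes the default value 0; otherwise any quotient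
    is a nonnegative lower bound. *)
Lemma lip_norm_ge0 : 0 <= lip_norm dist F.
Proof.
rewrite /lip_norm; set A := [set q | _].
have [sA|/sup_out ->//] := pselect (has_sup A).
have [[q Aq] ub] := sA; have [x [y [_ qE]]] := Aq.
by apply: le_trans (ub_le_sup ub Aq); rewrite qE divr_ge0.
Qed.

Lemma lip_normP : lipschitz_wrt dist F -> forall x y, `|F x - F y| <= lip_norm dist F * dist x y.
Proof.
move=> [k Fk] x y; have [<-|xy] := pselect (x = y).
  by rewrite subrr normr0 distxx mulr0.
have [d0|d0] := eqVneq (dist x y) 0.
  by rewrite d0 mulr0; have := Fk x y; rewrite d0 mulr0.
have dp : 0 < dist x y by rewrite lt_def d0 dist_ge0.
rewrite -ler_pdivrMr//; apply: ub_le_sup; last by exists x, y.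
exists `|k| => _ [x' [y' [_ ->]]].
have [->|d1] := eqVneq (dist x' y') 0; first by rewrite invr0 mulr0.
have dp' : 0 < dist x' y' by rewrite lt_def d1 dist_ge0.
rewrite ler_pdivrMr//; apply: le_trans (Fk x' y') _.
by rewrite ler_wpM2r// ler_norm.
Qed.

End lipschitz.

Lemma continuous_matrix {R : realType} m n (f : R -> 'M[R]_(m, n)) :
  (forall i j, continuous (fun t => f t i j)) -> continuous f.
Proof.
move=> cf t; apply/cvg_mx_entourageP => A eA.
apply: filter_forall => i; apply: filter_forall => j.
have h : nbhs t (fun s => A (f t i j, f s i j)).
  by have /cvg_entourageP/(_ A eA) := cf i j t.
have : nbhs t (fun s => (f t i j, f s i j) \in A).
  by apply: filterS h => s; rewrite inE.
by [].
Qed.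

Section solution_paths.
Context {R : realType} disp (T : measurableType disp) (P : probability T R) {d : nat}.
Variables (H : R) (b : 'cV[R]_d -> 'cV[R]_d) (sigma : 'M[R]_d) (x : 'cV[R]_d).
Variables (B Y : 'I_d -> R -> {RV P >-> R}) (alpha L D : R).
Hypotheses (cb : continuous b) (alpha0 : 0 < alpha) (L0 : 0 < L) (D0 : 0 < D).
Hypothesis b_drift : forall y z : 'cV[R]_d,
  scalprod (b y - b z) (y - z) <= - alpha * enorm (y - z) ^+ 2 /\
  enorm (b y - b z) <= L * enorm (y - z).
Hypotheses (hB : fbm H B) (hY : solution b sigma x B Y).

(** The sum of the two constants of [two_solutions_bound], so that it serves both parts; the added 1
    keeps it positive when [sigma] is zero. *)
Definition solution_constant : R :=
  (alpha^-1 + (L / alpha + 1) * D + ((alpha * D)^-1 + L / alpha + L * D + 1)) *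
  (1 + \sum_i \sum_j `|sigma i j|).

Lemma solution_constant_gt0 : 0 < solution_constant.
Proof.
have a1 : 0 < alpha^-1 by rewrite invr_gt0.
have a2 : 0 <= (alpha * D)^-1 by rewrite invr_ge0 mulr_ge0// ltW.
have a3 : 0 < L / alpha by rewrite divr_gt0.
have a4 : 0 < L * D by rewrite mulr_gt0.
have a5 : 0 <= \sum_i \sum_j `|sigma i j| by rewrite sumr_ge0// => i _; rewrite sumr_ge0.
have a6 : 0 < (L / alpha + 1) * D by rewrite mulr_gt0// addr_gt0.
by rewrite mulr_gt0//; lra.
Qed.

(** Freezing the paths at their time 0 value for negative t gives paths continuous on the whole
    line. *)
Let y w (t : R) := vproc Y (Num.max 0 t) w.
Let g w (t : R) := sigma *m vproc B (Num.max 0 t) w.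

Let continuous_max0 : continuous (fun t : R => Num.max 0 t).
Proof.
move=> t; apply/cvgrPdist_lt => e e0; near=> s.
apply: (@le_lt_trans _ _ `|t - s|).
  have := ler_norm (s - t); have := ler_norm (t - s); rewrite (distrC s t) ler_norml.
  by rewrite /Order.max; do 2 case: ifPn; rewrite -?leNgt => *; apply/andP; split; lra.
by near: s; exact: (nbhsx_ballx t e e0).
Unshelve. all: end_near. Qed.

Let max0_ge0 (t : R) : `[0, +oo[%classic (Num.max 0 t).
Proof. by rewrite /= in_itv/= le_max lexx. Qed.

Let cy w : continuous (y w).
Proof.
exact: (@continuous_comp_within _ _ _ (fun t => vproc Y t w) (fun t => Num.max 0 t)
  (@solution_continuous _ _ _ _ _ _ _ _ _ _ hY w) continuous_max0 max0_ge0).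
Qed.

Let cBmax i w : continuous (fun t : R => B i (Num.max 0 t) w).
Proof.
exact: (@continuous_comp_within _ _ _ (fun t => B i t w) (fun t => Num.max 0 t)
  (@fbm1_continuous _ _ _ _ _ _ (fbm_component hB i) w) continuous_max0 max0_ge0).
Qed.

Let cg w : continuous (g w).
Proof.
apply: continuous_matrix => i j.
rewrite (_ : (fun t => _) = (fun t => \sum_k sigma i k * B k (Num.max 0 t) w)).
  by move=> t; apply: cvg_sumr => k; apply: cvgMr; exact: cBmax.
by apply/funext => t; rewrite /g mxE; apply: eq_bigr => k _; rewrite mxE.
Qed.

Let yE w t : 0 <= t ->
  y w t = x + \col_i (\int[lebesgue_measure]_(s in `[0, t]) (b (y w s)) i 0) + g w t.
Proof.
move=> t0; rewrite /y /g max_r// (solution_equation hY w t0); congr (_ + _ + _).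
apply/matrixP => i j; rewrite !mxE; apply: eq_Rintegral => s.
by rewrite inE/= in_itv/= => /andP[s0 _]; rewrite max_r.
Qed.

(** The seminorm of the driving difference sigma (B(w) - B(w')) is bounded componentwise, exchanging
    the sum over components with the integrals and the sum over blocks. *)
Let sum_enorm_le w w' n (h := fun t => g w t - g w' t) :
  enorm (h 0) + D^-1 * (\sum_(k < n) \int[lebesgue_measure]_(t in `[k%:R * D, k.+1%:R * D])
    enorm (h t - h (k%:R * D))) + \sum_(k < n) enorm (h (k.+1%:R * D) - h (k%:R * D)) <=
  (1 + \sum_i \sum_j `|sigma i j|) *
  \sum_i block_variation D n (fun t => B i t w - B i t w').
Proof.
pose hi i t := B i (Num.max 0 t) w - B i (Num.max 0 t) w'.
set c := \sum_i \sum_j _.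
have c0 : 0 <= c by rewrite sumr_ge0// => i _; rewrite sumr_ge0.
have Dge0 := ltW D0.
have chi i : continuous (hi i) by move=> t; apply: cvgB; exact: cBmax.
have ch : continuous h by move=> t; apply: cvgB; exact: cg.
rewrite (eq_bigr (fun i => block_variation D n (hi i))); last first.
  by move=> i _; apply: eq_block_variation => // t /andP[t0 _]; rewrite /hi max_r.
have hE t : h t = sigma *m \col_i hi i t.
  by rewrite /h /g -mulmxBr; congr (_ *m _); apply/matrixP => i j; rewrite !mxE.
have h0 : enorm (h 0) <= c * \sum_i `|hi i 0|.
  rewrite hE; apply: le_trans (enorm_mulmx_le _ _) _.
  by rewrite ler_wpM2l//; apply: ler_sum => i _; rewrite mxE.
have hd s t : enorm (h t - h s) <= c * \sum_i `|hi i t - hi i s|.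
  rewrite !hE -mulmxBr; apply: le_trans (enorm_mulmx_le _ _) _.
  by rewrite ler_wpM2l//; apply: ler_sum => i _; rewrite !mxE.
have ci k i : continuous (fun t => `|hi i t - hi i (k%:R * D)|).
  by move=> t; apply: cvg_norm; apply: cvgB; [exact: chi|exact: cvg_cst].
have hI k : \int[lebesgue_measure]_(t in `[k%:R * D, k.+1%:R * D]) enorm (h t - h (k%:R * D))
    <= c * \sum_i \int[lebesgue_measure]_(t in `[k%:R * D, k.+1%:R * D]) `|hi i t - hi i (k%:R * D)|.
  have mI : measurable (`[k%:R * D, k.+1%:R * D]%classic : set (measurableTypeR R)) by [].
  have [i1 <-] := Rintegral_sum (index_enum 'I_d) mI
    (fun i => continuous_integrable (k%:R * D) (k.+1%:R * D) (ci k i)).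
  rewrite -(RintegralZl c mI i1); apply: Rintegral_le.
  - apply: continuous_enorm => i t.
    apply: (@continuous_comp _ _ _ (fun t => h t - h (k%:R * D)) (fun M : 'cV[R]_d => M i 0)).
      by apply: cvgB; [exact: ch|exact: cvg_cst].
    exact: coord_continuous.
  - by move=> t; apply: cvgMr; apply: cvg_sumr => i; exact: ci.
  - by move=> t _; exact: hd.
have bv0 i : 0 <= block_variation D n (hi i).
  rewrite /block_variation !addr_ge0 ?mulr_ge0 ?invr_ge0 ?sumr_ge0// => k _.
  by rewrite Rintegral_ge0.
apply: (@le_trans _ _ (c * \sum_i block_variation D n (hi i))); last first.
  by rewrite ler_wpM2r ?sumr_ge0// lerDr.
have -> : c * \sum_i block_variation D n (hi i) = c * \sum_i `|hi i 0| +
  D^-1 * (\sum_(k < n) c * \sum_i \int[lebesgue_measure]_(t in `[k%:R * D, k.+1%:R * D])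
      `|hi i t - hi i (k%:R * D)|) +
  \sum_(k < n) c * \sum_i `|hi i (k.+1%:R * D) - hi i (k%:R * D)|.
  rewrite !big_split/= !mulrDr -!mulr_sumr [in RHS]exchange_big/=.
  rewrite [X in _ + _ + _ * X = _]exchange_big/= ; congr (_ + _ + _).
  by rewrite mulrCA.
apply: lerD; [apply: lerD => //|by apply: ler_sum].
by rewrite ler_wpM2l ?invr_ge0//; apply: ler_sum => k _; exact: hI.
Qed.

Lemma solution_paths_bound w w' n s : 0 <= s <= n%:R * D ->
  \int[lebesgue_measure]_(t in `[0, s]) enorm (vproc Y t w - vproc Y t w') <=
    solution_constant * \sum_i block_variation D n (fun t => B i t w - B i t w') /\
  \sum_(k < n) enorm (vproc Y (k.+1%:R * D) w - vproc Y (k.+1%:R * D) w') <=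
    solution_constant * \sum_i block_variation D n (fun t => B i t w - B i t w').
Proof.
move=> /andP[s0 sn]; have [] := two_solutions_bound cb alpha0 L0 b_drift (@cy w) (@cy w') (@cg w) (@cg w')
  (@yE w) (@yE w') n D0.
have := sum_enorm_le w w' n; cbv zeta.
set N := (_ + _ + _); set S := \sum_i block_variation _ _ _; set c := 1 + _ => Nc.
have a1 : 0 < alpha^-1 by rewrite invr_gt0.
have a2 : 0 <= (alpha * D)^-1 by rewrite invr_ge0 mulr_ge0// ltW.
have a3 : 0 < L / alpha by rewrite divr_gt0.
have a4 : 0 < L * D by rewrite mulr_gt0.
have a6 : 0 < (L / alpha + 1) * D by rewrite mulr_gt0// addr_gt0.
have Dge0 := ltW D0.
have cS : 0 <= c * S.
  apply: le_trans Nc; rewrite /N !addr_ge0 ?mulr_ge0 ?invr_ge0 ?sumr_ge0 ?enorm_ge0//.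
    by move=> k _; rewrite Rintegral_ge0// => t _; exact: enorm_ge0.
  by move=> k _; exact: enorm_ge0.
rewrite /solution_constant -/c -mulrA.
have cz : continuous (fun t => enorm (y w t - y w' t)).
  apply: continuous_enorm => i t.
  apply: (@continuous_comp _ _ _ (fun t => y w t - y w' t) (fun M : 'cV[R]_d => M i 0)).
    by apply: cvgB; exact: cy.
  exact: coord_continuous.
have -> : \int[lebesgue_measure]_(t in `[0, s]) enorm (vproc Y t w - vproc Y t w') =
    \int[lebesgue_measure]_(t in `[0, s]) enorm (y w t - y w' t).
  by apply: eq_Rintegral => t; rewrite inE/= in_itv/= => /andP[t0 _]; rewrite /y max_r.
rewrite (eq_bigr (fun k : 'I_n => enorm (vproc Y (k.+1%:R * D) w - vproc Y (k.+1%:R * D) w')));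
  last by move=> k _; rewrite /y max_r// mulr_ge0.
move=> h1 h2; split.
  apply: (@le_trans _ _ (\int[lebesgue_measure]_(t in `[0, n%:R * D]) enorm (y w t - y w' t))).
    rewrite (Rintegral_split cz s0 sn) lerDl Rintegral_ge0// => t _.
    exact: enorm_ge0.
  apply: le_trans h1 _; apply: le_trans (ler_wpM2l _ Nc) _; first by rewrite addr_ge0// ltW.
  by apply: ler_wpM2r => //; lra.
apply: le_trans h2 _; apply: le_trans (ler_wpM2l _ Nc) _; first by lra.
by apply: ler_wpM2r => //; lra.
Qed.

End solution_paths.

Section distances.
Context {R : realType} {d : nat}.

Lemma dist_n_ge0 n (x y : 'I_n -> 'cV[R]_d) : 0 <= dist_n x y.
Proof. by rewrite sumr_ge0// => i _; exact: enorm_ge0. Qed.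

Lemma dist_nxx n (x : 'I_n -> 'cV[R]_d) : dist_n x x = 0.
Proof. by rewrite /dist_n big1// => i _; rewrite subrr enorm0. Qed.

Lemma dist_T_ge0 (T : R) (x y : cpath d T) : 0 <= dist_T x y.
Proof.
rewrite /dist_T Rintegral_ge0// => t _ /=.
by case: ('oinv_set_val t) => //= u; exact: enorm_ge0.
Qed.

Lemma dist_Txx (T : R) (x : cpath d T) : dist_T x x = 0.
Proof.
rewrite /dist_T /Rintegral integral0_eq// => t _ /=.
by case: ('oinv_set_val t) => //= u; rewrite subrr enorm0.
Qed.

Lemma dist_T_solution_path disp (Omega : measurableType disp) (P : probability Omega R)
    (b : 'cV[R]_d -> 'cV[R]_d) (sigma : 'M[R]_d) (x : 'cV[R]_d)
    (B Y : 'I_d -> R -> {RV P >-> R}) (hY : solution b sigma x B Y) (T : R) (w w' : Omega) :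
  dist_T (solution_path hY T w) (solution_path hY T w') =
  \int[lebesgue_measure]_(t in `[0, T]) enorm (vproc Y t w - vproc Y t w').
Proof.
apply: eq_Rintegral => t tT.
pose h s := enorm (vproc Y s w - vproc Y s w').
have := congr1 (fun k => k h t) (@sigLK _ _ (0 : R) `[0, T]%classic).
by rewrite patchT//; apply.
Qed.

End distances.

(** Composes the Lipschitz norm of [F] with the pathwise constant [K]; the scale [s] and constant
    [C] are free so that n blocks can be compared with a real horizon T. *)
Lemma lipschitz_concentration {R : realType} disp (T : measurableType disp)
    (P : probability T R) (d : nat) (H : R) (B : 'I_d -> R -> {RV P >-> R})
    (D : R) (n : nat) (K C s r : R) (E : Type) (dist : E -> E -> R) (F : E -> R) (y : T -> E) :
  0 < H < 1 -> fbm H B -> 0 < D -> (0 < n)%N -> 0 < K ->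
  (forall a b, 0 <= dist a b) -> (forall a, dist a a = 0) -> lipschitz_wrt dist F ->
  (forall w w', dist (y w) (y w') <=
    K * \sum_i block_variation D n (fun t => B i t w - B i t w')) ->
  fbm_constant H D d * K ^+ 2 * n%:R `^ Num.max (2 * H) 1 <= C * s -> 0 <= r ->
  (P [set t | r%:E < (F (y t))%:E - 'E_P[F \o y]] <=
    (concentration_bound C (lip_norm dist F) s r)%:E)%E.
Proof.
move=> H01 hB D0 n0 K0 dist_ge0 distxx lF yK Cs r0.
have FP := lip_normP dist_ge0 distxx lF.
have := lip_norm_ge0 F dist_ge0; rewrite /concentration_bound.
set lip := lip_norm dist F in FP *; rewrite le_eqVlt => /orP[/eqP lip0|lip0].
  rewrite -lip0 eqxx.
  (* With zero Lipschitz norm the variable is constant, so the event of a deviation strictly above r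
     >= 0 is empty. *)
  have [t0 FE] : exists c : R, F \o y = cst c.
    have [[w]|T0] := pselect ([set: T] !=set0).
      exists (F (y w)); apply/funext => w' /=; apply/eqP; rewrite -subr_eq0 -normr_le0.
      by apply: le_trans (FP _ _) _; rewrite -lip0 mul0r.
    by exists 0; apply/funext => w; case: T0; exists w.
  rewrite [X in P X](_ : _ = set0) ?measure0; first by case: ifP.
  apply/seteqP; split=> // w /=; rewrite FE expectation_cst.
  have -> : F (y w) = t0 by rewrite -[LHS]/((F \o y) w) FE.
  by rewrite subee// lte_fin ltNge r0.
rewrite gt_eqF//.
have np0 : 0 < n%:R `^ Num.max (2 * H) 1 :> R by rewrite powR_gt0 ?ltr0n.
have c0 := fbm_constant_gt0 H d D0.
have lK : 0 < lip * K by rewrite mulr_gt0.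
apply: le_trans (fbm_concentration (G := F \o y) H01 hB D0 n0 lK _ r0) _.
  move=> w w'; apply: le_trans (FP _ _) _; rewrite -mulrA ler_pM2l//; exact: yK.
rewrite lee_fin ler_expR lerN2.
have A0 : 0 < fbm_constant H D d * K ^+ 2 * n%:R `^ Num.max (2 * H) 1.
  exact: mulr_gt0 (mulr_gt0 c0 (exprn_gt0 2 K0)) np0.
have l20 : 0 < lip ^+ 2 by rewrite exprn_gt0.
rewrite ler_wpM2l ?sqr_ge0// lef_pV2 ?posrE.
- rewrite exprMn.
  have := ler_wpM2l (ltW l20) Cs; lra.
- rewrite (_ : 4 * C * lip ^+ 2 * s = 4 * lip ^+ 2 * (C * s)); last by ring.
  by apply: (mulr_gt0 _ (lt_le_trans A0 Cs)); apply: (mulr_gt0 _ l20).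
- apply: (mulr_gt0 _ np0); apply: (mulr_gt0 _ (exprn_gt0 2 lK)); exact: mulr_gt0 _ c0.
Qed.

Theorem theorem2p2 (R : realType) (d : nat) (b : 'cV[R]_d -> 'cV[R]_d)
    (hb : continuous b)
    (hb_drift : exists alpha L : R, [/\ 0 < alpha, 0 < L &
      forall y z : 'cV[R]_d,
        scalprod (b y - b z) (y - z) <= - alpha * enorm (y - z) ^+ 2 /\
        enorm (b y - b z) <= L * enorm (y - z)])
    (H : R) (hH : 0 < H < 1) (sigma : 'M[R]_d) :
  (forall Delta : R, 0 < Delta ->
    exists C : R, 0 < C /\
    forall (disp : measure_display) (Omega : measurableType disp)
      (P : probability Omega R) (B Y : 'I_d -> R -> {RV P >-> R})
      (x : 'cV[R]_d) (hB : fbm H B) (hY : solution b sigma x B Y)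
      (n : nat), (0 < n)%N ->
    forall F : ('I_n -> 'cV[R]_d) -> R, lipschitz_wrt dist_n F ->
    forall r : R, 0 <= r ->
    let F_Y := fun w : Omega =>
      F (fun k : 'I_n => vproc Y (k.+1%:R * Delta) w) in
    (P [set w | r%:E < (F_Y w)%:E - 'E_P[F_Y]] <=
      (concentration_bound C (lip_norm dist_n F)
         (n%:R `^ Num.max (2 * H) 1) r)%:E)%E)
  /\
  (exists C : R, 0 < C /\
    forall (disp : measure_display) (Omega : measurableType disp)
      (P : probability Omega R) (B Y : 'I_d -> R -> {RV P >-> R})
      (x : 'cV[R]_d) (hB : fbm H B) (hY : solution b sigma x B Y)
      (T : R), 1 <= T ->
    forall F : cpath d T -> R, lipschitz_wrt dist_T F ->
    forall r : R, 0 <= r ->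
    let F_Y := fun w : Omega =>
      F (solution_path hY T w) in
    (P [set w | r%:E < (F_Y w)%:E - 'E_P[F_Y]] <=
      (concentration_bound C (lip_norm dist_T F)
         (T `^ Num.max (2 * H) 1) r)%:E)%E).
Proof.
have [alpha [L [alpha0 L0 b_drift]]] := hb_drift; split=> [Delta Delta0|].
  have K0 := solution_constant_gt0 sigma alpha0 L0 Delta0.
  exists (fbm_constant H Delta d * solution_constant sigma alpha L Delta ^+ 2); split.
    by rewrite mulr_gt0 ?fbm_constant_gt0 ?exprn_gt0.
  move=> disp Omega P B Y x hB hY n n0 F lF r r0; cbv zeta.
  pose y w (k : 'I_n) := vproc Y (k.+1%:R * Delta) w.
  apply: (lipschitz_concentration (F := F) (y := y)
    hH hB Delta0 n0 K0 (@dist_n_ge0 _ _ n) (@dist_nxx _ _ n)) => // w w'.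
  (* The horizon s only concerns the time integral, which is discarded here, so 0 will do. *)
  have [|_] := solution_paths_bound hb alpha0 L0 Delta0 b_drift hB hY w w' (n := n) (s := 0) _.
    by rewrite lexx mulr_ge0// ltW.
  exact.
have K0 := solution_constant_gt0 sigma alpha0 L0 (@ltr01 R).
(* The 4 absorbs the rounding of T to n unit blocks: n <= T + 1 <= 2T because T >= 1, and
   2^(max(2H,1)) <= 4. *)
exists (4 * (fbm_constant H 1 d * solution_constant sigma alpha L 1 ^+ 2)); split.
  apply: mulr_gt0 => //; apply: mulr_gt0 (exprn_gt0 2 K0); exact: fbm_constant_gt0.
move=> disp Omega P B Y x hB hY T T1 F lF r r0; cbv zeta.
have T0 : 0 <= T by rewrite (le_trans _ T1).
pose n := (Num.truncn T).+1.
have /andP[n1 n2] := truncn_itv T0.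
have nT : n%:R <= 2 * T by rewrite /n -natr1; lra.
apply: (lipschitz_concentration (F := F) (y := solution_path hY T) (n := n)
    hH hB ltr01 _ K0 (@dist_T_ge0 _ _ T) (@dist_Txx _ _ T)) => // [w w'|].
  have [|+ _] := solution_paths_bound hb alpha0 L0 ltr01 b_drift hB hY w w' (n := n) (s := T) _.
    by rewrite T0 mulr1 ltW.
  by apply: le_trans; rewrite dist_T_solution_path.
set g := Num.max (2 * H) 1.
have g0 : 0 <= g by rewrite le_max ler01 orbT.
have g2 : g <= 2%:R by rewrite ge_max; case/andP: hH => *; apply/andP; split; lra.
have two_g : 2 `^ g <= 4 :> R.
  have := ler_powR (ler1n R 2) g2; rewrite powR_mulrn//.
  by move=> h; apply: le_trans h _; lra.
have nTg : n%:R `^ g <= 4 * T `^ g.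
  apply: le_trans (ge0_ler_powR g0 _ _ nT) _; rewrite ?nnegrE ?mulr_ge0//.
  by rewrite powRM// ler_wpM2r ?powR_ge0.
have cK0 : 0 <= fbm_constant H 1 d * solution_constant sigma alpha L 1 ^+ 2.
  by apply: mulr_ge0 (sqr_ge0 _); apply: ltW; exact: fbm_constant_gt0.
have := ler_wpM2l cK0 nTg; set c := _ * _ ^+ 2; lra.
Qed.
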